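(* Let $(M^3,g)$ be a $3$-dimensional simply connected Riemannian manifold. Assume that $|\widetilde{R}|\neq 0$ everywhere on $M^3$. Then $(M^3,g)$ can be locally isometrically embedded into $\mathbb{R}^4$ (every point of $M^3$ has an open neighborhood $U$ admitting a smooth isometric embedding $f:(U,g|_U)\to\mathbb{R}^4$) if and only if $|\widetilde{R}|>0$ and the six equalities $r_1=r_2=r_3=r_4=r_5=r_6=0$ hold everywhere on $M^3$.
   Context: Isometric embedding: a smooth embedding $f$ with $\langle df,df\rangle=g$, where $\langle\,,\rangle$ is the standard inner product of $\mathbb{R}^4$. Let $\nabla$ be the Levi-Civita connection, $R(X,Y)Z=\nabla_X\nabla_YZ-\nabla_Y\nabla_XZ-\nabla_{[X,Y]}Z$. For local vector fields $X_1,X_2,X_3$ forming a basis of each tangent space put $R_{ijkl}=-g(R(X_i,X_j)X_k,X_l)=:R(X_i,X_j,X_k,X_l)$ and $S_{ijklm}=(\nabla_{X_m}R)(X_i,X_j,X_k,X_l)$. $|\widetilde{R}|=\begin{vmatrix}R_{1212}&R_{1213}&R_{1223}\\R_{1213}&R_{1313}&R_{1323}\\R_{1223}&R_{1323}&R_{2323}\end{vmatrix}.$ With the abbreviations $C_{11}=R_{1212}R_{1313}-R_{1213}^2$, $C_{12}=R_{1212}R_{1323}-R_{1213}R_{1223}$, $C_{13}=R_{1213}R_{1323}-R_{1223}R_{1313}$, $C_{22}=R_{1212}R_{2323}-R_{1223}^2$, $C_{23}=R_{1213}R_{2323}-R_{1223}R_{1323}$, $C_{33}=R_{1313}R_{2323}-R_{1323}^2$,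 the polynomials $r_1,\dots,r_6$ (Rivertz's polynomials) are: $r_1=C_{23}S_{12121}-C_{13}S_{12122}-C_{22}S_{12131}+C_{12}S_{12132}+C_{12}S_{12231}-C_{11}S_{12232}$, $r_2=C_{33}S_{12121}-2C_{13}S_{12123}-C_{11}S_{12233}-C_{22}S_{13131}+2C_{12}S_{13132}-C_{11}S_{13232}$, $r_3=C_{33}S_{12122}-2C_{23}S_{12123}+C_{22}S_{12133}-C_{22}S_{13231}+2C_{12}S_{23231}-C_{11}S_{23232}$, $r_4=C_{33}S_{12131}-C_{13}S_{12133}-C_{23}S_{13131}+C_{12}S_{13133}+C_{13}S_{13231}-C_{11}S_{13233}$, $r_5=C_{33}S_{12132}+C_{33}S_{12231}-2C_{23}S_{13132}+C_{22}S_{13133}+2C_{13}S_{23231}-C_{11}S_{23233}$, $r_6=C_{33}S_{12232}-C_{23}S_{12233}-C_{23}S_{13232}+C_{22}S_{13233}+C_{13}S_{23232}-C_{12}S_{23233}$. The sign (and vanishing) of $|\widetilde R|$ and the simultaneous vanishing of $r_1,\dots,r_6$ at a point do not depend on the chosen basis of the tangent space. *)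

(* Defs.v *)
From HB Require Import structures.
From mathcomp Require Import all_boot all_order all_algebra.
From mathcomp Require Import all_classical all_reals all_analysis.

Set Implicit Arguments.
Unset Strict Implicit.
Unset Printing Implicit Defensive.

Import Order.TTheory GRing.Theory Num.Theory.
Import numFieldNormedType.Exports.

Local Open Scope classical_set_scope.
Local Open Scope ring_scope.

Section Smoothness.
Context {R : realType} {V W : normedModType R}.

Fixpoint Ck (k : nat) (A : set V) (f : V -> W) : Prop :=
  match k with
  | 0 => forall x, A x -> {for x, continuous f}
  | k'.+1 => (forall x, A x -> differentiable f x) /\
             (forall v, Ck k' A (fun x => 'D_v f x))
  end.

(* To be used on open sets only. *)
Definition smooth (A : set V) (f : V -> W) : Prop := forall k, Ck k A f.

End Smoothness.

Section SimplyConnected.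
Variables (R : realType) (T : topologicalType).

Definition path_connected : Prop :=
  forall p q : T, exists gamma : R -> T,
    [/\ {within `[0, 1], continuous gamma}, gamma 0 = p & gamma 1 = q].

Definition null_homotopic_loop (gamma : R -> T) : Prop :=
  exists H : R * R -> T,
    [/\ {within `[0, 1]%classic `*` `[0, 1]%classic, continuous H},
        forall t : R, 0 <= t <= 1 -> H (0, t) = gamma t,
        forall t : R, 0 <= t <= 1 -> H (1, t) = gamma 0 &
        forall s : R, 0 <= s <= 1 -> H (s, 0) = gamma 0 /\ H (s, 1) = gamma 0].

Definition simply_connected : Prop :=
  [/\ [set: T] !=set0, path_connected &
      forall gamma : R -> T, {within `[0, 1], continuous gamma} ->
        gamma 0 = gamma 1 -> null_homotopic_loop gamma].

End SimplyConnected.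

Section Manifolds.
Context {R : realType}.

(* [chart_coord] and [chart_param] are total functions; only their values on
   [chart_dom] and [chart_coord @` chart_dom] are meaningful. *)
Record chart (T : topologicalType) (n : nat) := Chart {
  chart_dom : set T;
  chart_coord : T -> 'rV[R]_n;
  chart_param : 'rV[R]_n -> T;
  chart_dom_open : open chart_dom;
  chart_image_open : open (chart_coord @` chart_dom);
  chart_coordK : forall p, chart_dom p -> chart_param (chart_coord p) = p;
  chart_coord_continuous :
    forall p, chart_dom p -> {for p, continuous chart_coord};
  chart_param_continuous :
    forall x, (chart_coord @` chart_dom) x -> {for x, continuous chart_param}
}.

Definition transition (T : topologicalType) n (c d : chart T n) :
    'rV[R]_n -> 'rV[R]_n :=
  chart_coord d \o chart_param c.

Definition overlap (T : topologicalType) n (c d : chart T n) : set 'rV[R]_n :=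
  chart_coord c @` (chart_dom c `&` chart_dom d).

Record smoothManifold (n : nat) := SmoothManifold {
  carrier :> topologicalType;
  atlas : set (chart carrier n);
  manifold_hausdorff : hausdorff_space carrier;
  manifold_second_countable : @second_countable carrier;
  atlas_cover : forall p : carrier, exists2 c, atlas c & chart_dom c p;
  atlas_compatible : forall c d, atlas c -> atlas d ->
    smooth (overlap c d) (transition c d)
}.

Definition bilin n (A : 'M[R]_n) (v w : 'rV[R]_n) : R := (v *m A *m w^T) 0 0.

(* [gram c x] is the Gram matrix of the coordinate frame of the chart [c] at
   the point with coordinates [x]; [gram_compatible] says that these matrices
   represent one tensor on the manifold. *)
Record riemannianMetric (n : nat) (M : smoothManifold n) := RiemannianMetric {
  gram : chart M n -> 'rV[R]_n -> 'M[R]_n;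
  gram_smooth : forall c, atlas c ->
    smooth (chart_coord c @` chart_dom c) (gram c);
  gram_sym : forall c x, atlas c -> (chart_coord c @` chart_dom c) x ->
    (gram c x)^T = gram c x;
  gram_pos : forall c x (v : 'rV[R]_n), atlas c ->
    (chart_coord c @` chart_dom c) x -> v != 0 -> 0 < bilin (gram c x) v v;
  gram_compatible : forall c d x v w, atlas c -> atlas d -> overlap c d x ->
    bilin (gram c x) v w =
    bilin (gram d (transition c d x))
      ('D_v (transition c d) x) ('D_w (transition c d) x)
}.

End Manifolds.

Arguments smoothManifold R n : clear implicits.

Section LeviCivita.
Context {R : realType} {n : nat}.
Implicit Types (X Y Z W U : 'rV[R]_n -> 'rV[R]_n).
Variable g : 'rV[R]_n -> 'M[R]_n.

Definition basis_vector (i : 'I_n) : 'rV[R]_n := delta_mx 0 i.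

Definition dmetric (i j k : 'I_n) (x : 'rV[R]_n) : R :=
  'D_(basis_vector i) (fun y => g y j k) x.

Definition christoffel (k i j : 'I_n) (x : 'rV[R]_n) : R :=
  2^-1 * \sum_l invmx (g x) k l *
           (dmetric i j l x + dmetric j i l x - dmetric l i j x).

Definition nabla X Y : 'rV[R]_n -> 'rV[R]_n := fun x =>
  'D_(X x) Y x +
  \row_k \sum_i \sum_j christoffel k i j x * X x 0 i * Y x 0 j.

Definition lie_bracket X Y : 'rV[R]_n -> 'rV[R]_n := fun x =>
  'D_(X x) Y x - 'D_(Y x) X x.

Definition curvature X Y Z : 'rV[R]_n -> 'rV[R]_n := fun x =>
  nabla X (nabla Y Z) x - nabla Y (nabla X Z) x - nabla (lie_bracket X Y) Z x.

Definition riemann X Y Z W : 'rV[R]_n -> R := fun x =>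
  - bilin (g x) (curvature X Y Z x) (W x).

(* $(\nabla_U R)(X,Y,Z,W)$ for the covariant 4-tensor [riemann] *)
Definition nabla_riemann U X Y Z W : 'rV[R]_n -> R := fun x =>
  'D_(U x) (riemann X Y Z W) x
  - riemann (nabla U X) Y Z W x - riemann X (nabla U Y) Z W x
  - riemann X Y (nabla U Z) W x - riemann X Y Z (nabla U W) x.

End LeviCivita.

Section Rivertz.
Context {R : realType}.
Variables (g : 'rV[R]_3 -> 'M[R]_3) (X : 'I_3 -> 'rV[R]_3 -> 'rV[R]_3).
Variable x : 'rV[R]_3.

(* Indices are numbered 1, 2, 3. *)
Definition frame (i : nat) : 'rV[R]_3 -> 'rV[R]_3 := X (inord i.-1).

Definition Rc (i j k l : nat) : R :=
  riemann g (frame i) (frame j) (frame k) (frame l) x.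

Definition Sc (i j k l m : nat) : R :=
  nabla_riemann g (frame m) (frame i) (frame j) (frame k) (frame l) x.

Definition Rtilde : 'M[R]_3 :=
  \matrix_(a, b) nth 0 (nth [::]
    [:: [:: Rc 1 2 1 2; Rc 1 2 1 3; Rc 1 2 2 3];
        [:: Rc 1 2 1 3; Rc 1 3 1 3; Rc 1 3 2 3];
        [:: Rc 1 2 2 3; Rc 1 3 2 3; Rc 2 3 2 3]] a) b.

Definition C11 : R := Rc 1 2 1 2 * Rc 1 3 1 3 - Rc 1 2 1 3 ^+ 2.
Definition C12 : R := Rc 1 2 1 2 * Rc 1 3 2 3 - Rc 1 2 1 3 * Rc 1 2 2 3.
Definition C13 : R := Rc 1 2 1 3 * Rc 1 3 2 3 - Rc 1 2 2 3 * Rc 1 3 1 3.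
Definition C22 : R := Rc 1 2 1 2 * Rc 2 3 2 3 - Rc 1 2 2 3 ^+ 2.
Definition C23 : R := Rc 1 2 1 3 * Rc 2 3 2 3 - Rc 1 2 2 3 * Rc 1 3 2 3.
Definition C33 : R := Rc 1 3 1 3 * Rc 2 3 2 3 - Rc 1 3 2 3 ^+ 2.

Definition r1 : R :=
  C23 * Sc 1 2 1 2 1 - C13 * Sc 1 2 1 2 2 - C22 * Sc 1 2 1 3 1
  + C12 * Sc 1 2 1 3 2 + C12 * Sc 1 2 2 3 1 - C11 * Sc 1 2 2 3 2.

Definition r2 : R :=
  C33 * Sc 1 2 1 2 1 - 2 * C13 * Sc 1 2 1 2 3 - C11 * Sc 1 2 2 3 3
  - C22 * Sc 1 3 1 3 1 + 2 * C12 * Sc 1 3 1 3 2 - C11 * Sc 1 3 2 3 2.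

Definition r3 : R :=
  C33 * Sc 1 2 1 2 2 - 2 * C23 * Sc 1 2 1 2 3 + C22 * Sc 1 2 1 3 3
  - C22 * Sc 1 3 2 3 1 + 2 * C12 * Sc 2 3 2 3 1 - C11 * Sc 2 3 2 3 2.

Definition r4 : R :=
  C33 * Sc 1 2 1 3 1 - C13 * Sc 1 2 1 3 3 - C23 * Sc 1 3 1 3 1
  + C12 * Sc 1 3 1 3 3 + C13 * Sc 1 3 2 3 1 - C11 * Sc 1 3 2 3 3.

Definition r5 : R :=
  C33 * Sc 1 2 1 3 2 + C33 * Sc 1 2 2 3 1 - 2 * C23 * Sc 1 3 1 3 2
  + C22 * Sc 1 3 1 3 3 + 2 * C13 * Sc 2 3 2 3 1 - C11 * Sc 2 3 2 3 3.

Definition r6 : R :=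
  C33 * Sc 1 2 2 3 2 - C23 * Sc 1 2 2 3 3 - C23 * Sc 1 3 2 3 2
  + C22 * Sc 1 3 2 3 3 + C13 * Sc 2 3 2 3 2 - C12 * Sc 2 3 2 3 3.

End Rivertz.

Section LocalFrames.
Context {R : realType} {n : nat} (M : smoothManifold R n).

(* A smooth local frame of the manifold over the open set [chart_param c @` A],
   written in the coordinates of the chart [c]. *)
Definition local_frame (c : chart M n) (A : set 'rV[R]_n)
    (X : 'I_n -> 'rV[R]_n -> 'rV[R]_n) : Prop :=
  [/\ open A, A `<=` chart_coord c @` chart_dom c, forall i, smooth A (X i) &
      forall x, A x -> (\matrix_i X i x) \in unitmx].

(* The property [P] of a metric, a local frame and a point holds at every point
   of the manifold, with respect to every local frame around it. *)
Definition holds_everywhere (g : riemannianMetric M)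
    (P : ('rV[R]_n -> 'M[R]_n) -> ('I_n -> 'rV[R]_n -> 'rV[R]_n) ->
         'rV[R]_n -> Prop) : Prop :=
  forall c A X, atlas c -> local_frame c A X ->
    forall x, A x -> P (gram g c) X x.

End LocalFrames.

Section IsometricEmbedding.
Context {R : realType} {n : nat} (M : smoothManifold R n).
Variable g : riemannianMetric M.

Definition dot N (v w : 'rV[R]_N) : R := (v *m w^T) 0 0.

Definition smooth_embedding N (U : set M) (f : M -> 'rV[R]_N) : Prop :=
  [/\ forall c, atlas c ->
        smooth (chart_coord c @` (chart_dom c `&` U)) (f \o chart_param c),
      forall c x (v : 'rV[R]_n), atlas c ->
        (chart_coord c @` (chart_dom c `&` U)) x ->
        'D_v (f \o chart_param c) x = 0 -> v = 0 &
      exists h : 'rV[R]_N -> M,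
        (forall p, U p -> h (f p) = p) /\ {within f @` U, continuous h}].

Definition isometric_embedding N (U : set M) (f : M -> 'rV[R]_N) : Prop :=
  smooth_embedding U f /\
  (forall c x v w, atlas c -> (chart_coord c @` (chart_dom c `&` U)) x ->
     dot ('D_v (f \o chart_param c) x) ('D_w (f \o chart_param c) x) =
     bilin (gram g c x) v w).

Definition locally_isometrically_embeddable (N : nat) : Prop :=
  forall p : M, exists U : set M,
    [/\ open U, U p & exists f : M -> 'rV[R]_N, isometric_embedding U f].

End IsometricEmbedding.

(* Main.v *)
Require Import Defs.
From HB Require Import structures.
From mathcomp Require Import all_boot all_order all_algebra.
From mathcomp Require Import all_classical all_reals all_analysis.
From mathcomp Require Import ring lra.
Set Implicit Arguments.
Unset Strict Implicit.
Unset Printing Implicit Defensive.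
Import Order.TTheory GRing.Theory Num.Theory.
Import numFieldNormedType.Exports.
Local Open Scope classical_set_scope.
Local Open Scope ring_scope.

(**
Vectors are rows. In a chart the Levi-Civita connection is a matrix-valued
1-form [Gam x u], with [nabla_u Y = 'D_u Y + Y *m Gam x u], and its curvature
[Om x u v] acts by right multiplication.

Necessity: a hypersurface has a second fundamental form [H], with
[Om x u v *m g x = H x *m (v^T *m u - u^T *m v) *m H x] (Gauss) and [nabla H]
totally symmetric (Codazzi). Gauss gives [Rtilde] as the second compound of
[H], so that [\det Rtilde = (\det H) ^+ 2]; differentiating Gauss and using
the symmetry of [nabla H], the polynomials [r1 .. r6] vanish identically.

Sufficiency: when [\det Rtilde > 0], the [C_ij] divided by the square root of
[\det Rtilde] define a form [H] satisfying Gauss. Its Codazzi defect has nine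
components; up to an invertible matrix they are [r1 .. r6] and the three
components of the second Bianchi identity, so [H] satisfies Codazzi. Hence the
linear system for the position, the tangent frame and the normal of a
hypersurface with data [g] and [H] is integrable. It is solved along rays, and
the isometry property is propagated by a linear differential equation.
*)

(** * Calculus of matrix-valued maps *)

(** The analytic obstacle is the dependence of the ray solutions on their endpoint. No theorem on
    parameters is invoked: the solution at a nearby endpoint is compared with an explicit
    first-order variation, and flatness makes the error quadratic. Shrinking the ball makes the
    coefficients so small that Picard iteration converges on the whole unit segment and that a
    Gronwall bound follows from one maximum, without exponentials. Solving for the position together
    with the frame makes the closedness of the differential of the immersion part of the same
    flatness condition. Gauss determines the form only up to sign, because its second compound is
    even in it; the positive square root selects the sign for which [\det H] is positive, and the
    opposite sign belongs to the mirror image. Nondegeneracy is used twice: to divide by the root,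
    and to invert the cofactor matrix that multiplies the Codazzi defect. The curvature identities
    all come from the symmetry of second derivatives, followed by an identity between noncommuting
    matrices. *)

Section MatrixEntries.
Context {R : pzRingType} {m n : nat}.
Implicit Types A B : 'M[R]_(m, n).

Lemma addmx_entry A B i j : (A + B) i j = A i j + B i j.
Proof. by rewrite mxE. Qed.

Lemma oppmx_entry A i j : (- A) i j = - A i j.
Proof. by rewrite mxE. Qed.

Lemma scalemx_entry (a : R) A i j : (a *: A) i j = a * A i j.
Proof. by rewrite mxE. Qed.

Lemma zeromx_entry i j : (0 : 'M[R]_(m, n)) i j = 0.
Proof. by rewrite mxE. Qed.

End MatrixEntries.

Definition mx_entryE := (@addmx_entry, @oppmx_entry, @scalemx_entry, @zeromx_entry).

Lemma trmx_add (R : pzRingType) m n (A B : 'M[R]_(m, n)) : (A + B)^T = A^T + B^T.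
Proof. exact: raddfD. Qed.

Lemma trmx_opp (R : pzRingType) m n (A : 'M[R]_(m, n)) : (- A)^T = - A^T.
Proof. exact: raddfN. Qed.

Ltac mx_distr := rewrite ?(trmx_add, trmx_opp, trmx_mul, trmxK);
  rewrite ?(mulmxDl, mulmxDr, mulmxN, mulNmx, mulmx0, mul0mx) ?mulmxA.

Ltac mx_ring := apply/matrixP => ? ?; rewrite !mx_entryE; ring.

Section Calculus.
Context {R : realType}.
Implicit Types V W : normedModType R.

Lemma mx_norm_le m n (M : 'M[R]_(m, n)) (K : R) :
  0 <= K -> (forall i j, `|M i j| <= K) -> `|M| <= K.
Proof.
by move=> K0 MK; rewrite [leLHS]/Num.Def.normr/= mx_normrE bigmax_le.
Qed.

Lemma mx_entry_le m n (M : 'M[R]_(m, n)) i j : `|M i j| <= `|M|.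
Proof.
by rewrite [leRHS]/Num.Def.normr/= mx_normrE; exact: (le_bigmax _ _ (i, j)).
Qed.

Lemma mx_norm_mul m n p (A : 'M[R]_(m, n)) (B : 'M[R]_(n, p)) :
  `|A *m B| <= n%:R * `|A| * `|B|.
Proof.
apply: mx_norm_le => [|i j]; first by rewrite !mulr_ge0.
rewrite mxE (le_trans (ler_norm_sum _ _ _))//.
rewrite (@le_trans _ _ (\sum_(k < n) `|A| * `|B|))//; last first.
  by rewrite sumr_const card_ord -mulrA mulr_natl.
by apply: ler_sum => k _; rewrite normrM ler_pM// mx_entry_le.
Qed.

Lemma derive_chain V1 V W (g : V1 -> V) (f : V -> W) x v :
  differentiable g x -> differentiable f (g x) ->
  'D_v (fun y => f (g y)) x = 'D_('D_v g x) f (g x).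
Proof.
move=> dg df; rewrite -[fun y => f (g y)]/(f \o g).
rewrite [LHS]deriveE; last exact: differentiable_comp.
by rewrite diff_comp// [RHS]deriveE// [in RHS]deriveE.
Qed.

Lemma is_derive_line V W (f : V -> W) p u (t : R) :
  differentiable f (p + t *: u) ->
  is_derive t 1 (fun s : R => f (p + s *: u)) ('D_u f (p + t *: u)).
Proof.
move=> df; have dl : is_diff t (fun s : R => p + s *: u) (fun s : R => s *: u).
  have h : is_diff t (cst p + ( *:%R^~ u : R -> V)) (0 + *:%R^~ u).
    exact: is_diffD.
  by apply: (is_diff_eq h); apply/funext => s; rewrite /GRing.add/= add0r.
have dl1 : differentiable (fun s : R => p + s *: u) t by exact: ex_diff.
split.
  apply: diff_derivable.
  exact: (@differentiable_comp _ _ _ _ (fun s : R => p + s *: u) f).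
rewrite (@derive_chain _ _ _ (fun s : R => p + s *: u) f)//.
by rewrite [X in derive _ _ X]deriveE// diff_val scale1r.
Qed.

Lemma derivative_add V W (f : V -> W) x u v : differentiable f x ->
  'D_(u + v) f x = 'D_u f x + 'D_v f x.
Proof. by move=> df; rewrite !deriveE// linearD. Qed.

Lemma derivative_scale V W (f : V -> W) x (a : R) v : differentiable f x ->
  'D_(a *: v) f x = a *: 'D_v f x.
Proof. by move=> df; rewrite !deriveE// linearZ. Qed.

Lemma derivative_sum V W (f : V -> W) x (I : finType) (F : I -> V) :
  differentiable f x -> 'D_(\sum_i F i) f x = \sum_i 'D_(F i) f x.
Proof.
by move=> df; rewrite !deriveE// linear_sum; apply: eq_bigr => i _; rewrite deriveE.
Qed.

Lemma derivative_rV n W (f : 'rV[R]_n -> W) x v : differentiable f x ->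
  'D_v f x = \sum_i v 0 i *: 'D_(delta_mx 0 i) f x.
Proof.
move=> df; rewrite {1}(row_sum_delta v) derivative_sum//.
by apply: eq_bigr => i _; rewrite derivative_scale.
Qed.

(** The matrix norm is the largest absolute value of an entry, so the scalar mean value theorem
    applied to each entry loses no constant. *)
Lemma mean_value_mx m n (f df : R -> 'M[R]_(m, n)) (a b K : R) :
  a <= b -> 0 <= K -> (forall t, t \in `]a, b[%R -> is_derive t 1 f (df t)) ->
  {within `[a, b], continuous f} ->
  (forall t, t \in `]a, b[%R -> `|df t| <= K) ->
  `|f b - f a| <= K * (b - a).
Proof.
rewrite le_eqVlt => /predU1P[<-|ab] K0 fd fc dfK.
  by rewrite !subrr mulr0 normr0.
have ba0 : 0 <= b - a by rewrite subr_ge0 ltW.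
apply: mx_norm_le => [|i j]; first by rewrite mulr_ge0.
have [||c cab] := @MVT R (fun t => f t i j) (fun t => df t i j) a b ab.
- move=> t /fd [dft <-]; have dft' := (derivable_mxP _ _ _).1 dft i j.
  by split => //; rewrite derive_mx// mxE.
- move=> t; apply: (@continuous_comp (subspace `[a, b]) _ _ f
    (fun M : 'M[R]_(m, n) => M i j)); first exact: fc.
  exact: coord_continuous.
rewrite !mxE => ->; rewrite normrM (ger0_norm ba0) ler_wpM2r//.
exact: le_trans (mx_entry_le _ _ _) (dfK _ cab).
Qed.

Lemma derivable_line V W (f : V -> W) p u (t : R) :
  differentiable f (p + t *: u) -> derivable (fun s : R => f (p + s *: u)) t 1.
Proof. by move=> /is_derive_line []. Qed.

Lemma continuous_line V W (f : V -> W) p u (t : R) :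
  differentiable f (p + t *: u) -> {for t, continuous (fun s : R => f (p + s *: u))}.
Proof.
by move=> /derivable_line/derivable1_diffP/differentiable_continuous.
Qed.

Lemma mean_value_segment V m n (f : V -> 'M[R]_(m, n)) p u K : 0 <= K ->
  (forall t : R, 0 <= t <= 1 -> differentiable f (p + t *: u)) ->
  (forall t : R, 0 <= t <= 1 -> `|'D_u f (p + t *: u)| <= K) ->
  `|f (p + u) - f p| <= K.
Proof.
move=> K0 fd dK.
have := @mean_value_mx _ _ (fun s : R => f (p + s *: u))
  (fun s : R => 'D_u f (p + s *: u)) 0 1 K ler01 K0.
rewrite scale1r scale0r addr0 subr0 mulr1; apply => [t|x|t].
- by rewrite in_itv/= => /andP[t0 t1]; apply/is_derive_line/fd; rewrite !ltW.
- apply: continuous_in_subspaceT => t; rewrite inE/= in_itv/= => t01.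
  exact/continuous_line/fd.
- by rewrite in_itv/= => /andP[t0 t1]; apply: dK; rewrite !ltW.
Qed.

Lemma mean_value_eq V (f : V -> R) p u (a : R) : 0 < a ->
  (forall t : R, 0 <= t <= a -> differentiable f (p + t *: u)) ->
  exists2 c, 0 < c < a & f (p + a *: u) - f p = 'D_u f (p + c *: u) * a.
Proof.
move=> a0 fd; have [||c] := @MVT R (fun s : R => f (p + s *: u))
  (fun s : R => 'D_u f (p + s *: u)) 0 a a0.
- move=> t; rewrite in_itv/= => /andP[t0 t1].
  by apply/is_derive_line/fd; rewrite !ltW.
- apply: continuous_in_subspaceT => t; rewrite inE/= in_itv/= => t01.
  exact/continuous_line/fd.
- by rewrite in_itv/= scale0r addr0 subr0 => c0a ->; exists c.
Qed.

Lemma differentiable_translate V W (f : V -> W) c x :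
  differentiable f (x + c) -> differentiable (fun z => f (z + c)) x.
Proof.
by move=> df; apply: (@differentiable_comp _ _ _ _ (fun z : V => z + c) f).
Qed.

Lemma derive_translate V W (f : V -> W) c x v :
  differentiable f (x + c) -> 'D_v (fun z => f (z + c)) x = 'D_v f (x + c).
Proof.
move=> df; rewrite (@derive_chain _ _ _ (fun z : V => z + c) f)//.
congr (derive _ _ _).
rewrite (@deriveD _ _ _ id (cst c))//.
by rewrite derive_id derive_cst addr0.
Qed.

(** Two mean values: one along [u] for the increment [f (z + a *: v) - f z], then one along [v] for
    ['D_u f]. *)
Lemma second_difference V (f : V -> R) (B : set V) p u v (a : R) : 0 < a ->
  (forall s t : R, 0 <= s <= a -> 0 <= t <= a -> B (p + s *: u + t *: v)) ->
  (forall y, B y -> differentiable f y) ->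
  (forall y, B y -> differentiable (fun z => 'D_u f z) y) ->
  exists2 y, B y & f (p + a *: u + a *: v) - f (p + a *: u)
    - (f (p + a *: v) - f p) = 'D_v (fun z => 'D_u f z) y * a * a.
Proof.
move=> a0 Bp fd fdd; pose g z := f (z + a *: v) - f z.
have a0a : 0 <= a <= a by rewrite lexx ltW.
have a00 : 0 <= (0 : R) <= a by rewrite lexx ltW.
have df1 t : 0 <= t <= a -> differentiable f (p + t *: u).
  by move=> ta; have := fd _ (Bp t 0 ta a00); rewrite scale0r addr0.
have df2 t : 0 <= t <= a -> differentiable (fun z => f (z + a *: v)) (p + t *: u).
  by move=> ta; exact/differentiable_translate/fd/Bp.
have [|c /andP[c0 ca] gE] := @mean_value_eq _ g p u a a0.
  by move=> t ta; apply: differentiableB; [exact: df2|exact: df1].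
have cA : 0 <= c <= a by rewrite !ltW.
have [|d /andP[d0 da] DE] :=
  @mean_value_eq _ (fun z => 'D_u f z) (p + c *: u) v a a0.
  by move=> t ta; exact/fdd/Bp.
exists (p + c *: u + d *: v); first by apply: Bp => //; rewrite !ltW.
rewrite -DE; transitivity (g (p + a *: u) - g p) => //; rewrite gE; congr (_ * _).
rewrite deriveB; [|exact/diff_derivable/df2|exact/diff_derivable/df1].
by rewrite derive_translate//; exact/fd/Bp.
Qed.

(** The second difference is symmetric in [u] and [v], so the two mixed derivatives agree at two
    points of any small ball; continuity brings both points to [x]. *)
Lemma schwarz_scalar V (f Duv Dvu : V -> R) (B : set V) x u v : nbhs x B ->
  (forall y, B y -> differentiable f y) ->
  (forall w y, B y -> differentiable (fun z => 'D_w f z) y) ->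
  (forall y, B y -> 'D_v (fun z => 'D_u f z) y = Duv y) ->
  (forall y, B y -> 'D_u (fun z => 'D_v f z) y = Dvu y) ->
  {for x, continuous Duv} -> {for x, continuous Dvu} -> Duv x = Dvu x.
Proof.
move=> Bx fd fdd DuvE DvuE cuv cvu; apply/eqP; rewrite -subr_eq0 -normr_le0.
apply/ler_addgt0Pl => e e0; rewrite addr0.
have [r /= r0 Br] : exists2 r : R, 0 < r & ball x r `<=` [set y |
    [/\ B y, `|Duv x - Duv y| <= e / 2 & `|Dvu x - Dvu y| <= e / 2]].
  have e20 : 0 < e / 2 by rewrite divr_gt0.
  have /cvgrPdist_le/(_ _ e20) H1 := cuv.
  have /cvgrPdist_le/(_ _ e20) H2 := cvu.
  apply/nbhs_ballP.
  by apply: filterS3 Bx H1 H2 => y By H1 H2; split.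
(* This side length keeps the parallelogram spanned by [a *: u] and [a *: v] inside the ball; the
   [1] covers [u = v = 0]. *)
pose a := r / (`|u| + `|v| + 1).
have M0 : 0 < `|u| + `|v| + 1 by rewrite ltr_wpDl// addr_ge0.
have a0 : 0 < a by rewrite divr_gt0.
have bp (s t : R) : 0 <= s <= a -> 0 <= t <= a -> ball x r (x + s *: u + t *: v).
  move=> /andP[s0 sa] /andP[t0 ta]; rewrite -ball_normE /ball_/=.
  rewrite -addrA opprD addNKr normrN (le_lt_trans (ler_normD _ _))// !normrZ.
  rewrite !ger0_norm// (@le_lt_trans _ _ (a * (`|u| + `|v|)))//.
    by rewrite mulrDr lerD// ler_wpM2r.
  by rewrite /a mulrAC ltr_pdivrMr// ltr_pM2l// ltrDl.
have [||y /Br[By y1 _]] := @second_difference _ f (ball x r) x u v a a0 bp.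
  by move=> y /Br[/fd].
  by move=> y /Br[/fdd].
rewrite (DuvE y By) => yE.
have [|||y' /Br[By' _ y2]] := @second_difference _ f (ball x r) x v u a a0.
  by move=> s t sa ta; rewrite addrAC; exact: bp.
  by move=> z /Br[/fd].
  by move=> z /Br[/fdd].
rewrite (DvuE y' By') => yE'.
have E : Duv y = Dvu y'.
  apply: (@mulIf _ a); first by rewrite gt_eqF.
  apply: (@mulIf _ a); first by rewrite gt_eqF.
  rewrite -yE -yE' (addrAC x (a *: v)).
  move: (f (x + a *: u + a *: v)) (f (x + a *: u)) (f (x + a *: v)) (f x).
  by move=> *; ring.
rewrite -(subrKA (Duv y)) (le_trans (ler_normD _ _))// (splitr e) lerD//.
by rewrite E distrC.
Qed.

Lemma differentiable_mxP V m n (f : V -> 'M[R]_(m, n)) x :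
  differentiable f x <-> forall i j, differentiable (fun y => f y i j) x.
Proof.
split=> [df i j|df].
  apply: (@differentiable_comp _ _ _ _ f (fun M : 'M[R]_(m, n) => M i j)) => //.
  exact: differentiable_coord.
rewrite (_ : f = \sum_(i < m) \sum_(j < n) (fun y => f y i j *: delta_mx i j)).
  apply: differentiable_sum => i; apply: differentiable_sum => j.
  exact: differentiableZl.
apply/funext => y; rewrite {1}(matrix_sum_delta (f y)) fct_sumE.
by apply: eq_bigr => i _; rewrite fct_sumE.
Qed.

Lemma derive_mx_entry V m n (f : V -> 'M[R]_(m, n)) x v i j :
  differentiable f x -> ('D_v f x) i j = 'D_v (fun y => f y i j) x.
Proof. by move=> df; rewrite derive_mx ?mxE//; exact: diff_derivable. Qed.

Lemma differentiable_trmx V m n (f : V -> 'M[R]_(m, n)) x :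
  differentiable f x -> differentiable (fun y => (f y)^T) x.
Proof.
move=> /differentiable_mxP df; apply/differentiable_mxP => i j.
have -> : (fun y => (f y)^T i j) = (fun y => f y j i).
  by apply/funext => y; rewrite mxE.
exact: df.
Qed.

Lemma derive_trmx V m n (f : V -> 'M[R]_(m, n)) x v :
  differentiable f x -> 'D_v (fun y => (f y)^T) x = ('D_v f x)^T.
Proof.
move=> df; apply/matrixP => i j; rewrite mxE.
rewrite derive_mx_entry; last exact: differentiable_trmx.
rewrite derive_mx_entry; last exact: df.
have -> : (fun y => (f y)^T i j) = (fun y => f y j i).
  by apply/funext => y; rewrite mxE.
by [].
Qed.

Lemma differentiable_mulmx V m n p (f : V -> 'M[R]_(m, n)) (g : V -> 'M[R]_(n, p)) x :
  differentiable f x -> differentiable g x ->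
  differentiable (fun y => f y *m g y) x.
Proof.
move=> /differentiable_mxP df /differentiable_mxP dg.
apply/differentiable_mxP => i j.
rewrite (_ : (fun _ => _) = \sum_k (fun y => f y i k * g y k j)).
  by apply: differentiable_sum => k; exact: differentiableM.
by apply/funext => y; rewrite mxE fct_sumE.
Qed.

Lemma derive_mulmx V m n p (f : V -> 'M[R]_(m, n)) (g : V -> 'M[R]_(n, p)) x v :
  differentiable f x -> differentiable g x ->
  'D_v (fun y => f y *m g y) x = 'D_v f x *m g x + f x *m 'D_v g x.
Proof.
move=> df dg; have [df' dg'] := ((differentiable_mxP _ _).1 df, (differentiable_mxP _ _).1 dg).
apply/matrixP => i j; rewrite derive_mx_entry; last exact: differentiable_mulmx.
rewrite (_ : (fun _ => _) = \sum_k (fun y => f y i k * g y k j)); last first.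
  by apply/funext => y; rewrite mxE fct_sumE.
rewrite derive_sum; last first.
  by move=> k; apply: diff_derivable; exact: differentiableM.
rewrite !mxE -big_split/=; apply: eq_bigr => k _.
rewrite deriveM; [|exact: diff_derivable..].
rewrite -!derive_mx_entry// /GRing.scale/=.
by move: (f x i k) (g x k j) ('D_v f x i k) ('D_v g x k j) => *; ring.
Qed.

End Calculus.

(** * Closure properties of maps of class [Ck] *)

Section Smooth.
Context {R : realType}.
Implicit Types V W : normedModType R.

(** Differentiability from an estimate with a guessed differential, for maps obtained as limits or
    as solutions, to which no composition rule applies. *)
Lemma differentiable_eps V W (f L : V -> W) x : linear L -> continuous L ->
  (forall e, 0 < e -> \forall h \near (0 : V), `|f (h + x) - f x - L h| <= e * `|h|) ->
  differentiable f x /\ forall v, 'D_v f x = L v.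
Proof.
move=> Llin Lc fL.
pose Lin := GRing.isLinear.Build R V W *:%R L Llin.
pose L' : {linear V -> W} := HB.pack L Lin.
have E : f \o shift x = cst (f x) + L +o_ 0 id.
  apply/eqaddoP => e e0; apply: filterS (fL e e0) => h.
  rewrite (_ : (_ - _) h = f (h + x) - f x - L h)//.
  by rewrite [LHS](_ : _ = f (h + x) - (f x + L h))// opprD addrA.
have dE : 'd f x = L :> (V -> W) := @diff_unique _ _ _ f L' x Lc E.
have df : differentiable f x by apply/diff_locallyP; rewrite dE.
by split=> // v; rewrite deriveE// dE.
Qed.

Lemma differentiable_expansion V W (f : V -> W) x e : differentiable f x ->
  0 < e -> \forall h \near (0 : V), `|f (h + x) - f x - 'D_h f x| <= e * `|h|.
Proof.
move=> df e0; have /eqaddoP/(_ _ e0) := diff_locally df; apply: filterS => h.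
rewrite [X in `|X| <= _](_ : _ = f (h + x) - (f x + 'd f x h))//.
by rewrite opprD addrA deriveE.
Qed.

Lemma near_differentiable V W (f g : V -> W) x : {near x, f =1 g} ->
  differentiable f x -> differentiable g x.
Proof.
move=> fg df; have gx := nbhs_singleton fg.
suff [] : differentiable g x /\ forall v, 'D_v g x = 'd f x v by [].
apply: differentiable_eps => [||e e0].
- exact: linearP.
- exact: diff_continuous.
have h1 := differentiable_expansion df e0.
have h2 : \forall h \near (0 : V), f (h + x) = g (h + x).
  move: fg; rewrite (near_shift 0)/=; apply: filterS => h /=.
  by rewrite subr0.
apply: filterS2 h1 h2 => h + <-; by rewrite -gx deriveE.
Qed.

Lemma differentiable_open_eq V W (A : set V) (f g : V -> W) x : open A ->
  {in A, f =1 g} -> A x -> differentiable f x -> differentiable g x.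
Proof.
move=> oA fg Ax; apply: near_differentiable.
by apply: filterS (open_nbhs_nbhs (conj oA Ax)) => y Ay; apply: fg; rewrite inE.
Qed.

Lemma derive_open_eq V W (A : set V) (f g : V -> W) x v : open A ->
  {in A, f =1 g} -> A x -> 'D_v f x = 'D_v g x.
Proof.
move=> oA fg Ax; apply: near_eq_derive.
by apply: filterS (open_nbhs_nbhs (conj oA Ax)) => y Ay; apply: fg; rewrite inE.
Qed.

Lemma Ck_eq V W k (A : set V) (f g : V -> W) : open A -> {in A, f =1 g} ->
  Ck k A f -> Ck k A g.
Proof.
move=> oA; elim: k f g => [|k ih] f g fg /=.
  move=> fc x Ax; have fgx : f x = g x by rewrite fg// inE.
  rewrite /prop_for/continuous_at -fgx.
  have := fc x Ax; apply: cvg_trans; apply: near_eq_cvg.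
  apply: filterS (open_nbhs_nbhs (conj oA Ax)) => y Ay.
  by rewrite fg// inE.
move=> [fd fD]; split=> [x Ax|v].
  exact: (differentiable_open_eq oA fg Ax (fd x Ax)).
apply: ih (fD v) => x; rewrite inE => Ax.
exact: derive_open_eq fg Ax.
Qed.

Lemma CkS V W k (A : set V) (f : V -> W) : Ck k.+1 A f -> Ck k A f.
Proof.
elim: k f => [|k ih] f [fd fD].
  by move=> x /fd; exact: differentiable_continuous.
by split => // v; apply: ih; exact: fD.
Qed.

Lemma Ck_sub V W k (A B : set V) (f : V -> W) : A `<=` B -> Ck k B f -> Ck k A f.
Proof.
move=> AB; elim: k f => [|k ih] f /=; first by move=> fB x /AB/fB.
by move=> [fd fD]; split => [x /AB/fd//|v]; exact/ih/fD.
Qed.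

Lemma Ck_cst V W k (A : set V) (a : W) : Ck k A (fun=> a).
Proof.
elim: k a => [|k ih] a /=; first by move=> x _; exact: cst_continuous.
split=> [x _|v]; first exact: differentiable_cst.
have -> : (fun x => 'D_v (fun=> a) x) = ((fun=> 0) : V -> W); last exact: ih.
by apply/funext => x; exact: derive_cst.
Qed.

Lemma CkD V W k (A : set V) (f g : V -> W) : open A ->
  Ck k A f -> Ck k A g -> Ck k A (fun x => f x + g x).
Proof.
move=> oA; elim: k f g => [|k ih] f g /=.
  by move=> fc gc x Ax; apply: continuousD; [exact: fc|exact: gc].
move=> [fd fD] [gd gD]; split=> [x Ax|v].
  by apply: differentiableD; [exact: fd|exact: gd].
apply: Ck_eq (ih _ _ (fD v) (gD v)) => // x; rewrite inE => Ax.
by rewrite deriveD//; apply: diff_derivable; [exact: fd|exact: gd].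
Qed.

Lemma CkZ V W k (A : set V) (c : R) (f : V -> W) : open A ->
  Ck k A f -> Ck k A (fun x => c *: f x).
Proof.
move=> oA; elim: k f => [|k ih] f /=.
  by move=> fc x Ax; apply: continuousZr; exact: fc.
move=> [fd fD]; split=> [x Ax|v]; first by apply: differentiableZ; exact: fd.
apply: Ck_eq (ih _ (fD v)) => // x; rewrite inE => Ax.
by rewrite deriveZ//; apply: diff_derivable; exact: fd.
Qed.

Lemma CkN V W k (A : set V) (f : V -> W) : open A ->
  Ck k A f -> Ck k A (fun x => - f x).
Proof.
move=> oA /(CkZ (-1) oA); apply: Ck_eq => // x _; by rewrite scaleN1r.
Qed.

Lemma CkB V W k (A : set V) (f g : V -> W) : open A ->
  Ck k A f -> Ck k A g -> Ck k A (fun x => f x - g x).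
Proof. by move=> oA fA gA; apply: CkD => //; exact: CkN. Qed.

Lemma Ck_sum V W k (A : set V) (I : Type) (s : seq I) (P : pred I)
    (F : I -> V -> W) : open A ->
  (forall i, P i -> Ck k A (F i)) -> Ck k A (fun x => \sum_(i <- s | P i) F i x).
Proof.
move=> oA FA; elim: s => [|i s ih].
  by apply: Ck_eq (Ck_cst _ _ 0) => // x _; rewrite big_nil.
have [Pi|nPi] := boolP (P i).
  by apply: Ck_eq (CkD oA (FA i Pi) ih) => // x _; rewrite big_cons Pi.
by apply: Ck_eq ih => // x _; rewrite big_cons (negPf nPi).
Qed.

Lemma Ck_mul V k (A : set V) (f g : V -> R) : open A ->
  Ck k A f -> Ck k A g -> Ck k A (fun x => f x * g x).
Proof.
move=> oA; elim: k f g => [|k ih] f g.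
  by move=> fc gc x Ax; apply: continuousM; [exact: fc|exact: gc].
move=> fk gk; have [fd fD] := fk; have [gd gD] := gk.
split=> [x Ax|v].
  by apply: differentiableM; [exact: fd|exact: gd].
have h : Ck k A (fun x => f x * 'D_v g x + g x * 'D_v f x).
  by apply: CkD => //; apply: ih; solve [exact: CkS|exact: fD|exact: gD].
apply: Ck_eq h => // x; rewrite inE => Ax.
by rewrite deriveM//; apply: diff_derivable; [exact: fd|exact: gd].
Qed.

Lemma Ck_prod V k (A : set V) (I : Type) (s : seq I) (F : I -> V -> R) : open A ->
  (forall i, Ck k A (F i)) -> Ck k A (fun x => \prod_(i <- s) F i x).
Proof.
move=> oA FA; elim: s => [|i s ih].
  by apply: (Ck_eq oA _ (@Ck_cst V R k A (1 : R))) => x _; rewrite big_nil.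
by apply: Ck_eq (Ck_mul oA (FA i) ih) => // x _; rewrite big_cons.
Qed.

Lemma Ck_mxP V m n k (A : set V) (f : V -> 'M[R]_(m, n)) : open A ->
  Ck k A f <-> forall i j, Ck k A (fun x => f x i j).
Proof.
move=> oA; elim: k f => [|k ih] f.
  split=> [fc i j x Ax|fc x Ax].
    by apply: (@continuous_comp _ _ _ f (fun M : 'M[R]_(m, n) => M i j));
      [exact: fc|exact: coord_continuous].
  apply/cvgrPdist_le => e e0; near=> y.
  apply: mx_norm_le => [|i j]; first exact: ltW.
  move: i j; near: y; apply: filter_forall => i; apply: filter_forall => j.
  have /cvgrPdist_le/(_ _ e0) := fc i j x Ax.
  by apply: filterS => y; rewrite !mxE.
split=> [[fd fD] i j|fij].
  split=> [x Ax|v]; first by move/differentiable_mxP: (fd x Ax).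
  apply: Ck_eq ((ih _).1 (fD v) i j) => // x; rewrite inE => Ax.
  by rewrite derive_mx_entry//; exact: fd.
have fd x : A x -> differentiable f x.
  by move=> Ax; apply/differentiable_mxP => i j; have [+ _] := fij i j; exact.
split=> // v; apply/ih => i j; have [_ /(_ v)] := fij i j.
apply: Ck_eq => // x; rewrite inE => Ax.
by rewrite derive_mx_entry//; exact: fd.
Unshelve. all: by end_near. Qed.

Lemma Ck_mulmx V m n p k (A : set V) (f : V -> 'M[R]_(m, n))
    (g : V -> 'M[R]_(n, p)) : open A ->
  Ck k A f -> Ck k A g -> Ck k A (fun x => f x *m g x).
Proof.
move=> oA /Ck_mxP fA /Ck_mxP gA; apply/Ck_mxP => // i j.
rewrite (_ : (fun _ => _) = fun x => \sum_l f x i l * g x l j).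
  by apply: Ck_sum => // l _; apply: Ck_mul => //; [exact: fA|exact: gA].
by apply/funext => x; rewrite mxE.
Qed.

Lemma Ck_scale V m n k (A : set V) (c : V -> R) (f : V -> 'M[R]_(m, n)) : open A ->
  Ck k A c -> Ck k A f -> Ck k A (fun x => c x *: f x).
Proof.
move=> oA cA /Ck_mxP fA; apply/Ck_mxP => // i j.
rewrite (_ : (fun _ => _) = fun x => c x * f x i j).
  by apply: Ck_mul => //; exact: fA.
by apply/funext => x; rewrite mxE.
Qed.

Lemma Ck_trmx V m n k (A : set V) (f : V -> 'M[R]_(m, n)) : open A ->
  Ck k A f -> Ck k A (fun x => (f x)^T).
Proof.
move=> oA /Ck_mxP fA; apply/Ck_mxP => // i j.
rewrite (_ : (fun _ => _) = fun x => f x j i); first exact: fA.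
by apply/funext => x; rewrite mxE.
Qed.

Lemma Ck_comp V m p q k (A : set V) (B : set 'rV[R]_m) (g : V -> 'rV[R]_m)
    (f : 'rV[R]_m -> 'M[R]_(p, q)) : open A -> (forall x, A x -> B (g x)) ->
  Ck k A g -> Ck k B f -> Ck k A (fun x => f (g x)).
Proof.
move=> oA gAB; elim: k g f gAB => [|k ih] g f gAB.
  move=> gc fc x Ax; apply: (@continuous_comp _ _ _ g f).
    exact: gc.
  exact/fc/gAB.
move=> gk fk; have [gd gD] := gk; have [fd fD] := fk.
split=> [x Ax|v].
  by apply: (@differentiable_comp _ _ _ _ g f); [exact: gd|exact/fd/gAB].
(* The chain rule differentiates [f] in a direction that moves with [x]; expanding it in the
   standard basis leaves fixed directions, to which the induction hypothesis applies. *)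
have h : Ck k A (fun x => \sum_i ('D_v g x) 0 i *: 'D_(delta_mx 0 i) f (g x)).
  apply: Ck_sum => // i _; apply: Ck_scale => //.
    exact: ((Ck_mxP _ _ oA).1 (gD v)).
  by apply: (ih g (fun y => 'D_(delta_mx 0 i) f y)); [|exact: CkS|exact: fD].
apply: Ck_eq h => // x; rewrite inE => Ax.
rewrite -derivative_rV; last exact/fd/gAB.
by rewrite (@derive_chain _ _ _ _ g f); [|exact: gd|exact/fd/gAB].
Qed.

(** With [s] the inverse square root of [f], the derivative of [s] is [- 2^-1 * s ^+ 3] times that
    of [f]: a polynomial in [s] and the derivative of [f], so the induction on [k] closes. *)
Lemma Ck_rsqrt V k (A : set V) (f : V -> R) : open A ->
  (forall x, A x -> 0 < f x) -> Ck k A f ->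
  Ck k A (fun x => (Num.sqrt (f x))^-1).
Proof.
move=> oA f0; have fs0 x : A x -> Num.sqrt (f x) != 0.
  by move=> Ax; rewrite gt_eqF// sqrtr_gt0 f0.
have sd x : A x -> differentiable f x -> differentiable (fun x => Num.sqrt (f x)) x.
  move=> Ax fd; apply: (@differentiable_comp _ _ _ _ f Num.sqrt) => //.
  by apply/derivable1_diffP; have [] := is_derive1_sqrt (f0 _ Ax).
elim: k f f0 fs0 sd => [|k ih] f f0 fs0 sd fk.
  move=> x Ax; apply: continuousV; first exact: fs0.
  apply: (@continuous_comp _ _ _ f Num.sqrt); first exact: fk.
  exact: sqrt_continuous.
have [fd fD] := fk; have h := ih f f0 fs0 sd (CkS fk).
split=> [x Ax|v]; first by apply: differentiableV; [exact/sd/fd|exact: fs0].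
have h3 : Ck k A (fun x => - 2^-1 * ((Num.sqrt (f x))^-1 *
    ((Num.sqrt (f x))^-1 * ((Num.sqrt (f x))^-1 * 'D_v f x)))).
  apply: (Ck_mul oA (@Ck_cst V R k A (- 2^-1 : R))).
  by do 3?[apply: (Ck_mul oA); first exact: h]; exact: fD.
apply: Ck_eq h3 => // x; rewrite inE => Ax.
have fdx := fd x Ax; have sdx := sd x Ax fdx.
rewrite deriveV; [|exact: fs0|exact: diff_derivable].
have dsq : is_derive (f x) 1 Num.sqrt (2 * Num.sqrt (f x))^-1.
  by apply: is_derive1_sqrt; exact: f0.
have dsd : differentiable Num.sqrt (f x).
  by apply/derivable1_diffP; have [] := dsq.
have -> : 'D_v (fun x => Num.sqrt (f x)) x = 'D_v f x * (2 * Num.sqrt (f x))^-1.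
  rewrite (@derive_chain _ _ _ _ f Num.sqrt)// -[X in derive _ _ X]mulr1 derivative_scale//.
  by rewrite derive_val.
rewrite /GRing.scale/=; have := fs0 x Ax.
by move: (Num.sqrt (f x)) ('D_v f x) => s d s0; field.
Qed.

Lemma Ck_inv V k (A : set V) (f : V -> R) : open A ->
  (forall x, A x -> f x != 0) -> Ck k A f -> Ck k A (fun x => (f x)^-1).
Proof.
move=> oA f0; elim: k f f0 => [|k ih] f f0 fk.
  by move=> x Ax; apply: continuousV; [exact: f0|exact: fk].
have [fd fD] := fk; have h := ih f f0 (CkS fk).
split=> [x Ax|v]; first by apply: differentiableV; [exact: fd|exact: f0].
have h2 : Ck k A (fun x => - (((f x)^-1 * (f x)^-1) * 'D_v f x)).
  by apply: (CkN oA); apply: (Ck_mul oA (Ck_mul oA h h)); exact: fD.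
apply: Ck_eq h2 => // x; rewrite inE => Ax.
rewrite deriveV; [|exact: f0|exact/diff_derivable/fd].
by rewrite /GRing.scale/= expr2 invfM mulNr.
Qed.

Lemma Ck_det V n k (A : set V) (f : V -> 'M[R]_n) : open A ->
  Ck k A f -> Ck k A (fun x => \det (f x)).
Proof.
move=> oA /Ck_mxP fA; apply: Ck_sum => // s _.
apply: Ck_mul => //; first exact: Ck_cst.
by apply: Ck_prod => // i; exact: fA.
Qed.

Lemma Ck_invmx V n k (A : set V) (f : V -> 'M[R]_n) : open A ->
  (forall x, A x -> f x \in unitmx) -> Ck k A f -> Ck k A (fun x => invmx (f x)).
Proof.
move=> oA fu fk; have h : Ck k A (fun x => (\det (f x))^-1 *: \adj (f x)).
  apply: Ck_scale => //.
    apply: Ck_inv => //; last exact: Ck_det.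
    by move=> x /fu; rewrite unitmxE unitfE.
  apply/Ck_mxP => // i j.
  have h : Ck k A (fun x => (-1) ^+ (j + i) * \det (row' j (col' i (f x)))).
    apply: (Ck_mul oA (@Ck_cst V R k A ((-1) ^+ (j + i) : R))).
    apply: Ck_det => //; apply/Ck_mxP => // a b.
    move/Ck_mxP : fk => /(_ oA (lift j a) (lift i b)).
    by apply: Ck_eq => // x _; rewrite !mxE.
  by apply: Ck_eq h => // x _; rewrite mxE.
by apply: Ck_eq h => // x; rewrite inE => /fu; rewrite /invmx => ->.
Qed.

Lemma smooth_derive V W (A : set V) (f : V -> W) v :
  smooth A f -> smooth A (fun x => 'D_v f x).
Proof. by move=> fA k; have [_ +] := fA k.+1; exact. Qed.

Lemma smooth_differentiable V W (A : set V) (f : V -> W) x :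
  smooth A f -> A x -> differentiable f x.
Proof. by move=> fA Ax; have [+ _] := fA 1%N; exact. Qed.

Lemma smooth_continuous V W (A : set V) (f : V -> W) x :
  smooth A f -> A x -> {for x, continuous f}.
Proof. by move=> fA Ax; have := fA 0%N; exact. Qed.

Lemma schwarz V m n (A : set V) (f : V -> 'M[R]_(m, n)) x u v : open A ->
  smooth A f -> A x ->
  'D_v (fun y => 'D_u f y) x = 'D_u (fun y => 'D_v f y) x.
Proof.
move=> oA fA Ax; apply/matrixP => i j.
have fd w y : A y -> differentiable (fun z => 'D_w f z) y.
  by move=> Ay; apply: smooth_differentiable Ay; exact: smooth_derive.
have fdd w1 w2 y : A y -> {for y, continuous (fun y => ('D_w1 (fun z => 'D_w2 f z) y) i j)}.
  move=> Ay; apply: (@smooth_continuous _ _ A) => // k.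
  have := smooth_derive w1 (smooth_derive w2 fA).
  by move=> /(_ k)/Ck_mxP; apply.
have E w1 w2 y : A y -> 'D_w1 (fun z => 'D_w2 (fun t => f t i j) z) y =
    ('D_w1 (fun z => 'D_w2 f z) y) i j.
  move=> Ay; rewrite derive_mx_entry; last exact: fd.
  apply: (@derive_open_eq V R A _ _ y w1 oA _ Ay) => z; rewrite inE => Az.
  by rewrite derive_mx_entry//; exact: smooth_differentiable Az.
apply: (@schwarz_scalar _ _ (fun t => f t i j)
  (fun y => ('D_v (fun z => 'D_u f z) y) i j)
  (fun y => ('D_u (fun z => 'D_v f z) y) i j) A x u v).
- exact: open_nbhs_nbhs.
- by move=> y Ay; have /differentiable_mxP := smooth_differentiable fA Ay; exact.
- move=> w y Ay; apply: (@differentiable_open_eq _ _ A (fun z => ('D_w f z) i j)) => //.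
    move=> z; rewrite inE => Az; rewrite derive_mx_entry//.
    exact: smooth_differentiable Az.
  by move/differentiable_mxP: (fd w y Ay); exact.
- by move=> y Ay; exact: E.
- by move=> y Ay; exact: E.
- exact: fdd.
- exact: fdd.
Qed.

Lemma derive_symmetric V n (A : set V) (f : V -> 'M[R]_n) x u : open A -> smooth A f ->
  (forall y, A y -> (f y)^T = f y) -> A x -> ('D_u f x)^T = 'D_u f x.
Proof.
move=> oA fsm fT Ax; rewrite -(derive_trmx u (smooth_differentiable fsm Ax)).
by apply: (@derive_open_eq _ _ A) => // y; rewrite inE => /fT.
Qed.

End Smooth.

(** * Linear differential systems *)

Section LinearODE.
Context {R : realType}.

Lemma half_power_small (C e : R) k : 0 < e -> exists2 l, (k <= l)%N & C / 2 ^+ l <= e.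
Proof.
move=> e0; pose n := Num.truncn (`|C| / e).
exists (maxn k n.+1); first exact: leq_maxl.
rewrite ler_pdivrMr ?exprn_gt0// mulrC -ler_pdivrMr//.
rewrite (@le_trans _ _ n.+1%:R)//.
  rewrite (le_trans _ (ltW (truncnS_gt _)))// ler_wpM2r ?invr_ge0 ?ler_norm//.
  exact: ltW.
rewrite -natrX ler_nat (leq_trans (leq_maxr k n.+1))//.
by rewrite ltnW// ltn_expl.
Qed.

(** Nested intervals: the steps from [k] on add up to at most [2 * M / 2 ^+ k], so the intervals of
    that radius around [u k] decrease, and the supremum of their left ends lies in all of them. *)
Lemma geometric_limit (u : nat -> R) M : 0 <= M ->
  (forall k, `|u k.+1 - u k| <= M / 2 ^+ k) ->
  exists l, forall k, `|u k - l| <= 2 * M / 2 ^+ k.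
Proof.
move=> M0 uM; pose a k := u k - 2 * M / 2 ^+ k; pose b k := u k + 2 * M / 2 ^+ k.
have step k : 2 * M / 2 ^+ k.+1 = M / 2 ^+ k.
  by rewrite exprS; field; rewrite expf_neq0.
have step2 k : 2 * M / 2 ^+ k = M / 2 ^+ k + M / 2 ^+ k by field; rewrite expf_neq0.
have amono : {homo a : m n / (m <= n)%N >-> m <= n}.
  apply: homo_leq => //; first exact: le_trans.
  by move=> k; have := uM k; rewrite /a step step2 ler_norml => /andP[]; lra.
have bmono : {homo b : m n / (m <= n)%N >-> n <= m}.
  apply: homo_leq => //; first by move=> x y z yx /le_trans; apply.
  by move=> k; have := uM k; rewrite /b step step2 ler_norml => /andP[]; lra.
have ab k : a k <= b k.
  have : 0 <= 2 * M / 2 ^+ k by rewrite divr_ge0 ?mulr_ge0// exprn_ge0.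
  by rewrite /a /b; lra.
have abkj k j : a k <= b j.
  rewrite (le_trans (amono _ _ (leq_maxl k j)))// (le_trans (ab _))//.
  exact/bmono/leq_maxr.
exists (sup (range a)) => k.
have ak : a k <= sup (range a).
  by apply: ub_le_sup; [exists (b 0%N) => _ [j _ <-]|exists k].
have bk : sup (range a) <= b k.
  by apply: ge_sup; [exists (a 0%N); exists 0%N|move=> _ [j _ <-]].
by rewrite ler_norml; move: ak bk; rewrite /a /b; lra.
Qed.

Lemma geometric_limit_mx m n (u : nat -> 'M[R]_(m, n)) M : 0 <= M ->
  (forall k, `|u k.+1 - u k| <= M / 2 ^+ k) ->
  exists l, forall k, `|u k - l| <= 2 * M / 2 ^+ k.
Proof.
move=> M0 uM.
have /choice[l lP] : forall ij : 'I_m * 'I_n, exists l, forall k,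
    `|u k ij.1 ij.2 - l| <= 2 * M / 2 ^+ k.
  move=> [i j] /=; apply: geometric_limit => // k.
  by rewrite (le_trans _ (uM k))// (le_trans _ (mx_entry_le _ i j))// !mxE.
exists (\matrix_(i, j) l (i, j)) => k; apply: mx_norm_le => [|i j].
  by rewrite divr_ge0 ?mulr_ge0// exprn_ge0.
by rewrite !mxE; exact: lP (i, j) k.
Qed.

Lemma derivable_continuous m n (f : R -> 'M[R]_(m, n)) (df : 'M[R]_(m, n)) (t : R) :
  is_derive t 1 f df -> {for t, continuous f}.
Proof.
by move=> [fd _]; apply: differentiable_continuous; exact/derivable1_diffP.
Qed.

Lemma mean_value_oo m n (f df : R -> 'M[R]_(m, n)) (c d K : R) : 0 <= K ->
  (forall t : R, c < t < d -> is_derive t 1 f (df t)) ->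
  (forall t : R, c < t < d -> `|df t| <= K) ->
  forall s t, c < s < d -> c < t < d -> `|f s - f t| <= K * `|s - t|.
Proof.
move=> K0 fd dfK; suff H s t : c < s -> t < d -> s <= t -> `|f t - f s| <= K * (t - s).
  move=> s t /andP[cs sd] /andP[ct td]; have [st|ts] := leP s t.
    by rewrite distrC (distrC s t) (@ger0_norm _ (t - s)) ?subr_ge0//; exact: H.
  have st0 : 0 <= s - t by rewrite subr_ge0 ltW.
  by rewrite (ger0_norm st0); apply: H => //; exact: ltW.
move=> cs td st; have inD x : s <= x -> x <= t -> c < x < d.
  by move=> sx xt; rewrite (lt_le_trans cs)// (le_lt_trans xt).
apply: (@mean_value_mx _ _ _ f df) => //.
- by move=> x; rewrite in_itv/= => /andP[/ltW ? /ltW ?]; exact/fd/inD.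
- apply: continuous_in_subspaceT => x; rewrite inE/= in_itv/= => /andP[? ?].
  by apply: derivable_continuous; exact/fd/inD.
- by move=> x; rewrite in_itv/= => /andP[/ltW ? /ltW ?]; exact/dfK/inD.
Qed.

(** The mean value inequality for [f_ l - f_ k], with [l] arbitrarily large, shows that [f - f_ k]
    is Lipschitz around [t] with a constant that tends to [0] with [k]. A single [k] then reduces
    the differentiability of [f] to that of [f_ k], at the cost of three thirds of [e]. *)
Lemma derive_geometric_limit m n (f_ g_ : nat -> R -> 'M[R]_(m, n))
    (f g : R -> 'M[R]_(m, n)) (c d C : R) : 0 <= C ->
  (forall k (t : R), c < t < d -> is_derive t 1 (f_ k) (g_ k t)) ->
  (forall k (t : R), c < t < d -> `|f_ k t - f t| <= C / 2 ^+ k) ->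
  (forall k (t : R), c < t < d -> `|g_ k t - g t| <= C / 2 ^+ k) ->
  forall t, c < t < d -> is_derive t 1 f (g t).
Proof.
move=> C0 fg fC gC t tcd.
have approx k s : c < s < d ->
    `|f s - f t - (f_ k s - f_ k t)| <= 2 * C / 2 ^+ k * `|s - t|.
  move=> scd; apply/ler_addgt0Pr => e e0.
  have [l kl lC] := @half_power_small (2 * C) e k e0.
  have Hl x : c < x < d -> `|g_ l x - g_ k x| <= 2 * C / 2 ^+ k.
    move=> xcd; rewrite -(subrKA (g x)) (le_trans (ler_normD _ _))//.
    rewrite (_ : 2 * C / 2 ^+ k = C / 2 ^+ k + C / 2 ^+ k); last by field; rewrite expf_neq0.
    rewrite lerD//; last by rewrite distrC gC.
    rewrite (le_trans (gC _ _ xcd))// ler_wpM2l// lef_pV2 ?posrE ?exprn_gt0//.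
    by rewrite ler_eXn2l// ltr1n.
  have := @mean_value_oo _ _ (fun x => f_ l x - f_ k x) (fun x => g_ l x - g_ k x)
    c d (2 * C / 2 ^+ k).
  rewrite divr_ge0 ?mulr_ge0 ?exprn_ge0// => /(_ isT).
  move=> /(_ _ Hl s t scd tcd) /= => Hst.
  have {}Hst : `|f_ l s - f_ k s - (f_ l t - f_ k t)| <= 2 * C / 2 ^+ k * `|s - t|.
    by apply: Hst => x xcd; have := fg l x xcd; have := fg k x xcd => *; exact: is_deriveB.
  have -> : f s - f t - (f_ k s - f_ k t) =
     (f_ l s - f_ k s - (f_ l t - f_ k t)) + ((f_ l t - f t) - (f_ l s - f s)).
    by apply/matrixP => i j; rewrite !mxE; ring.
  apply: le_trans (ler_normD _ _) _; apply: lerD; first exact: Hst.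
  apply: le_trans (ler_normB _ _) _.
  rewrite (le_trans _ lC)// (_ : 2 * C / 2 ^+ l = C / 2 ^+ l + C / 2 ^+ l).
    by apply: lerD; exact: fC.
  by field; rewrite expf_neq0.
suff [fd fD] : differentiable f t /\ forall v, 'D_v f t = v *: g t.
  split; first exact/derivable1_diffP.
  by rewrite fD scale1r.
apply: differentiable_eps => [a u v||].
- by rewrite scalerDl scalerA.
- exact: scalel_continuous.
move=> e e0; have e30 : 0 < e / 3 by rewrite divr_gt0.
have [k _ kC] := @half_power_small (2 * C) (e / 3) 0 e30.
have fkd : differentiable (f_ k) t.
  by apply/derivable1_diffP; have [] := fg k t tcd.
have H1 := differentiable_expansion fkd e30.
have H2 : \forall h \near (0 : R), c < h + t < d.
  have : t \in `]c, d[ by rewrite in_itv.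
  move/near_in_itvoo; rewrite (near_shift 0)/=; apply: filterS => h /=.
  by rewrite subr0 in_itv.
apply: filterS2 H1 H2 => h H1 H2.
have {}approx := approx k _ H2; rewrite addrK in approx.
have D1 : 'D_h (f_ k) t = h *: g_ k t.
  have -> : h = h *: (1 : R) by rewrite /GRing.scale/= mulr1.
  rewrite derivative_scale//; have [_ ->] := fg k t tcd.
  by rewrite /GRing.scale/= mulr1.
rewrite D1 in H1.
have gk : `|h *: g_ k t - h *: g t| <= e / 3 * `|h|.
  rewrite -scalerBr normrZ mulrC ler_wpM2r// (le_trans (gC _ _ tcd))//.
  rewrite (le_trans _ kC)// ler_wpM2r ?invr_ge0 ?exprn_ge0//; lra.
have -> : f (h + t) - f t - h *: g t =
   (f (h + t) - f t - (f_ k (h + t) - f_ k t)) +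
   (f_ k (h + t) - f_ k t - h *: g_ k t) + (h *: g_ k t - h *: g t).
  by apply/matrixP => i j; rewrite !mxE; ring.
rewrite (_ : e * `|h| = e / 3 * `|h| + e / 3 * `|h| + e / 3 * `|h|); last by field.
rewrite (le_trans (ler_normD _ _))// lerD//.
rewrite (le_trans (ler_normD _ _))// lerD// (le_trans approx)//.
by rewrite ler_wpM2r.
Qed.

(** The integral is taken from [-3] and is controlled only inside []-3, 3[]. Clamping its argument
    to [[-2, 2]] makes the result continuous on the whole line, as the Picard iteration requires,
    and changes nothing on []-2, 2[]. *)
Lemma antiderivative (b : R -> R) : continuous b ->
  exists Y : R -> R, [/\ Y 0 = 0, continuous Y &
    forall t : R, -2 < t < 2 -> is_derive t 1 Y (b t)].
Proof.
move=> bc; pose F (x : R) : R := (\int[lebesgue_measure]_(t in `[-3, x]) b t)%R.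
have dF (x : R) : -3 < x < 3 -> derivable F x 1 /\ 'D_1 F x = b x.
  move=> /andP[x0 x3]; rewrite -derive1E; apply: (@continuous_FTC1_closed _ b (-3) x 3) => //.
  - apply: continuous_compact_integrable; first exact: segment_compact.
    exact: continuous_subspaceT.
  - exact: bc.
pose c (t : R) := Num.max (-2) (Num.min t 2).
have cc : continuous c.
  have minc t : {for t, continuous ((id : R -> R^o) \min cst 2)}.
    by apply: continuous_min; [exact: cvg_id|exact: cst_continuous].
  have maxc t : {for t, continuous ((cst (-2) : R -> R^o) \max (id \min cst 2))}.
    by apply: continuous_max; [exact: cst_continuous|exact: minc].
  exact: maxc.
have c3 t : -3 < c t < 3.
  by rewrite /c lt_max gt_max lt_min gt_min; apply/andP; split; lra.
have cE t : -2 < t < 2 -> c t = t.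
  by move=> /andP[t2 t2']; rewrite /c min_l ?ltW// max_r// ltW.
have cdiff t : {for c t, continuous F}.
  by apply: differentiable_continuous; apply/derivable1_diffP; have [] := dF _ (c3 t).
exists (fun t => F (c t) - F (c 0)); split; first by rewrite subrr.
  move=> t; apply: cvgB; last exact: cvg_cst.
  apply: (@continuous_comp _ _ _ c F); first exact: cc.
  exact: cdiff.
move=> t t2; have t3 : -3 < t < 3 by move: t2 => /andP[? ?]; apply/andP; split; lra.
have [dFt FtE] := dF t t3; rewrite -FtE.
have nt : \forall x \near t, F x - F (c 0) = F (c x) - F (c 0).
  have : t \in `]-2, 2[ by rewrite in_itv.
  by move/near_in_itvoo; apply: filterS => x; rewrite in_itv/= => /cE ->.
apply: near_eq_is_derive nt _.
rewrite -[X in is_derive _ _ _ X]subr0.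
apply: is_deriveB.
by split.
Qed.

Lemma is_derive_mx m n (f : R -> 'M[R]_(m, n)) (df : 'M[R]_(m, n)) (t : R) :
  (forall i j, is_derive t 1 (fun x => f x i j) (df i j)) -> is_derive t 1 f df.
Proof.
move=> fd; have fd' : derivable f t 1.
  by apply/derivable_mxP => i j; have [] := fd i j.
split => //; apply/matrixP => i j; rewrite derive_mx// mxE.
by have [] := fd i j.
Qed.

Lemma continuous_mxP (T : topologicalType) m n (f : T -> 'M[R]_(m, n)) x :
  {for x, continuous f} <-> forall i j, {for x, continuous (fun y => f y i j)}.
Proof.
split=> [fc i j|fc].
  by apply: (@continuous_comp _ _ _ f (fun M : 'M[R]_(m, n) => M i j));
    [exact: fc|exact: coord_continuous].
apply/cvgrPdist_le => e e0; near=> y.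
apply: mx_norm_le => [|i j]; first exact: ltW.
move: i j; near: y; apply: filter_forall => i; apply: filter_forall => j.
have /cvgrPdist_le/(_ _ e0) := fc i j.
by apply: filterS => y; rewrite !mxE.
Unshelve. all: by end_near. Qed.

Lemma antiderivative_mx m n (b : R -> 'M[R]_(m, n)) : continuous b ->
  exists Y : R -> 'M[R]_(m, n), [/\ Y 0 = 0, continuous Y &
    forall t : R, -2 < t < 2 -> is_derive t 1 Y (b t)].
Proof.
move=> bc.
have /choice[Y YP] : forall ij : 'I_m * 'I_n, exists Y : R -> R,
    [/\ Y 0 = 0, continuous Y &
     forall t : R, -2 < t < 2 -> is_derive t 1 Y (b t ij.1 ij.2)].
  move=> [i j]; apply: antiderivative => x.
  by move/continuous_mxP: (bc x); exact.
exists (fun t => \matrix_(i, j) Y (i, j) t); split.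
- by apply/matrixP => i j; rewrite !mxE; have [] := YP (i, j).
- move=> t; apply/continuous_mxP => i j.
  rewrite (_ : (fun _ => _) = Y (i, j)); first by have [_ + _] := YP (i, j); exact.
  by apply/funext => x; rewrite mxE.
- move=> t t2; apply: is_derive_mx => i j.
  rewrite (_ : (fun _ => _) = Y (i, j)); first by have [_ _ +] := YP (i, j); exact.
  by apply/funext => x; rewrite mxE.
Qed.

(** Picard iteration. Multiplication by [B t] costs a factor at most [4^-1] and integration from [0]
    over []-2, 2[] a factor at most [2], so the differences of successive iterates halve. The
    interval contains [[0, 1]] in its interior, which gives two-sided derivatives at both ends of
    the segment. *)
Lemma linear_ode m p (B : R -> 'M[R]_m) (Y0 : 'M[R]_(m, p)) : continuous B ->
  (forall t, m%:R * `|B t| <= 4^-1) ->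
  exists y : R -> 'M[R]_(m, p),
    y 0 = Y0 /\ forall t : R, -2 < t < 2 -> is_derive t 1 y (B t *m y t).
Proof.
move=> Bc B4.
(* The continuity premise sits inside the existential, so that choice yields a total operator that
   can be iterated; its values at discontinuous [y] are unconstrained. *)
have /choice[next nextP] : forall y : R -> 'M[R]_(m, p), exists z,
    continuous y -> [/\ z 0 = Y0, continuous z &
      forall t : R, -2 < t < 2 -> is_derive t 1 z (B t *m y t)].
  move=> y; have [yc|nyc] := pselect (continuous y); last by exists y.
  have [|Y [Y00 Yc YD]] := @antiderivative_mx _ _ (fun t => B t *m y t).
    move=> t; apply: (@Ck_mulmx R R _ _ _ 0 setT B y openT) => //.
      by move=> x _; exact: Bc.
    by move=> x _; exact: yc.
  exists (fun t => Y0 + Y t) => _; split; first by rewrite Y00 addr0.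
    by move=> t; apply: cvgD; [exact: cvg_cst|exact: Yc].
  move=> t t2; rewrite -[X in is_derive _ _ _ X]add0r; apply: is_deriveD.
  exact: YD.
pose y_ k := iter k next (fun=> Y0).
have yc k : continuous (y_ k).
  elim: k => [|k ih]; first by move=> t; exact: cst_continuous.
  by have [] := nextP _ ih.
have y0 k : y_ k 0 = Y0.
  by case: k => // k; have [] := nextP _ (yc k).
have yD k (t : R) : -2 < t < 2 -> is_derive t 1 (y_ k.+1) (B t *m y_ k t).
  by have [_ _] := nextP _ (yc k); exact.
have Bbound (Z : 'M[R]_(m, p)) t K : `|Z| <= K -> `|B t *m Z| <= 4^-1 * K.
  move=> ZK; rewrite (le_trans (mx_norm_mul _ _))// ler_pM// mulr_ge0//.
have zero2 : -2 < (0 : R) < 2 by apply/andP; split; lra.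
have step k (t : R) : -2 < t < 2 -> `|y_ k.+1 t - y_ k t| <= `|Y0| / 2 ^+ k.
  elim: k t => [|k ih] t t2.
    have := @mean_value_oo _ _ (y_ 1%N) (fun t => B t *m Y0) (-2) 2 (4^-1 * `|Y0|).
    rewrite mulr_ge0 ?invr_ge0// => /(_ isT (yD 0%N)).
    move=> /(_ (fun t _ => Bbound _ _ _ (lexx _)) t 0 t2 zero2).
    rewrite y0 subr0 expr0 divr1 => /le_trans; apply.
    rewrite mulrAC ler_piMl//.
    by move: t2; rewrite -ltr_norml; lra.
  have := @mean_value_oo _ _ (fun t => y_ k.+2 t - y_ k.+1 t)
    (fun t => B t *m (y_ k.+1 t - y_ k t)) (-2) 2 (4^-1 * (`|Y0| / 2 ^+ k)).
  have M0 : 0 <= `|Y0| / 2 ^+ k by rewrite divr_ge0// exprn_ge0.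
  rewrite mulr_ge0 ?invr_ge0// => /(_ isT).
  have DD (s : R) : -2 < s < 2 -> is_derive s 1 (fun t => y_ k.+2 t - y_ k.+1 t)
      (B s *m (y_ k.+1 s - y_ k s)).
    move=> s2; have h1 := yD k.+1 s s2; have h2 := yD k s s2.
    by rewrite mulmxBr; exact: is_deriveB.
  move=> /(_ DD (fun s s2 => Bbound _ _ _ (ih s s2)) t 0 t2 zero2).
  rewrite !y0 subrr !subr0 => /le_trans; apply.
  have -> : `|Y0| / 2 ^+ k.+1 = 2^-1 * (`|Y0| / 2 ^+ k) by rewrite exprS invfM mulrCA.
  have tl2 : `|t| <= 2 by rewrite ltW// ltr_norml.
  by have := ler_wpM2l M0 tl2; move: (_ / _) (`|t|) => M x; lra.
have /choice[y yP] : forall t : R, exists l, -2 < t < 2 ->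
    forall k, `|y_ k t - l| <= 2 * `|Y0| / 2 ^+ k.
  move=> t; have [t2|nt2] := boolP (-2 < t < 2); last by exists 0.
  have [l lP] := @geometric_limit_mx _ _ (fun k => y_ k t) _ (normr_ge0 Y0)
    (fun k => step k t t2).
  by exists l.
have tiny (Z : 'M[R]_(m, p)) C : (forall k, `|Z| <= C / 2 ^+ k) -> Z = 0.
  move=> ZC; apply/eqP; rewrite -normr_le0; apply/ler_addgt0Pl => e e0.
  by have [k _ kC] := half_power_small C 0 e0; rewrite addr0 (le_trans (ZC k)).
exists y; split.
  apply/subr0_eq; apply: (tiny _ (2 * `|Y0|)) => k.
  by have := yP 0 zero2 k; rewrite y0 distrC.
(* The index is shifted because [B t *m y_ k t] is the derivative of the next iterate. *)
apply: (@derive_geometric_limit _ _ (fun k => y_ k.+1) (fun k t => B t *m y_ k t)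
  y (fun t => B t *m y t) (-2) 2 (2 * `|Y0|)) => //.
- move=> k t t2; rewrite (le_trans (yP _ t2 _))// ler_wpM2l ?mulr_ge0//.
  by rewrite lef_pV2 ?posrE ?exprn_gt0// ler_eXn2l// ltr1n.
- move=> k t t2; rewrite -mulmxBr (le_trans (Bbound _ _ _ (yP _ t2 _)))//.
  by rewrite ler_piMl//; lra.
Qed.

(** At a point where [|z|] is maximal, the mean value inequality bounds the maximum by half of
    itself plus [e]. With [e = 0] this is uniqueness; with [e] quadratic in a displacement it
    measures the error of a first-order variation. *)
Lemma gronwall_small m n (z dz : R -> 'M[R]_(m, n)) (e : R) : 0 <= e ->
  z 0 = 0 -> {within `[0, 1], continuous z} ->
  (forall t : R, 0 < t < 1 -> is_derive t 1 z (dz t)) ->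
  (forall t : R, 0 < t < 1 -> `|dz t| <= 2^-1 * `|z t| + e) ->
  forall t : R, 0 <= t <= 1 -> `|z t| <= 2 * e.
Proof.
move=> e0 z0 zc zd dzK.
have [|c c01 cmax] := @EVT_max R (fun t => `|z t|) 0 1 ler01.
  move=> x; apply: (@continuous_comp (subspace `[0 : R, 1]) _ R z (fun M : 'M[R]_(m, n) => `|M|)).
    exact: zc.
  exact: norm_continuous.
suff H : `|z c| <= 2 * e.
  by move=> t t01; rewrite (le_trans _ H)//; apply: cmax; rewrite in_itv.
move: c01; rewrite in_itv/= => /andP[c0 c1].
have K0 : 0 <= 2^-1 * `|z c| + e by rewrite addr_ge0// mulr_ge0// invr_ge0.
have := @mean_value_mx _ _ _ z dz 0 c (2^-1 * `|z c| + e) c0 K0.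
rewrite z0 !subr0.
have sub (t : R) : t \in `]0, c[%R -> 0 < t < 1.
  by rewrite in_itv/= => /andP[-> /lt_le_trans]; exact.
have H1 (t : R) (tc : t \in `]0, c[%R) := zd t (sub t tc).
move=> /(_ H1) => {}H1.
have : `|z c| <= (2^-1 * `|z c| + e) * c.
  apply: H1.
    apply: continuous_subspaceW zc; apply: subset_itvl.
    by rewrite bnd_simp.
  move=> t tc; rewrite (le_trans (dzK _ (sub _ tc)))// lerD2r ler_wpM2l ?invr_ge0//.
  by apply: cmax; rewrite in_itv/=; have /andP[/ltW -> /ltW ->] := sub _ tc.
move=> H2; have : `|z c| <= 2^-1 * `|z c| + e.
  by rewrite (le_trans H2)// ler_piMr.
by lra.
Qed.

End LinearODE.

Section LinearBounds.
Context {R : realType}.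

Lemma linear_row_bound n (W : normedModType R) (f : 'rV[R]_n -> W) v :
  linear f -> `|f v| <= (\sum_i `|f (delta_mx 0 i)|) * `|v|.
Proof.
move=> flin.
pose Lin := GRing.isLinear.Build R 'rV[R]_n W *:%R f flin.
pose f' : {linear 'rV[R]_n -> W} := HB.pack f Lin.
rewrite -[f]/(f' : _ -> _) {1}(row_sum_delta v) linear_sum mulr_suml.
rewrite (le_trans (ler_norm_sum _ _ _))//; apply: ler_sum => i _.
by rewrite linearZ normrZ mulrC ler_wpM2l// mx_entry_le.
Qed.

Lemma linear_row_continuous m n p (f : 'rV[R]_n -> 'M[R]_(m, p)) :
  linear f -> continuous f.
Proof.
move=> flin v.
pose Lin := GRing.isLinear.Build R 'rV[R]_n _ *:%R f flin.
pose f' : {linear 'rV[R]_n -> 'M[R]_(m, p)} := HB.pack f Lin.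
have h : Ck 0 setT (fun v : 'rV[R]_n => \sum_i v 0 i *: f (delta_mx 0 i)).
  apply: Ck_sum => [|i _]; first exact: openT.
  apply: Ck_scale; [exact: openT| |exact: Ck_cst].
  by move=> x _; exact: coord_continuous.
suff -> : f = fun v => \sum_i v 0 i *: f (delta_mx 0 i) by exact: h.
apply/funext => w; rewrite -[f]/(f' : _ -> _) {1}(row_sum_delta w) linear_sum.
by apply: eq_bigr => i _; rewrite linearZ.
Qed.

Lemma near_norm_bound (V W : normedModType R) (f : V -> W) x :
  {for x, continuous f} -> \forall y \near x, `|f y| <= `|f x| + 1.
Proof.
move=> /cvgrPdist_le/(_ _ ltr01); apply: filterS => y fxy.
rewrite -[f y](subrK (f x)) addrC (le_trans (ler_normD _ _))// lerD2l.
by rewrite distrC.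
Qed.

End LinearBounds.

Section Coefficients.
Context {R : realType} {n m : nat}.
Variables (A : 'rV[R]_n -> 'rV[R]_n -> 'M[R]_m) (D : set 'rV[R]_n).
Hypothesis Do : open D.
Hypothesis Alin : forall x, linear (A x).
Hypothesis Asm : forall v, smooth D (fun x => A x v).

Lemma coef_differentiable v x : D x -> differentiable (fun y => A y v) x.
Proof. by move=> Dx; exact: smooth_differentiable (Asm v) Dx. Qed.

Lemma coefD_differentiable u v x : D x ->
  differentiable (fun y => 'D_u (fun z => A z v) y) x.
Proof. by move=> Dx; exact: smooth_differentiable (smooth_derive u (Asm v)) Dx. Qed.

Lemma coef_derive_linear u x : D x -> linear (fun v => 'D_u (fun y => A y v) x).
Proof.
move=> Dx a v w /=.
rewrite (_ : (fun y => A y (a *: v + w)) = fun y => a *: A y v + A y w).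
  rewrite deriveD ?deriveZ//; first exact/diff_derivable/coef_differentiable.
  - exact/derivableZ/diff_derivable/coef_differentiable.
  - exact/diff_derivable/coef_differentiable.
by apply/funext => y; rewrite Alin.
Qed.

Lemma coef_derive_linearl v x : D x -> linear (fun u => 'D_u (fun y => A y v) x).
Proof.
move=> Dx a u w /=; have d := coef_differentiable v Dx.
by rewrite derivative_add// derivative_scale.
Qed.

Lemma coef_derive2_linear u w x : D x ->
  linear (fun v => 'D_u (fun z => 'D_w (fun y => A y v) z) x).
Proof.
move=> Dx a v1 v2 /=.
have d v := coefD_differentiable w v Dx.
rewrite -deriveZ; last exact: diff_derivable.
rewrite -deriveD; [|exact/derivableZ/diff_derivable|exact/diff_derivable].
apply: (@derive_open_eq _ _ _ D) => // z; rewrite inE => Dz.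
by rewrite (coef_derive_linear w Dz).
Qed.

Lemma coef_derive2_linearm u v x : D x ->
  linear (fun w => 'D_u (fun z => 'D_w (fun y => A y v) z) x).
Proof.
move=> Dx a w1 w2 /=.
have d w := coefD_differentiable w v Dx.
rewrite -deriveZ; last exact: diff_derivable.
rewrite -deriveD; [|exact/derivableZ/diff_derivable|exact/diff_derivable].
apply: (@derive_open_eq _ _ _ D) => // z; rewrite inE => Dz.
by rewrite (coef_derive_linearl v Dz).
Qed.

Lemma coef_derive2_linearl w v x : D x ->
  linear (fun u => 'D_u (fun z => 'D_w (fun y => A y v) z) x).
Proof.
move=> Dx a u1 u2 /=; have d := coefD_differentiable w v Dx.
by rewrite derivative_add// derivative_scale.
Qed.

(** Continuity bounds the finitely many values on basis vectors near [x0], and linearity extends the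
    bounds to all directions. Second derivatives are included for the Taylor remainder of the
    coefficients. *)
Lemma coef_bounds x0 : D x0 -> exists r K : R, [/\ 0 < r, 0 < K & ball x0 r `<=` D] /\
  [/\ forall x v, ball x0 r x -> `|A x v| <= K * `|v|,
  forall x u v, ball x0 r x -> `|'D_u (fun y => A y v) x| <= K * `|u| * `|v| &
  forall x u w v, ball x0 r x ->
    `|'D_u (fun z => 'D_w (fun y => A y v) z) x| <= K * `|u| * `|w| * `|v|].
Proof.
move=> Dx0.
pose e i : 'rV[R]_n := delta_mx 0 i.
pose K1 := \sum_i (`|A x0 (e i)| + 1).
pose K2 := \sum_i \sum_j (`|'D_(e j) (fun y => A y (e i)) x0| + 1).
pose K3 := \sum_i \sum_j \sum_k
  (`|'D_(e k) (fun z => 'D_(e j) (fun y => A y (e i)) z) x0| + 1).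
have K1p : 0 <= K1 by apply: sumr_ge0 => i _; rewrite addr_ge0.
have K2p : 0 <= K2 by do 2?[apply: sumr_ge0 => ? _]; rewrite addr_ge0.
have K3p : 0 <= K3 by do 3?[apply: sumr_ge0 => ? _]; rewrite addr_ge0.
have [r /= r0 Br] : exists2 r : R, 0 < r & ball x0 r `<=` [set y |
   [/\ D y, forall i, `|A y (e i)| <= `|A x0 (e i)| + 1,
    forall i j, `|'D_(e j) (fun y => A y (e i)) y| <=
      `|'D_(e j) (fun y => A y (e i)) x0| + 1 &
    forall i j k, `|'D_(e k) (fun z => 'D_(e j) (fun y => A y (e i)) z) y| <=
      `|'D_(e k) (fun z => 'D_(e j) (fun y => A y (e i)) z) x0| + 1]].
  apply/nbhs_ballP.
  have H0 : nbhs x0 D by exact: open_nbhs_nbhs.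
  have H1 : \forall y \near x0, forall i, `|A y (e i)| <= `|A x0 (e i)| + 1.
    near=> y; near: y; apply: filter_forall => i.
    apply: (@near_norm_bound _ _ _ (fun y => A y (e i))).
    exact: smooth_continuous (Asm _) Dx0.
  have H2 : \forall y \near x0, forall i j, `|'D_(e j) (fun y => A y (e i)) y| <=
      `|'D_(e j) (fun y => A y (e i)) x0| + 1.
    near=> y; near: y; apply: filter_forall => i; apply: filter_forall => j.
    apply: (@near_norm_bound _ _ _ (fun x => 'D_(e j) (fun y => A y (e i)) x)).
    exact: smooth_continuous (smooth_derive _ (Asm _)) Dx0.
  have H3 : \forall y \near x0, forall i j k,
     `|'D_(e k) (fun z => 'D_(e j) (fun y => A y (e i)) z) y| <=
      `|'D_(e k) (fun z => 'D_(e j) (fun y => A y (e i)) z) x0| + 1.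
    near=> y; near: y; apply: filter_forall => i.
    apply: filter_forall => j; apply: filter_forall => k.
    apply: (@near_norm_bound _ _ _
      (fun x => 'D_(e k) (fun z => 'D_(e j) (fun y => A y (e i)) z) x)).
    exact: smooth_continuous (smooth_derive _ (smooth_derive _ (Asm _))) Dx0.
  apply: filterS2 (filterI H0 H1) (filterI H2 H3) => y [h0 h1] [h2 h3].
  by split; [exact: h0|exact: h1|exact: h2|exact: h3].
exists r, (K1 + K2 + K3 + 1); split; split=> //.
- by rewrite ltr_wpDl// !addr_ge0.
- by move=> y /Br[].
- move=> x v /Br[Dx b1 _ _]; rewrite (le_trans (linear_row_bound v (Alin x)))//.
  rewrite ler_wpM2r// (@le_trans _ _ K1)//; last lra.
  by apply: ler_sum => i _; exact: b1.
- move=> x u v /Br[Dx _ b2 _].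
  rewrite (le_trans (linear_row_bound v (coef_derive_linear u Dx)))//.
  rewrite ler_wpM2r// (@le_trans _ _ (K2 * `|u|))//; last first.
    by rewrite ler_wpM2r//; lra.
  rewrite mulr_suml; apply: ler_sum => i _.
  rewrite (le_trans (linear_row_bound u (coef_derive_linearl _ Dx)))//.
  by rewrite ler_wpM2r//; apply: ler_sum => j _; exact: b2.
- move=> x u w v /Br[Dx _ _ b3].
  rewrite (le_trans (linear_row_bound v (coef_derive2_linear u w Dx)))//.
  rewrite ler_wpM2r// (@le_trans _ _ (K3 * `|u| * `|w|))//; last first.
    by do 2!rewrite ler_wpM2r//; lra.
  rewrite !mulr_suml; apply: ler_sum => i _.
  rewrite (le_trans (linear_row_bound w (coef_derive2_linearm u _ Dx)))//.
  rewrite ler_wpM2r// mulr_suml; apply: ler_sum => j _.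
  rewrite (le_trans (linear_row_bound u (coef_derive2_linearl _ _ Dx)))//.
  by rewrite ler_wpM2r//; apply: ler_sum => k _; exact: b3.
Unshelve. all: by end_near. Qed.

End Coefficients.

Section MatrixCurves.
Context {R : realType}.

Lemma is_derive_mulmx m n p (f : R -> 'M[R]_(m, n)) (g : R -> 'M[R]_(n, p))
    (df : 'M[R]_(m, n)) (dg : 'M[R]_(n, p)) (t : R) :
  is_derive t 1 f df -> is_derive t 1 g dg ->
  is_derive t 1 (fun s => f s *m g s) (df *m g t + f t *m dg).
Proof.
move=> [fd <-] [gd <-].
have [fd' gd'] := ((derivable1_diffP _ _).1 fd, (derivable1_diffP _ _).1 gd).
split; last exact: derive_mulmx.
exact/derivable1_diffP/differentiable_mulmx.
Qed.

Lemma is_derive_scale_id m n (f : R -> 'M[R]_(m, n)) (df : 'M[R]_(m, n)) (t : R) :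
  is_derive t 1 f df -> is_derive t 1 (fun s => s *: f s) (f t + t *: df).
Proof.
move=> [fd fD]; apply: is_derive_mx => i j.
have fij : is_derive t 1 (fun s => f s i j) (df i j).
  split; first by move/derivable_mxP: fd; exact.
  by rewrite -fD derive_mx// mxE.
have h : is_derive t 1 (id * (fun s => f s i j)) (t *: df i j + f t i j *: 1).
  exact: is_deriveM.
have -> : (fun s => (s *: f s) i j) = id * (fun s => f s i j).
  by apply/funext => s; rewrite mxE.
apply: is_derive_eq h _.
by rewrite !mxE /GRing.scale/= mulr1 addrC.
Qed.

End MatrixCurves.

(** * Flat linear systems integrated along rays *)

Section Frobenius.
Context {R : realType} {n m p : nat}.
Variables (A : 'rV[R]_n -> 'rV[R]_n -> 'M[R]_m) (D : set 'rV[R]_n).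
Hypothesis Do : open D.
Hypothesis Alin : forall x, linear (A x).
Hypothesis Asm : forall v, smooth D (fun x => A x v).
Hypothesis Aflat : forall (x u v : 'rV[R]_n), D x ->
  'D_u (fun y => A y v) x - 'D_v (fun y => A y u) x
  + A x v *m A x u - A x u *m A x v = 0.

(** Freezes the coefficients of the equation along a ray outside [[0, 1]], since [linear_ode] takes
    coefficients defined on the whole line. *)
Let unit_clamp (t : R) : R := Num.max 0 (Num.min t 1).

Let unit_clamp_continuous : continuous unit_clamp.
Proof.
have minc t : {for t, continuous ((id : R -> R^o) \min cst 1)}.
  by apply: continuous_min; [exact: cvg_id|exact: cst_continuous].
have maxc t : {for t, continuous ((cst 0 : R -> R^o) \max (id \min cst 1))}.
  by apply: continuous_max; [exact: cst_continuous|exact: minc].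
exact: maxc.
Qed.

Let unit_clamp_in t : 0 <= unit_clamp t <= 1.
Proof. by rewrite /unit_clamp le_max ge_max ge_min lexx ler01 lexx ?orbT. Qed.

Let unit_clampE (t : R) : 0 <= t <= 1 -> unit_clamp t = t.
Proof. by move=> /andP[t0 t1]; rewrite /unit_clamp min_l// max_r. Qed.

(** [mKr] makes [A x w] with [|w| < r] small enough for [linear_ode]; [r1] lets factors [|w|] be
    dropped from the error estimates. *)
Variables (x0 : 'rV[R]_n) (r K : R) (Y0 : 'M[R]_(m, p)).
Hypothesis r0 : 0 < r.
Hypothesis r1 : r <= 1.
Hypothesis K0 : 0 < K.
Hypothesis rD : ball x0 r `<=` D.
Hypothesis mKr : m%:R * (K * r) <= 4^-1.
Hypothesis AK : forall (x v : 'rV[R]_n), ball x0 r x -> `|A x v| <= K * `|v|.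
Hypothesis DAK : forall (x u v : 'rV[R]_n), ball x0 r x ->
  `|'D_u (fun y => A y v) x| <= K * `|u| * `|v|.
Hypothesis DDAK : forall (x u w v : 'rV[R]_n), ball x0 r x ->
  `|'D_u (fun z => 'D_w (fun y => A y v) z) x| <= K * `|u| * `|w| * `|v|.

Let ball_ray (w : 'rV[R]_n) (t : R) : `|w| < r -> 0 <= t <= 1 -> ball x0 r (x0 + t *: w).
Proof.
move=> wr /andP[t0 t1]; rewrite -ball_normE/= opprD addNKr normrN normrZ.
by rewrite ger0_norm// (le_lt_trans _ wr)// ler_piMl.
Qed.

Lemma ray_solution (w : 'rV[R]_n) : `|w| < r -> exists y : R -> 'M[R]_(m, p),
  y 0 = Y0 /\ forall t : R, 0 <= t <= 1 ->
    is_derive t 1 y (A (x0 + t *: w) w *m y t).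
Proof.
move=> wr; pose B t := A (x0 + unit_clamp t *: w) w.
have Bc : continuous B.
  move=> t; apply: (@continuous_comp _ _ _ (fun t => x0 + unit_clamp t *: w)
    (fun x => A x w)).
    apply: cvgD; first exact: cvg_cst.
    by apply: cvgZr_tmp; exact: unit_clamp_continuous.
  by apply: smooth_continuous (Asm w) _; exact/rD/ball_ray.
have [|y [y0 yD]] := @linear_ode R m p B Y0 Bc.
  move=> t; rewrite (le_trans _ mKr)// ler_wpM2l//.
  by rewrite (le_trans (AK _ (ball_ray wr (unit_clamp_in t))))// ler_pM2l// ltW.
exists y; split=> // t t01; have := yD t; rewrite /B unit_clampE//; apply.
by move: t01 => /andP[? ?]; apply/andP; split; lra.
Qed.

(** A solution along the ray from [x0] to [x0 + w]; its value at time [1] is the candidate for the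
    value at [x0 + w] of the solution of the whole system. Outside the ball the constant is a
    default. *)
Let sol (w : 'rV[R]_n) : R -> 'M[R]_(m, p) :=
  match pselect (`|w| < r) with
  | left h => sval (cid (ray_solution h))
  | right _ => fun=> Y0
  end.

Let sol0 w : sol w 0 = Y0.
Proof. by rewrite /sol; case: pselect => // h; case: cid => y [y0 yD] /=. Qed.

Let solD w (t : R) : `|w| < r -> 0 <= t <= 1 ->
  is_derive t 1 (sol w) (A (x0 + t *: w) w *m sol w t).
Proof.
by rewrite /sol; case: pselect => // h _; case: cid => y [y0 yD] /=; exact: yD.
Qed.

Let within_unit_continuous (z dz : R -> 'M[R]_(m, p)) :
  (forall t : R, 0 <= t <= 1 -> is_derive t 1 z (dz t)) ->
  {within `[0, 1], continuous z}.
Proof.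
move=> zD; apply: continuous_in_subspaceT => t; rewrite inE/= in_itv/= => t01.
exact: derivable_continuous (zD t t01).
Qed.

Let AZ_bound (x w : 'rV[R]_n) (Z : 'M[R]_(m, p)) : ball x0 r x -> `|w| < r ->
  `|A x w *m Z| <= 4^-1 * `|Z|.
Proof.
move=> xr wr; rewrite (le_trans (mx_norm_mul _ _))// ler_wpM2r//.
rewrite (le_trans _ mKr)// ler_wpM2l// (le_trans (AK _ xr))// ler_pM2l//.
exact: ltW.
Qed.

Let sol_bound (w : 'rV[R]_n) (t : R) : `|w| < r -> 0 <= t <= 1 -> `|sol w t| <= 2 * `|Y0|.
Proof.
move=> wr t01.
have zD (s : R) : 0 <= s <= 1 -> is_derive s 1 (fun s => sol w s - Y0)
    (A (x0 + s *: w) w *m sol w s).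
  move=> s01; have := solD wr s01 => h.
  by rewrite -[X in is_derive _ _ _ X]subr0; exact: is_deriveB.
have sub (s : R) : 0 < s < 1 -> 0 <= s <= 1 by move=> /andP[/ltW -> /ltW ->].
have := @gronwall_small _ _ _ (fun s => sol w s - Y0)
  (fun s => A (x0 + s *: w) w *m sol w s) (4^-1 * `|Y0|).
rewrite sol0 subrr mulr_ge0 ?invr_ge0// => /(_ isT erefl (within_unit_continuous zD)).
move=> /(_ (fun s s01 => zD s (sub s s01))) => H.
have Y0p := normr_ge0 Y0.
suff : `|sol w t - Y0| <= 2 * (4^-1 * `|Y0|).
  by have := ler_normD (sol w t - Y0) Y0; rewrite subrK; lra.
apply: H => // s s01; have s01' := sub s s01.
rewrite (le_trans (AZ_bound _ (ball_ray wr s01') wr))//.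
have := ler_normD (sol w s - Y0) Y0; rewrite subrK.
by have := normr_ge0 (sol w s - Y0); lra.
Qed.

Let A_scale y a w : A y (a *: w) = a *: A y w.
Proof.
have A0 : A y 0 = 0.
  by have := Alin y 1 0 0; rewrite !scale1r addr0 -{1}[A y 0]addr0 => /addrI <-.
by have := Alin y a w 0; rewrite A0 !addr0.
Qed.

(** Both sides solve the same equation along the ray of [s *: w], so their difference vanishes by
    [gronwall_small] with [e = 0]. The case [s = 0] gives the initial value at the centre. *)
Let sol_scale (w : 'rV[R]_n) (s t : R) : `|w| < r -> 0 <= s <= 1 -> 0 <= t <= 1 ->
  sol (s *: w) t = sol w (s * t).
Proof.
move=> wr s01 t01.
have swr : `|s *: w| < r.
  move: s01 => /andP[s0 s1].
  by rewrite normrZ ger0_norm// (le_lt_trans _ wr)// ler_piMl.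
have st01 (x : R) : 0 <= x <= 1 -> 0 <= s * x <= 1.
  move: s01 => /andP[s0 s1] /andP[x0' x1].
  by rewrite mulr_ge0//= mulr_ile1.
have zD (x : R) : 0 <= x <= 1 -> is_derive x 1 (fun x => sol (s *: w) x - sol w (s * x))
    (A (x0 + x *: (s *: w)) (s *: w) *m (sol (s *: w) x - sol w (s * x))).
  move=> x01; have h1 := solD swr x01; have h2 := solD wr (st01 _ x01).
  have [h2d h2D] := h2.
  have h3 : is_derive x 1 (fun x => sol w (s * x))
      (A (x0 + x *: (s *: w)) (s *: w) *m sol w (s * x)).
    have dw : differentiable (sol w) (0 + x *: s).
      by rewrite add0r /GRing.scale/= mulrC; apply/derivable1_diffP.
    have h := is_derive_line dw.
    rewrite (_ : (fun x => sol w (s * x)) = fun y : R => sol w (0 + y *: s)).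
      apply: is_derive_eq h _.
      rewrite -[X in derive _ _ X]mulr1 derivative_scale// add0r.
      rewrite (_ : x *: s = s * x); last by rewrite mulrC.
      by rewrite h2D A_scale scalerA (mulrC x) -scalemxAl.
    by apply/funext => y; rewrite add0r mulrC.
  by rewrite mulmxBr; exact: is_deriveB.
have sub (x : R) : 0 < x < 1 -> 0 <= x <= 1 by move=> /andP[/ltW -> /ltW ->].
have := @gronwall_small _ _ _ (fun x => sol (s *: w) x - sol w (s * x))
  (fun x => A (x0 + x *: (s *: w)) (s *: w) *m (sol (s *: w) x - sol w (s * x)))
  0 (lexx 0).
rewrite mulr0 !sol0 subrr => /(_ erefl (within_unit_continuous zD)).
move=> /(_ (fun x x01 => zD x (sub x x01))) => H.
apply/subr0_eq/eqP; rewrite -normr_le0; have := H _ t t01; rewrite mulr0; apply.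
move=> x x01; rewrite addr0.
rewrite (le_trans (AZ_bound _ (ball_ray swr (sub _ x01)) swr))//.
by rewrite ler_wpM2r// lef_pV2 ?posrE//; lra.
Qed.

Let ball_convex X k (t : R) : ball x0 r X -> ball x0 r (X + k) -> 0 <= t <= 1 ->
  ball x0 r (X + t *: k).
Proof.
rewrite -ball_normE/= => Xr Xkr /andP[t0 t1].
have -> : x0 - (X + t *: k) = (1 - t) *: (x0 - X) + t *: (x0 - (X + k)).
  by apply/rowP => j; rewrite !mxE; ring.
have t1' : 0 <= 1 - t by rewrite subr_ge0.
rewrite (le_lt_trans (ler_normD _ _))// !normrZ !ger0_norm//.
have [->|tn0] := eqVneq t 0; first by rewrite subr0 mul1r mul0r addr0.
have tp : 0 < t by rewrite lt_neqAle eq_sym tn0.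
rewrite [ltRHS](_ : r = (1 - t) * r + t * r); last by ring.
by rewrite ler_ltD ?ler_wpM2l ?ltr_pM2l// ltW.
Qed.

Let A_diff v X : ball x0 r X -> differentiable (fun y => A y v) X.
Proof. by move=> Xr; apply: smooth_differentiable (Asm v) _; exact: rD. Qed.

Let A_diffD u v X : ball x0 r X -> differentiable (fun y => 'D_u (fun z => A z v) y) X.
Proof.
by move=> Xr; apply: smooth_differentiable (smooth_derive u (Asm v)) _; exact: rD.
Qed.

Let A_growth X k v : ball x0 r X -> ball x0 r (X + k) ->
  `|A (X + k) v - A X v| <= K * `|k| * `|v|.
Proof.
move=> Xr Xkr; apply: (@mean_value_segment _ _ _ _ (fun y => A y v)).
- by rewrite !mulr_ge0// ltW.
- by move=> t t01; exact/A_diff/ball_convex.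
- by move=> t t01; exact/DAK/ball_convex.
Qed.

(** The mean value inequality is used twice: for the coefficient minus its linear part along the
    segment, whose derivative is an increment of ['D_k A], and then for that increment. *)
Let A_taylor X k v : ball x0 r X -> ball x0 r (X + k) ->
  `|A (X + k) v - A X v - 'D_k (fun y => A y v) X| <= K * `|k| * `|k| * `|v|.
Proof.
move=> Xr Xkr; set a := 'D_k _ X.
have Kk : 0 <= K * `|k| * `|k| * `|v| by rewrite !mulr_ge0// ltW.
have segd (t : R) : 0 <= t <= 1 -> is_derive t 1
    (fun s => A (X + s *: k) v - s *: a) ('D_k (fun y => A y v) (X + t *: k) - a).
  move=> t01; apply: is_deriveB.
    by apply: is_derive_line; exact/A_diff/ball_convex.
  have ca : is_derive t 1 (fun _ : R => a) 0 by exact: is_derive_cst.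
  have := is_derive_scale_id ca.
  by rewrite scaler0 addr0.
have sub (s : R) : s \in `]0, 1[%R -> 0 <= s <= 1.
  by rewrite in_itv/= => /andP[/ltW -> /ltW ->].
have := @mean_value_mx _ _ _ (fun s => A (X + s *: k) v - s *: a)
  (fun t => 'D_k (fun y => A y v) (X + t *: k) - a) 0 1 _ ler01 Kk
  (fun t t01 => segd t (sub t t01)).
rewrite !scale1r !scale0r !addr0 !subr0 mulr1 addrAC; apply.
  apply: continuous_in_subspaceT => t; rewrite inE/= in_itv/= => t01.
  exact: derivable_continuous (segd t t01).
move=> t /sub t01.
apply: (@mean_value_segment _ _ _ _ (fun z => 'D_k (fun y => A y v) z) X (t *: k)) => //.
  move=> s s01; apply: A_diffD; apply: ball_convex => //; exact: ball_convex.
move=> s s01; have sr : ball x0 r (X + s *: (t *: k)).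
  by apply: ball_convex => //; exact: ball_convex.
rewrite derivative_scale; last exact: A_diffD.
rewrite normrZ -[leRHS]mul1r ler_pM//; last exact: DDAK.
by move: t01 => /andP[? ?]; rewrite ger0_norm.
Qed.

(** The factors are: [2] from [gronwall_small], [m] from the norm of a product, the bound [BrK] of
    the defect, and [sol_bound]. *)
Let C := 2 * (m%:R * ((2 * K + 2 * m%:R * K ^+ 2) * (2 * `|Y0|))).

(* The candidate variation [t *: (A (X t) h *m sol w t)] satisfies the linearised
   equation up to [|h| ^ 2], since flatness cancels the terms linear in [h]. *)
Let sol_expansion w h : `|w| < r -> `|w + h| < r ->
  `|sol (w + h) 1 - (sol w 1 + A (x0 + w) h *m sol w 1)| <= C * (`|h| * `|h|).
Proof.
move=> wr whr.
pose X (t : R) := x0 + t *: w.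
pose P (t : R) := A (x0 + t *: (w + h)) (w + h).
pose v (t : R) := sol w t + t *: (A (X t) h *m sol w t).
(* [Br t *m sol w t] is the defect of [v] in the equation along [w + h], namely [P t *m v t] minus
   the derivative of [v]. *)
pose Br (t : R) := P t + t *: (P t *m A (X t) h) - A (X t) w - A (X t) h
   - t *: 'D_w (fun y => A y h) (X t) - t *: (A (X t) h *m A (X t) w).
have Xr (t : R) : 0 <= t <= 1 -> ball x0 r (X t) by move=> t01; exact: ball_ray.
have XhE (t : R) : x0 + t *: (w + h) = X t + t *: h.
  by rewrite /X scalerDr addrA.
have Xhr (t : R) : 0 <= t <= 1 -> ball x0 r (X t + t *: h).
  by move=> t01; rewrite -XhE; exact: ball_ray.
have zD (t : R) : 0 <= t <= 1 -> is_derive t 1 (fun t => sol (w + h) t - v t)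
    (P t *m (sol (w + h) t - v t) + Br t *m sol w t).
  move=> t01; have h1 := solD whr t01; have h2 := solD wr t01.
  have h3 : is_derive t 1 (fun t => A (X t) h) ('D_w (fun y => A y h) (X t)).
    by apply: is_derive_line; exact/A_diff/Xr.
  have h4 := is_deriveD h2 (is_derive_scale_id (is_derive_mulmx h3 h2)).
  apply: is_derive_eq (is_deriveB h1 h4) _.
  rewrite /Br /v -/(P t) !(mulmxBr, mulmxBl, mulmxDl, mulmxDr) -!scalemxAr -!scalemxAl.
  rewrite !mulmxA.
  by mx_ring.
(* Flatness trades ['D_w] of the coefficient in direction [h] for ['D_h] of the one in direction
   [w]. What remains is a Taylor remainder and two products of increments, all quadratic in [h]. *)
have BrE (t : R) : 0 <= t <= 1 -> Br t =
    (A (X t + t *: h) w - A (X t) w - 'D_(t *: h) (fun y => A y w) (X t))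
    + (A (X t + t *: h) h - A (X t) h) + t *: ((P t - A (X t) w) *m A (X t) h).
  move=> t01; have fl := Aflat h w (rD (Xr _ t01)).
  rewrite derivative_scale; last exact/A_diff/Xr.
  rewrite /Br.
  have PE : P t = A (X t + t *: h) w + A (X t + t *: h) h.
    rewrite /P XhE; have := Alin (X t + t *: h) 1 w h.
    by rewrite !scale1r.
  have {}fl : 'D_w (fun y => A y h) (X t) = 'D_h (fun y => A y w) (X t)
     + A (X t) w *m A (X t) h - A (X t) h *m A (X t) w.
    by apply/eqP; rewrite -subr_eq0 -oppr_eq0 -fl; apply/eqP; mx_ring.
  rewrite fl {1}PE mulmxBl.
  by mx_ring.
  have t1 (t : R) : 0 <= t <= 1 -> 0 <= t /\ t <= 1 by move=> /andP[].
  have w1 : `|w| <= 1 by rewrite (le_trans (ltW wr)).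
  have K0' := ltW K0.
  have BrK (t : R) : 0 <= t <= 1 ->
      `|Br t| <= (2 * K + 2 * m%:R * K ^+ 2) * (`|h| * `|h|).
    move=> t01; have [tp tl] := t1 t t01.
    have th : `|t *: h| <= `|h| by rewrite normrZ ger0_norm// ler_piMl.
    have T1 : `|A (X t + t *: h) w - A (X t) w - 'D_(t *: h) (fun y => A y w) (X t)|
        <= K * (`|h| * `|h|).
      rewrite (le_trans (A_taylor _ (Xr _ t01) (Xhr _ t01)))// -!mulrA ler_wpM2l//.
      by rewrite ler_pM ?mulr_ge0// -[leRHS]mulr1 ler_pM.
    have T2 : `|A (X t + t *: h) h - A (X t) h| <= K * (`|h| * `|h|).
      rewrite (le_trans (A_growth _ (Xr _ t01) (Xhr _ t01)))// -mulrA ler_wpM2l//.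
      by rewrite ler_wpM2r.
    have Q : `|P t - A (X t) w| <= 2 * K * `|h|.
      have -> : P t - A (X t) w =
          (A (X t + t *: h) w - A (X t) w) + A (X t + t *: h) h.
        rewrite /P XhE; have := Alin (X t + t *: h) 1 w h.
        by rewrite !scale1r => ->; mx_ring.
      rewrite (le_trans (ler_normD _ _))//.
      rewrite (_ : 2 * K * `|h| = K * `|h| + K * `|h|); last by ring.
      apply: lerD; last exact/AK/Xhr.
      rewrite (le_trans (A_growth _ (Xr _ t01) (Xhr _ t01)))//.
      by rewrite -mulrA ler_wpM2l// -[leRHS]mulr1 ler_pM.
    have T3 : `|t *: ((P t - A (X t) w) *m A (X t) h)|
        <= 2 * m%:R * K ^+ 2 * (`|h| * `|h|).
      rewrite normrZ ger0_norm// (@le_trans _ _ `|(P t - A (X t) w) *m A (X t) h|)//.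
        by rewrite ler_piMl.
      rewrite (le_trans (mx_norm_mul _ _))//.
      rewrite (_ : _ * (`|h| * `|h|) = m%:R * (2 * K * `|h|) * (K * `|h|)); last by ring.
      by rewrite ler_pM ?mulr_ge0// ?ler_wpM2l//; exact/AK/Xr.
    rewrite BrE// (le_trans (ler_normD _ _))// mulrDl lerD//.
    by rewrite (le_trans (ler_normD _ _))// mulr2n mulrDl mulrDl lerD ?mul1r.
  pose e := m%:R * ((2 * K + 2 * m%:R * K ^+ 2) * (`|h| * `|h|)) * (2 * `|Y0|).
  have e0 : 0 <= e.
    by rewrite !mulr_ge0// addr_ge0 ?mulr_ge0// exprn_ge0.
  have sub (t : R) : 0 < t < 1 -> 0 <= t <= 1 by move=> /andP[/ltW -> /ltW ->].
  have := @gronwall_small _ _ _ (fun t => sol (w + h) t - v t)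
    (fun t => P t *m (sol (w + h) t - v t) + Br t *m sol w t) e e0.
  rewrite {1}/v !sol0 scale0r addr0 subrr => /(_ erefl (within_unit_continuous zD)).
  move=> /(_ (fun t t01 => zD t (sub t t01))) H.
  have : `|sol (w + h) 1 - v 1| <= 2 * e.
    apply: H; last by rewrite ler01 lexx.
    move=> t t01; have t01' := sub t t01.
    rewrite (le_trans (ler_normD _ _))// lerD//.
      rewrite (le_trans (AZ_bound _ (ball_ray whr t01') whr))//.
      by rewrite ler_wpM2r// lef_pV2 ?posrE//; lra.
    rewrite (le_trans (mx_norm_mul _ _))//.
    rewrite ler_pM ?mulr_ge0// ?ler_wpM2l//; first exact: BrK.
    exact: sol_bound.
  rewrite /v /X !scale1r => /le_trans; apply.
  by rewrite /e /C; rewrite le_eqVlt; apply/orP; left; apply/eqP; ring.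
Qed.

Lemma frobenius_ball : exists F : 'rV[R]_n -> 'M[R]_(m, p), F x0 = Y0 /\
  forall x, ball x0 r x ->
    differentiable F x /\ forall v, 'D_v F x = A x v *m F x.
Proof.
exists (fun x => sol (x - x0) 1); split.
  rewrite subrr -[0 : 'rV[R]_n](scale0r 0) sol_scale ?mul0r ?sol0//.
  - by rewrite normr0.
  - by rewrite lexx ler01.
  - by rewrite lexx ler01.
move=> x xr.
have AL : linear (fun h => A x h *m sol (x - x0) 1).
  by move=> a u v; rewrite Alin mulmxDl scalemxAl.
apply: differentiable_eps => //; first exact: linear_row_continuous.
move=> e e0.
have C0 : 0 <= C.
  by rewrite /C !mulr_ge0// addr_ge0 ?mulr_ge0 ?exprn_ge0// ltW.
have xr' : `|x - x0| < r by move: xr; rewrite -ball_normE/= distrC.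
have H1 : \forall h \near (0 : 'rV[R]_n), `|h| < r - `|x - x0|.
  by apply: nbhs0_lt; rewrite subr_gt0.
have H2 : \forall h \near (0 : 'rV[R]_n), `|h| < e / (C + 1).
  by apply: nbhs0_lt; rewrite divr_gt0// ltr_wpDl.
apply: filterS2 H1 H2 => h h1 h2.
have whr : `|x - x0 + h| < r.
  by rewrite (le_lt_trans (ler_normD _ _))// addrC -ltrBrDr.
have := sol_expansion xr' whr.
rewrite (addrC h) addrAC (addrC x0) subrK opprD addrA => /le_trans; apply.
rewrite mulrA ler_wpM2r// (@le_trans _ _ ((C + 1) * `|h|))//.
  by rewrite ler_wpM2r// lerDl.
by rewrite mulrC -ler_pdivlMr ?ltr_wpDl// ltW.
Qed.

End Frobenius.

Section FrobeniusTheorem.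
Context {R : realType} {n m p : nat}.

(** Bootstrapping: each derivative of [F] is a smooth coefficient times [F], hence as regular as [F]
    itself. *)
Lemma smooth_linear_system (A : 'rV[R]_n -> 'rV[R]_n -> 'M[R]_m) (D : set 'rV[R]_n)
    (F : 'rV[R]_n -> 'M[R]_(m, p)) : open D ->
  (forall v, smooth D (fun x => A x v)) ->
  (forall x, D x -> differentiable F x /\ forall v, 'D_v F x = A x v *m F x) ->
  smooth D F.
Proof.
move=> Do Asm FD; elim=> [|k ih].
  by move=> x /FD[+ _]; exact: differentiable_continuous.
split=> [x /FD[]//|v].
apply: Ck_eq (Ck_mulmx Do (Asm v k) ih) => // x; rewrite inE => /FD[_ +].
by move=> ->.
Qed.

Theorem frobenius (A : 'rV[R]_n -> 'rV[R]_n -> 'M[R]_m) (D : set 'rV[R]_n)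
    (x0 : 'rV[R]_n) (Y0 : 'M[R]_(m, p)) :
  open D -> D x0 -> (forall x, linear (A x)) ->
  (forall v, smooth D (fun x => A x v)) ->
  (forall (x u v : 'rV[R]_n), D x ->
    'D_u (fun y => A y v) x - 'D_v (fun y => A y u) x
    + A x v *m A x u - A x u *m A x v = 0) ->
  exists (r : R) (F : 'rV[R]_n -> 'M[R]_(m, p)),
    [/\ 0 < r, ball x0 r `<=` D, F x0 = Y0, smooth (ball x0 r) F &
     forall x v, ball x0 r x -> 'D_v F x = A x v *m F x].
Proof.
move=> Do Dx0 Alin Asm Aflat.
have [r [K [[r0 K0 rD] [AK DAK DDAK]]]] := coef_bounds Do Alin Asm Dx0.
pose s := Num.min (Num.min r 1) (4^-1 / (m%:R * K + 1)).
have mK : 0 < m%:R * K + 1 by rewrite ltr_wpDl// mulr_ge0// ltW.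
have s0 : 0 < s by rewrite !lt_min r0 ltr01 divr_gt0// invr_gt0.
have sr : ball x0 s `<=` ball x0 r.
  by apply: le_ball; rewrite /s !ge_min lexx.
have s1 : s <= 1 by rewrite /s !ge_min lexx orbT.
have mKs : m%:R * (K * s) <= 4^-1.
  rewrite mulrA (@le_trans _ _ ((m%:R * K + 1) * s))//.
    by rewrite ler_wpM2r ?lerDl// ltW.
  by rewrite mulrC -ler_pdivlMr// /s ge_min lexx orbT.
have sD : ball x0 s `<=` D by move=> x /sr/rD.
have [F [F0 FD]] := @frobenius_ball R n m p A D Alin Asm Aflat x0 s K Y0
  s0 s1 K0 sD mKs (fun x v xs => AK x v (sr x xs))
  (fun x u v xs => DAK x u v (sr x xs)) (fun x u w v xs => DDAK x u w v (sr x xs)).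
exists s, F; split=> //.
- apply: (@smooth_linear_system A) => //; first exact: ball_open.
  by move=> v k; exact: Ck_sub sD (Asm v k).
- by move=> x v xs; have [_] := FD x xs; exact.
Qed.

End FrobeniusTheorem.

(** * The Levi-Civita connection *)

Section MovingFamily.
Context {R : realType} {n p q : nat}.

(** Leibniz rule for a vector field inserted into a linear map that varies with the point. It covers
    both ['D_(X y) Y y] and [Gam y (X y)], the two terms of [nabla]. *)
Lemma derive_linear_family (A : 'rV[R]_n -> 'rV[R]_n -> 'M[R]_(p, q))
    (Y : 'rV[R]_n -> 'rV[R]_n) (D : set 'rV[R]_n) x u : open D ->
  (forall y, D y -> linear (A y)) -> (forall v, smooth D (fun y => A y v)) ->
  smooth D Y -> D x ->
  'D_u (fun y => A y (Y y)) x = 'D_u (fun y => A y (Y x)) x + A x ('D_u Y x).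
Proof.
move=> Do Alin Asm Ysm Dx.
have expand y v : D y -> A y v = \sum_i v 0 i *: A y (delta_mx 0 i).
  move=> Dy; pose Lin := GRing.isLinear.Build R 'rV[R]_n _ *:%R (A y) (Alin y Dy).
  pose f' : {linear 'rV[R]_n -> 'M[R]_(p, q)} := HB.pack (A y) Lin.
  rewrite -[A y]/(f' : _ -> _) {1}(row_sum_delta v) linear_sum.
  by apply: eq_bigr => i _; rewrite linearZ.
have dA v : differentiable (fun y => A y v) x.
  exact: smooth_differentiable (Asm v) Dx.
have dY : differentiable Y x by exact: smooth_differentiable Ysm Dx.
have dYi i : differentiable (fun y => Y y 0 i) x.
  by move/differentiable_mxP: dY; exact.
have dS (c : 'rV[R]_n -> R) (F : 'rV[R]_n -> 'M[R]_(p, q)) :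
    differentiable c x -> differentiable F x ->
    differentiable (fun y => c y *: F y) x.
  move=> dc /differentiable_mxP dF; apply/differentiable_mxP => i j.
  rewrite (_ : (fun _ => _) = fun y => c y * F y i j); first exact: differentiableM.
  by apply/funext => y; rewrite mxE.
have DS (c : 'rV[R]_n -> R) (F : 'rV[R]_n -> 'M[R]_(p, q)) :
    differentiable c x -> differentiable F x ->
    'D_u (fun y => c y *: F y) x = 'D_u c x *: F x + c x *: 'D_u F x.
  move=> dc dF; apply/matrixP => i j; rewrite derive_mx_entry; last exact: dS.
  have dFij : differentiable (fun y => F y i j) x by move/differentiable_mxP: dF; exact.
  rewrite (_ : (fun y => _) = fun y => c y * F y i j); last first.
    by apply/funext => y; rewrite mxE.
  rewrite deriveM; [|exact: diff_derivable..].
  by rewrite !mx_entryE derive_mx_entry// addrC /GRing.scale/= (mulrC (F x i j)).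
transitivity ('D_u (fun y => \sum_i Y y 0 i *: A y (delta_mx 0 i)) x).
  by apply: (@derive_open_eq _ _ _ D) => // y; rewrite inE => /expand.
rewrite (_ : (fun y => \sum_i _) = \sum_i (fun y => Y y 0 i *: A y (delta_mx 0 i)));
  last by apply/funext => y; rewrite fct_sumE.
rewrite derive_sum; last by move=> i; exact/diff_derivable/dS.
have -> : 'D_u (fun y => A y (Y x)) x =
    \sum_i Y x 0 i *: 'D_u (fun y => A y (delta_mx 0 i)) x.
  transitivity ('D_u (fun y => \sum_i Y x 0 i *: A y (delta_mx 0 i)) x).
    by apply: (@derive_open_eq _ _ _ D) => // y; rewrite inE => /expand.
  rewrite (_ : (fun y => \sum_i _) = \sum_i (fun y => Y x 0 i *: A y (delta_mx 0 i)));
    last by apply/funext => y; rewrite fct_sumE.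
  rewrite derive_sum; last by move=> i; exact/derivableZ/diff_derivable.
  by apply: eq_bigr => i _; rewrite deriveZ//; exact: diff_derivable.
rewrite (expand x _ Dx) -big_split/=; apply: eq_bigr => i _.
by rewrite DS// addrC derive_mx_entry.
Qed.

Lemma smooth_linear_family (A : 'rV[R]_n -> 'rV[R]_n -> 'M[R]_(p, q))
    (Y : 'rV[R]_n -> 'rV[R]_n) (D : set 'rV[R]_n) : open D ->
  (forall y, D y -> linear (A y)) -> (forall v, smooth D (fun y => A y v)) ->
  smooth D Y -> smooth D (fun y => A y (Y y)).
Proof.
move=> Do Alin Asm Ysm k.
have h : Ck k D (fun y => \sum_i Y y 0 i *: A y (delta_mx 0 i)).
  apply: Ck_sum => // i _; apply: Ck_scale => //; last exact: Asm.
  by move/Ck_mxP: (Ysm k); exact.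
apply: Ck_eq h => // y; rewrite inE => Dy.
pose Lin := GRing.isLinear.Build R 'rV[R]_n _ *:%R (A y) (Alin y Dy).
pose f' : {linear 'rV[R]_n -> 'M[R]_(p, q)} := HB.pack (A y) Lin.
rewrite -[A y]/(f' : _ -> _) [in RHS](row_sum_delta (Y y)) linear_sum.
by apply: eq_bigr => i _; rewrite linearZ.
Qed.

End MovingFamily.

Section Connection.
Context {R : realType} {n : nat}.
Variable g : 'rV[R]_n -> 'M[R]_n.

(* [v *m connection x u] is the vector $\Gamma(u, v)$ at [x]. *)
Definition connection (x u : 'rV[R]_n) : 'M[R]_n :=
  \matrix_(j, k) \sum_i christoffel g k i j x * u 0 i.

(** The order of the products is that of matrices acting on rows from the right. The same expression
    is the integrability condition of ['D_v F = A x v *m F], hence the generality: it is applied to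
    the Levi-Civita connection and to the systems of the fundamental theorem. *)
Definition connection_curvature m (A : 'rV[R]_n -> 'rV[R]_n -> 'M[R]_m)
    (x u v : 'rV[R]_n) : 'M[R]_m :=
  'D_u (fun y => A y v) x - 'D_v (fun y => A y u) x
  + A x v *m A x u - A x u *m A x v.

Lemma nablaE X Y x :
  nabla g X Y x = 'D_(X x) Y x + Y x *m connection x (X x).
Proof.
congr (_ + _); apply/rowP => k; rewrite !mxE exchange_big/=.
apply: eq_bigr => j _; rewrite mxE mulr_sumr; apply: eq_bigr => i _.
by rewrite mulrC.
Qed.

Lemma connection_linear x : linear (connection x).
Proof.
move=> a u v; apply/matrixP => j k; rewrite !mxE mulr_sumr -big_split/=.
by apply: eq_bigr => i _; rewrite !mxE; ring.
Qed.

Lemma connectionB x u v : connection x (u - v) = connection x u - connection x v.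
Proof.
by have := connection_linear x (-1) v u; rewrite !scaleN1r !(addrC (- _)).
Qed.

Variable D : set 'rV[R]_n.
Hypothesis Do : open D.
Hypothesis gsm : smooth D g.
Hypothesis gsym : forall x, D x -> (g x)^T = g x.
Hypothesis gunit : forall x, D x -> g x \in unitmx.

Lemma dmetric_sym i j k x : D x -> dmetric g i j k x = dmetric g i k j x.
Proof.
move=> Dx; apply: (@derive_open_eq _ _ _ D) => // y; rewrite inE => Dy.
by rewrite -(gsym Dy) mxE (gsym Dy).
Qed.

Lemma dmetricE i j k x : D x -> dmetric g i j k x = ('D_(delta_mx 0 i) g x) j k.
Proof.
by move=> Dx; rewrite derive_mx_entry//; exact: smooth_differentiable gsm Dx.
Qed.

Lemma christoffel_sym k i j x : D x -> christoffel g k i j x = christoffel g k j i x.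
Proof.
move=> Dx; congr (_ * _); apply: eq_bigr => l _; congr (_ * _).
by rewrite (dmetric_sym l i j Dx); ring.
Qed.

Lemma christoffel_smooth k i j : smooth D (christoffel g k i j).
Proof.
move=> a; apply: Ck_mul => //; first exact: Ck_cst.
have dsm i' j' l' : Ck a D (dmetric g i' j' l').
  have := smooth_derive (delta_mx 0 i') gsm a => /Ck_mxP => /(_ Do j' l').
  by apply: Ck_eq => // y; rewrite inE => Dy; rewrite dmetricE.
apply: Ck_sum => // l _; apply: Ck_mul => //.
  by have := @Ck_invmx _ _ _ _ _ _ Do gunit (gsm a) => /Ck_mxP; exact.
by apply: CkB => //; apply: CkD.
Qed.

Lemma connection_smooth u : smooth D (fun x => connection x u).
Proof.
move=> a; apply/Ck_mxP => // j k.
have h : Ck a D (fun x => \sum_i christoffel g k i j x * u 0 i).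
  apply: Ck_sum => // i _; apply: Ck_mul => //; first exact: christoffel_smooth.
  exact: Ck_cst.
by apply: Ck_eq h => // y _; rewrite mxE.
Qed.

Lemma connection_differentiable u x : D x -> differentiable (fun y => connection y u) x.
Proof. by move=> Dx; exact: smooth_differentiable (connection_smooth u) Dx. Qed.

Lemma metric_differentiable x : D x -> differentiable g x.
Proof. by move=> Dx; exact: smooth_differentiable gsm Dx. Qed.

Lemma connection_torsion_free x u v : D x ->
  v *m connection x u = u *m connection x v.
Proof.
move=> Dx; apply/rowP => k; rewrite !mxE.
under eq_bigr do rewrite mxE mulr_sumr.
under [RHS]eq_bigr do rewrite mxE mulr_sumr.
rewrite exchange_big/=; apply: eq_bigr => i _; apply: eq_bigr => j _.
by rewrite (christoffel_sym k i j Dx); ring.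
Qed.

(** Lowering the index cancels the inverse metric and leaves the Christoffel symbols of the first
    kind. *)
Lemma connection_lowered x u : D x -> connection x u *m g x =
  \matrix_(j, l) \sum_i u 0 i * (2^-1 *
    (dmetric g i j l x + dmetric g j i l x - dmetric g l i j x)).
Proof.
move=> Dx; have gs a b : g x a b = g x b a by rewrite -{1}(gsym Dx) mxE.
apply/matrixP => j l; rewrite !mxE; under eq_bigr do rewrite mxE mulr_suml.
rewrite exchange_big/=; apply: eq_bigr => i _.
pose c m := dmetric g i j m x + dmetric g j i m x - dmetric g m i j x.
transitivity (\sum_k \sum_m (u 0 i * 2^-1 * c m) * (g x l k * invmx (g x) k m)).
  apply: eq_bigr => k _; rewrite /christoffel mulr_sumr !mulr_suml.
  by apply: eq_bigr => m _; rewrite (gs l k) /c; ring.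
rewrite exchange_big/=.
transitivity (\sum_m (u 0 i * 2^-1 * c m) * (1%:M : 'M[R]_n) l m).
  apply: eq_bigr => m _; rewrite -mulr_sumr; congr (_ * _).
  by rewrite -(mulmxV (gunit Dx)) mxE.
rewrite (bigD1 l)//= big1 ?addr0; last first.
  by move=> m ml; rewrite mxE eq_sym (negPf ml) mulr0.
by rewrite mxE eqxx mulr1 /c; ring.
Qed.

Lemma metric_compatible x u : D x ->
  'D_u g x = connection x u *m g x + g x *m (connection x u)^T.
Proof.
move=> Dx; rewrite -[X in _ + X *m _](gsym Dx) -trmx_mul connection_lowered//.
rewrite derivative_rV; last exact: metric_differentiable.
apply/matrixP => j l; rewrite summxE !mxE -big_split/=; apply: eq_bigr => i _.
by rewrite !mxE -dmetricE// (dmetric_sym i l j)//; field.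
Qed.

Local Notation Gam := connection.
Local Notation Om := (connection_curvature Gam).

Lemma curvature_matrix_antisym m (A : 'rV[R]_n -> 'rV[R]_n -> 'M[R]_m) x u v :
  connection_curvature A x v u = - connection_curvature A x u v.
Proof.
rewrite /connection_curvature.
move: ('D_u _ x) ('D_v _ x) (A x u) (A x v) => a b c d.
by mx_ring.
Qed.

(** Differentiating metric compatibility once more expresses the commutator of second derivatives of
    [g], which is zero, through the curvature. *)
Lemma curvature_metric_antisym x u v : D x ->
  Om x u v *m g x + g x *m (Om x u v)^T = 0.
Proof.
move=> Dx; have second a b : 'D_a (fun y => 'D_b g y) x =
    'D_a (fun y => Gam y b) x *m g x + Gam x b *m 'D_a g x
    + ('D_a g x *m (Gam x b)^T + g x *m ('D_a (fun y => Gam y b) x)^T).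
  have dG := connection_differentiable b Dx.
  have dg := metric_differentiable Dx.
  have dGT := differentiable_trmx dG; have DGT := derive_trmx a dG.
  transitivity ('D_a (fun y => Gam y b *m g y + g y *m (Gam y b)^T) x).
    apply: (@derive_open_eq _ _ _ D) => // y; rewrite inE => Dy.
    exact: metric_compatible.
  rewrite deriveD; [|exact/diff_derivable/differentiable_mulmx..].
  by rewrite !derive_mulmx// DGT.
have E : 'D_u (fun y => 'D_v g y) x - 'D_v (fun y => 'D_u g y) x = 0.
  by apply/eqP; rewrite subr_eq0; apply/eqP; exact: schwarz gsm Dx.
rewrite -[RHS]E !second !metric_compatible// /connection_curvature.
move: ('D_u (fun y => Gam y v) x) ('D_v (fun y => Gam y u) x) => a b.
move: (Gam x u) (Gam x v) (g x) => c d e.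
by mx_distr; mx_ring.
Qed.

(** Torsion-freeness holds on an open set, so it can be differentiated: [TD] cancels the terms with
    derivatives of [Gam] in pairs, and [T] cancels the quadratic ones. *)
Lemma first_bianchi x u v w : D x ->
  w *m Om x u v + u *m Om x v w + v *m Om x w u = 0.
Proof.
move=> Dx.
have TD a b c : b *m 'D_a (fun y => Gam y c) x = c *m 'D_a (fun y => Gam y b) x.
  have dG z := connection_differentiable z Dx.
  have E (z t : 'rV[R]_n) : z *m 'D_a (fun y => Gam y t) x = 'D_a (fun y => z *m Gam y t) x.
    have dz : differentiable (cst z : 'rV[R]_n -> 'rV[R]_n) x by exact: differentiable_cst.
    by rewrite (derive_mulmx a dz (dG t)) derive_cst mul0mx add0r.
  rewrite !E; apply: (@derive_open_eq _ _ _ D) => // y; rewrite inE => Dy.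
  exact: connection_torsion_free.
have T a b := connection_torsion_free a b Dx.
rewrite /connection_curvature.
move: (TD u w v) (TD v u w) (TD w v u) (T v w) (T u w) (T v u).
move: ('D_u (fun y => Gam y v) x) ('D_v (fun y => Gam y u) x).
move: ('D_v (fun y => Gam y w) x) ('D_w (fun y => Gam y v) x).
move: ('D_w (fun y => Gam y u) x) ('D_u (fun y => Gam y w) x).
move: (Gam x u) (Gam x v) (Gam x w).
move=> a b c d e f g' h i E1 E2 E3 E4 E5 E6; mx_distr.
by rewrite E1 E2 E3 E4 E5 E6; mx_ring.
Qed.

Lemma curvature_linearl x v : D x -> linear (fun u => Om x u v).
Proof.
move=> Dx a u w; rewrite /connection_curvature /=.
have dG := connection_differentiable v Dx.
rewrite derivative_add// derivative_scale//.
rewrite (coef_derive_linear connection_linear connection_smooth v Dx).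
rewrite connection_linear.
move: ('D_u _ x) ('D_w _ x) ('D_v _ x) ('D_v _ x) (Gam x u) (Gam x v) (Gam x w).
move=> b c d e f g' h; mx_distr; rewrite -?scalemxAl -?scalemxAr.
by mx_ring.
Qed.

End Connection.

Section Bilinear.
Context {R : realType} {n : nat}.

Lemma derivative_sub (V W : normedModType R) (f : V -> W) x u v :
  differentiable f x -> 'D_(u - v) f x = 'D_u f x - 'D_v f x.
Proof.
move=> df; rewrite derivative_add//; congr (_ + _).
by rewrite -scaleN1r derivative_scale// scaleN1r.
Qed.

Implicit Types (A B : 'M[R]_n) (v w : 'rV[R]_n).

Lemma bilinDl A v v' w : bilin A (v + v') w = bilin A v w + bilin A v' w.
Proof. by rewrite /bilin !mulmxDl mxE. Qed.

Lemma bilinDr A v w w' : bilin A v (w + w') = bilin A v w + bilin A v w'.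
Proof. by rewrite /bilin linearD mulmxDr mxE. Qed.

Lemma bilinBm A B v w : bilin (A - B) v w = bilin A v w - bilin B v w.
Proof. by rewrite /bilin mulmxBr mulmxBl !mx_entryE. Qed.

Lemma bilinNl A v w : bilin A (- v) w = - bilin A v w.
Proof. by rewrite /bilin !mulNmx mxE. Qed.

Lemma bilinMl A B v w : bilin (B *m A) v w = bilin A (v *m B) w.
Proof. by rewrite /bilin mulmxA. Qed.

Lemma bilinMr A B v w : bilin (A *m B^T) v w = bilin A v (w *m B).
Proof. by rewrite /bilin trmx_mul !mulmxA. Qed.

Lemma bilin_sym A v w : A^T = A -> bilin A v w = bilin A w v.
Proof.
move=> As; rewrite /bilin -[in LHS](trmxK (v *m A *m w^T)) [LHS]mxE.
by rewrite !trmx_mul trmxK As mulmxA.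
Qed.

Lemma bilin_delta A i j : bilin A (delta_mx 0 i) (delta_mx 0 j) = A i j.
Proof. by rewrite /bilin -rowE trmx_delta -colE !mxE. Qed.

Lemma bilin_mxP A B : (forall v w, bilin A v w = bilin B v w) -> A = B.
Proof. by move=> AB; apply/matrixP => i j; rewrite -!bilin_delta. Qed.

Lemma derive_bilin_field (A : 'rV[R]_n -> 'M[R]_n) (X Y : 'rV[R]_n -> 'rV[R]_n) x u :
  differentiable A x -> differentiable X x -> differentiable Y x ->
  'D_u (fun y => bilin (A y) (X y) (Y y)) x =
    bilin ('D_u A x) (X x) (Y x) + bilin (A x) ('D_u X x) (Y x)
    + bilin (A x) (X x) ('D_u Y x).
Proof.
move=> dA dX dY.
have dYT := differentiable_trmx dY; have DYT := derive_trmx u dY.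
have dXA : differentiable (fun y => X y *m A y) x by exact: differentiable_mulmx.
rewrite /bilin.
rewrite -(@derive_mx_entry _ _ _ _ (fun y => X y *m A y *m (Y y)^T)); last first.
  exact: differentiable_mulmx.
rewrite (@derive_mulmx _ _ _ _ _ (fun y => X y *m A y))// derive_mulmx// DYT.
by rewrite mulmxDl !mx_entryE; ring.
Qed.

Lemma differentiable_bilin_field (A : 'rV[R]_n -> 'M[R]_n) (X Y : 'rV[R]_n -> 'rV[R]_n) x :
  differentiable A x -> differentiable X x -> differentiable Y x ->
  differentiable (fun y => bilin (A y) (X y) (Y y)) x.
Proof.
move=> dA dX dY.
have dYT := differentiable_trmx dY.
have : differentiable (fun y => X y *m A y *m (Y y)^T) x.
  by do 2?apply: differentiable_mulmx.
by move/differentiable_mxP; exact.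
Qed.

End Bilinear.

(** * The curvature tensor on vector fields *)

Section Curvature.
Context {R : realType} {n : nat}.
Variables (g : 'rV[R]_n -> 'M[R]_n) (D : set 'rV[R]_n).
Hypothesis Do : open D.
Hypothesis gsm : smooth D g.
Hypothesis gsym : forall x, D x -> (g x)^T = g x.
Hypothesis gunit : forall x, D x -> g x \in unitmx.

Local Notation Gam := (connection g).
Local Notation Om := (connection_curvature Gam).
Local Notation Gsm := (connection_smooth Do gsm gunit).

Lemma derive_linear_direction (Y : 'rV[R]_n -> 'rV[R]_n) x :
  smooth D Y -> D x -> linear (fun v => 'D_v Y x).
Proof.
move=> Ysm Dx a u v /=; have dY := smooth_differentiable Ysm Dx.
by rewrite derivative_add// derivative_scale.
Qed.

Implicit Types (U X Y Z W V : 'rV[R]_n -> 'rV[R]_n) (x u v w z : 'rV[R]_n).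

Lemma smooth_derive_along X Y : smooth D X -> smooth D Y ->
  smooth D (fun x => 'D_(X x) Y x).
Proof.
move=> Xsm Ysm; apply: (@smooth_linear_family _ _ _ _ (fun x v => 'D_v Y x)) => //.
  by move=> y; exact: derive_linear_direction.
by move=> v; exact: smooth_derive.
Qed.

Lemma nabla_smooth X Y : smooth D X -> smooth D Y -> smooth D (nabla g X Y).
Proof.
move=> Xsm Ysm k.
have h : Ck k D (fun x => 'D_(X x) Y x + Y x *m Gam x (X x)).
  apply: (CkD Do (smooth_derive_along Xsm Ysm k)).
  apply: (Ck_mulmx Do (Ysm k)).
  apply: (smooth_linear_family Do _ _ Xsm) => //; last exact: Gsm.
  by move=> y _; exact: connection_linear.
by apply: Ck_eq h => // x _; rewrite nablaE.
Qed.

Lemma derive_nabla X Y x u : smooth D X -> smooth D Y -> D x ->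
  'D_u (nabla g X Y) x = 'D_u (fun y => 'D_(X x) Y y) x + 'D_('D_u X x) Y x
   + 'D_u Y x *m Gam x (X x)
   + Y x *m ('D_u (fun y => Gam y (X x)) x + Gam x ('D_u X x)).
Proof.
move=> Xsm Ysm Dx.
have GXsm : smooth D (fun y => Gam y (X y)).
  apply: smooth_linear_family => //; first by move=> y _; exact: connection_linear.
  by move=> v; exact: Gsm.
have dY := smooth_differentiable Ysm Dx; have dGX := smooth_differentiable GXsm Dx.
rewrite (_ : nabla g X Y = fun y => 'D_(X y) Y y + Y y *m Gam y (X y)); last first.
  by apply/funext => y; rewrite nablaE.
rewrite deriveD; last 2 first.
- exact/diff_derivable/(smooth_differentiable (smooth_derive_along Xsm Ysm) Dx).
- exact/diff_derivable/differentiable_mulmx.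
rewrite (@derive_linear_family _ _ _ _ (fun y v => 'D_v Y y) X D)//; last 2 first.
- by move=> y; exact: derive_linear_direction.
- by move=> v; exact: smooth_derive.
rewrite derive_mulmx//.
rewrite (@derive_linear_family _ _ _ _ Gam X D)//; last 2 first.
- by move=> y _; exact: connection_linear.
- exact: Gsm.
by rewrite addrA.
Qed.

(** Tensoriality: the second derivatives of [Z] cancel by [schwarz], and the derivatives of [X] and
    [Y] cancel against the bracket term. *)
Lemma curvatureE X Y Z x : smooth D X -> smooth D Y -> smooth D Z -> D x ->
  curvature g X Y Z x = Z x *m Om x (X x) (Y x).
Proof.
move=> Xsm Ysm Zsm Dx; have dZ := smooth_differentiable Zsm Dx.
rewrite /curvature /lie_bracket.
rewrite (nablaE _ X) (nablaE _ Y) !nablaE !derive_nabla//.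
rewrite (schwarz (X x) (Y x) Do Zsm Dx) connectionB.
rewrite derivative_sub// /connection_curvature.
move: (Gam x (X x)) (Gam x (Y x)) => a b.
move: (Gam x ('D_(X x) Y x)) (Gam x ('D_(Y x) X x)) => a' b'.
move: ('D_(X x) (fun y => Gam y (Y x)) x) ('D_(Y x) (fun y => Gam y (X x)) x) => c d.
move: ('D_(X x) Z x) ('D_(Y x) Z x) (Z x) => e f z.
move: ('D_('D_(X x) Y x) Z x) ('D_('D_(Y x) X x) Z x) => k l.
move: ('D_(X x) _ x) => j.
by mx_distr; mx_ring.
Qed.

Lemma riemannE X Y Z W x : smooth D X -> smooth D Y -> smooth D Z -> D x ->
  riemann g X Y Z W x = - bilin (g x) (Z x *m Om x (X x) (Y x)) (W x).
Proof. by move=> *; rewrite /riemann curvatureE. Qed.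

(** Leibniz rule for the Gauss equation: the derivatives of the fields cancel and only those of [H]
    survive. It applies to the second form of a hypersurface, and also to [rivertz_form] at a stage
    where Codazzi is still to be proved. *)
Lemma nabla_riemann_gauss (H : 'rV[R]_n -> 'M[R]_n) U X Y Z W x :
  smooth D H ->
  (forall y u v z w, D y -> - bilin (g y) (z *m Om y u v) w =
     bilin (H y) u z * bilin (H y) v w - bilin (H y) v z * bilin (H y) u w) ->
  smooth D U -> smooth D X -> smooth D Y -> smooth D Z -> smooth D W -> D x ->
  let T u v := bilin ('D_(U x) H x - Gam x (U x) *m H x - H x *m (Gam x (U x))^T) u v in
  let h := bilin (H x) in
  nabla_riemann g U X Y Z W x =
    T (X x) (Z x) * h (Y x) (W x) + h (X x) (Z x) * T (Y x) (W x)
    - T (Y x) (Z x) * h (X x) (W x) - h (Y x) (Z x) * T (X x) (W x).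
Proof.
move=> Hsm gauss Usm Xsm Ysm Zsm Wsm Dx T h.
have nab V : smooth D V -> smooth D (nabla g U V) by exact: nabla_smooth.
have riem X' Y' Z' W' y : smooth D X' -> smooth D Y' -> smooth D Z' -> D y ->
    riemann g X' Y' Z' W' y =
    bilin (H y) (X' y) (Z' y) * bilin (H y) (Y' y) (W' y)
    - bilin (H y) (Y' y) (Z' y) * bilin (H y) (X' y) (W' y).
  by move=> *; rewrite riemannE// gauss.
rewrite /nabla_riemann.
rewrite (@derive_open_eq _ _ _ D _ (fun y =>
    bilin (H y) (X y) (Z y) * bilin (H y) (Y y) (W y)
    - bilin (H y) (Y y) (Z y) * bilin (H y) (X y) (W y)) x (U x) Do)//; last first.
  by move=> y; rewrite inE => Dy; exact: riem.
rewrite !riem//; try exact: nab.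
have d V (Vsm : smooth D V) : differentiable V x by exact: smooth_differentiable Vsm Dx.
have dH : differentiable H x by exact: smooth_differentiable Hsm Dx.
have db V V' : smooth D V -> smooth D V' ->
    differentiable (fun y => bilin (H y) (V y) (V' y)) x.
  by move=> Vs Vs'; apply: differentiable_bilin_field => //; exact: d.
rewrite deriveB; last 2 first.
- by apply/diff_derivable/differentiableM; exact: db.
- by apply/diff_derivable/differentiableM; exact: db.
rewrite !deriveM; do ?[exact/diff_derivable/db].
rewrite !derive_bilin_field//; do ?[exact: d].
rewrite !nablaE !bilinDl !bilinDr /T /h !bilinBm !bilinMr !bilinMl /GRing.scale/=.
repeat match goal with |- context [bilin ?A ?v ?w] => generalize (bilin A v w) end.
by move=> *; ring.
Qed.

End Curvature.

(** * The second Bianchi identity *)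

Section SecondBianchi.
Context {R : realType} {n : nat}.
Variables (g : 'rV[R]_n -> 'M[R]_n) (D : set 'rV[R]_n).
Hypothesis Do : open D.
Hypothesis gsm : smooth D g.
Hypothesis gsym : forall x, D x -> (g x)^T = g x.
Hypothesis gunit : forall x, D x -> g x \in unitmx.

Local Notation Gam := (connection g).
Local Notation Om := (connection_curvature Gam).
Local Notation Gsm := (connection_smooth Do gsm gunit).

Let dG (u x : 'rV[R]_n) : D x -> differentiable (fun y => Gam y u) x.
Proof. by move=> Dx; exact: smooth_differentiable (Gsm u) Dx. Qed.

Let dDG (u v x : 'rV[R]_n) : D x -> differentiable (fun y => 'D_v (fun z => Gam z u) y) x.
Proof. by move=> Dx; exact: smooth_differentiable (smooth_derive v (Gsm u)) Dx. Qed.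

Lemma curvature_matrix_smooth (u v : 'rV[R]_n) : smooth D (fun y => Om y u v).
Proof.
move=> k; apply: (CkB Do).
  apply: (CkD Do); last exact: (Ck_mulmx Do (Gsm v k) (Gsm u k)).
  exact: (CkB Do (smooth_derive u (Gsm v) k) (smooth_derive v (Gsm u) k)).
exact: (Ck_mulmx Do (Gsm u k) (Gsm v k)).
Qed.

Let dOm (u v x : 'rV[R]_n) : D x -> differentiable (fun y => Om y u v) x.
Proof.
by move=> Dx; exact: smooth_differentiable (curvature_matrix_smooth u v) Dx.
Qed.

Lemma derive_curvature_matrix (w u v x : 'rV[R]_n) : D x ->
  'D_w (fun y => Om y u v) x =
   'D_w (fun y => 'D_u (fun z => Gam z v) y) x
   - 'D_w (fun y => 'D_v (fun z => Gam z u) y) x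
   + ('D_w (fun y => Gam y v) x *m Gam x u + Gam x v *m 'D_w (fun y => Gam y u) x)
   - ('D_w (fun y => Gam y u) x *m Gam x v + Gam x u *m 'D_w (fun y => Gam y v) x).
Proof.
move=> Dx; have dGu := dG u Dx; have dGv := dG v Dx.
have dm1 := differentiable_mulmx dGv dGu; have dm2 := differentiable_mulmx dGu dGv.
have dd1 := dDG v u Dx; have dd2 := dDG u v Dx.
rewrite -(derive_mulmx w dGv dGu) -(derive_mulmx w dGu dGv).
rewrite -(deriveB (diff_derivable dd1) (diff_derivable dd2)).
rewrite -(deriveD (diff_derivable (differentiableB dd1 dd2)) (diff_derivable dm1)).
rewrite -(deriveB (diff_derivable (differentiableD (differentiableB dd1 dd2) dm1))
  (diff_derivable dm2)).
by [].
Qed.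

(** Covariant derivative of [Om] as an endomorphism only; the corrections in the slots [u] and [v]
    are left out because they cancel in the cyclic sum. *)
Let cov (w u v x : 'rV[R]_n) : 'M[R]_n :=
  'D_w (fun y => Om y u v) x + Om x u v *m Gam x w - Gam x w *m Om x u v.

Lemma second_bianchi_mx (w u v x : 'rV[R]_n) : D x ->
  cov w u v x + cov u v w x + cov v w u x = 0.
Proof.
move=> Dx.
(* All derivatives of the connection become abstract matrices; the only fact kept about them is the
   symmetry of second derivatives, after which the identity is purely algebraic. *)
have [DD [DG [DDC [EO EDO]]]] : exists (DD : 'rV[R]_n -> 'rV[R]_n -> 'rV[R]_n -> 'M[R]_n)
    (DG : 'rV[R]_n -> 'rV[R]_n -> 'M[R]_n),
    (forall a b c, DD a b c = DD b a c) /\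
    (forall a b, Om x a b = DG a b - DG b a + Gam x b *m Gam x a - Gam x a *m Gam x b) /\
    (forall a b c, 'D_a (fun y => Om y b c) x = DD a b c - DD a c b
       + (DG a c *m Gam x b + Gam x c *m DG a b)
       - (DG a b *m Gam x c + Gam x b *m DG a c)).
  exists (fun a b c => 'D_a (fun y => 'D_b (fun z => Gam z c) y) x),
    (fun a b => 'D_a (fun y => Gam y b) x); split; last split.
  - by move=> a b c; exact: schwarz Do (Gsm c) Dx.
  - by [].
  - by move=> a b c; exact: derive_curvature_matrix.
rewrite /cov !EDO !EO (DDC v w) (DDC w u) (DDC u v).
move: (DD w v u) (DD u w v) (DD v u w) (DG u v) (DG v u) (DG v w) (DG w v).
move: (DG w u) (DG u w) (Gam x u) (Gam x v) (Gam x w) => a b c d e f h i j k l m.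
by mx_distr; mx_ring.
Qed.

Lemma nabla_riemann_cst (w u v z t x : 'rV[R]_n) : D x ->
  nabla_riemann g (cst w) (cst u) (cst v) (cst z) (cst t) x =
  - bilin (g x) (z *m cov w u v x) t
  + bilin (g x) (z *m Om x (u *m Gam x w) v) t
  + bilin (g x) (z *m Om x u (v *m Gam x w)) t.
Proof.
move=> Dx; have csm (a : 'rV[R]_n) : smooth D (cst a) by move=> k; exact: Ck_cst.
have nsm (a : 'rV[R]_n) : smooth D (nabla g (cst w) (cst a)).
  exact: nabla_smooth.
have nE (a : 'rV[R]_n) : nabla g (cst w) (cst a) x = a *m Gam x w.
  by rewrite nablaE derive_cst add0r.
rewrite /nabla_riemann.
rewrite (@derive_open_eq _ _ _ D _ (fun y => - bilin (g y) (z *m Om y u v) (cst t y)) x w Do);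
  last 2 first.
- by move=> y; rewrite inE => Dy; rewrite (riemannE Do gsm gunit _ (csm u) (csm v) (csm z)).
- exact: Dx.
rewrite (riemannE Do gsm gunit _ (nsm u) (csm v) (csm z))//.
rewrite (riemannE Do gsm gunit _ (csm u) (nsm v) (csm z))//.
rewrite (riemannE Do gsm gunit _ (csm u) (csm v) (nsm z))//.
rewrite (riemannE Do gsm gunit _ (csm u) (csm v) (csm z))//.
rewrite !nE.
have dg : differentiable g x by exact: smooth_differentiable gsm Dx.
have dz : differentiable (cst z : 'rV[R]_n -> 'rV[R]_n) x by exact: differentiable_cst.
have dt : differentiable (cst t : 'rV[R]_n -> 'rV[R]_n) x by exact: differentiable_cst.
have dzO : differentiable (fun y => z *m Om y u v) x.
  exact: (differentiable_mulmx dz (dOm u v Dx)).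
have db := differentiable_bilin_field dg dzO dt.
rewrite (deriveN (diff_derivable db)).
rewrite (derive_bilin_field w dg dzO dt) derive_cst.
rewrite (derive_mulmx w dz (dOm u v Dx)) derive_cst.
rewrite (metric_compatible Do gsm gsym gunit w Dx) /cov /cst.
move: ('D_w (fun y => Om y u v) x) (Om x u v) (Om x (u *m Gam x w) v).
move: (Om x u (v *m Gam x w)) => a; move: (Gam x w) (g x) => b c d e f.
rewrite /bilin -!(@addmx_entry, @oppmx_entry).
congr (fun_of_matrix _ 0 0); mx_distr.
rewrite trmx0 mulmx0.
by mx_ring.
Qed.

(** The corrections in the form slots cancel in pairs: torsion-freeness exchanges [v *m Gam x w]
    with [w *m Gam x v], and [Om] is antisymmetric. *)
Lemma second_bianchi (w u v z t x : 'rV[R]_n) : D x ->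
  nabla_riemann g (cst w) (cst u) (cst v) (cst z) (cst t) x
  + nabla_riemann g (cst u) (cst v) (cst w) (cst z) (cst t) x
  + nabla_riemann g (cst v) (cst w) (cst u) (cst z) (cst t) x = 0.
Proof.
move=> Dx; rewrite !nabla_riemann_cst//.
have T a b := connection_torsion_free Do gsym a b Dx.
rewrite (T v w) (T w u) (T u v).
rewrite (curvature_matrix_antisym Gam x v (w *m Gam x u)).
rewrite (curvature_matrix_antisym Gam x w (u *m Gam x v)).
rewrite (curvature_matrix_antisym Gam x u (v *m Gam x w)).
have := second_bianchi_mx w u v Dx.
move: (Om x v (w *m Gam x u)) (Om x w (u *m Gam x v)) (Om x u (v *m Gam x w)) => d e f.
move: (cov w u v x) (cov u v w x) (cov v w u x) => a b c abc.
have -> : c = - a - b by apply: subr0_eq; rewrite -[RHS]abc; mx_ring.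
rewrite !(mulmxN, mulmxDr) !(bilinDl, bilinNl).

by ring.
Qed.

End SecondBianchi.

(** * Hypersurfaces *)

Section Hypersurface.
Context {R : realType} {n : nat}.
Variables (g : 'rV[R]_n -> 'M[R]_n) (D : set 'rV[R]_n) (phi : 'rV[R]_n -> 'rV[R]_(n + 1)).
Hypothesis Do : open D.
Hypothesis gsm : smooth D g.
Hypothesis gsym : forall x, D x -> (g x)^T = g x.
Hypothesis gunit : forall x, D x -> g x \in unitmx.
Hypothesis phism : smooth D phi.
Hypothesis phi_iso : forall x v w, D x ->
  dot ('D_v phi x) ('D_w phi x) = bilin (g x) v w.

Local Notation Gam := (connection g).
Local Notation Om := (connection_curvature Gam).
Local Notation Gsm := (connection_smooth Do gsm gunit).

Definition tangent_frame (x : 'rV[R]_n) : 'M[R]_(n, n + 1) :=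
  \matrix_i 'D_(delta_mx 0 i) phi x.

Local Notation J := tangent_frame.

Lemma tangent_frameE x v : D x -> v *m J x = 'D_v phi x.
Proof.
move=> Dx; rewrite (derivative_rV _ (smooth_differentiable phism Dx)).
by rewrite mulmx_sum_row; apply: eq_bigr => i _; rewrite rowK.
Qed.

Lemma tangent_frame_smooth : smooth D J.
Proof.
move=> k; apply/Ck_mxP => // i j.
have := smooth_derive (delta_mx 0 i) phism k => /Ck_mxP => /(_ Do 0 j).
by apply: Ck_eq => // y _; rewrite mxE.
Qed.

Let dJ x : D x -> differentiable J x.
Proof. by move=> Dx; exact: smooth_differentiable tangent_frame_smooth Dx. Qed.

Lemma tangent_gram x : D x -> J x *m (J x)^T = g x.
Proof.
move=> Dx; apply: bilin_mxP => v w; rewrite -phi_iso// -!tangent_frameE//.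
by rewrite /bilin /dot trmx_mul !mulmxA.
Qed.

Lemma derive_tangent_frame x u v : D x ->
  v *m 'D_u J x = 'D_u (fun y => 'D_v phi y) x.
Proof.
move=> Dx; have dv : differentiable (cst v : 'rV[R]_n -> 'rV[R]_n) x.
  exact: differentiable_cst.
transitivity ('D_u (fun y => cst v y *m J y) x).
  by rewrite (derive_mulmx u dv (dJ Dx)) derive_cst mul0mx add0r.
by apply: (@derive_open_eq _ _ _ D) => // y; rewrite inE => /tangent_frameE.
Qed.

Lemma derive_tangent_frame_sym x u v : D x -> v *m 'D_u J x = u *m 'D_v J x.
Proof.
move=> Dx; rewrite (derive_tangent_frame u v Dx) (derive_tangent_frame v u Dx).
exact: (schwarz v u Do phism Dx).
Qed.

(* Koszul's argument: a form that is symmetric in the first two arguments and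
   antisymmetric in the last two vanishes. *)
Lemma second_fundamental_normal x u : D x ->
  ('D_u J x - Gam x u *m J x) *m (J x)^T = 0.
Proof.
move=> Dx; pose B (a b c : 'rV[R]_n) := ((b *m ('D_a J x - Gam x a *m J x)) *m (c *m J x)^T) 0 0.
have Bsym a b c : B a b c = B b a c.
  rewrite /B !mulmxBr (derive_tangent_frame_sym a b Dx) !mulmxA.
  by rewrite (connection_torsion_free Do gsym _ _ Dx).
have Bas a b c : B a b c = - B a c b.
  have E : ('D_a J x - Gam x a *m J x) *m (J x)^T
      + J x *m ('D_a J x - Gam x a *m J x)^T = 0.
    have : 'D_a (fun y => J y *m (J y)^T) x = 'D_a g x.
      by apply: (@derive_open_eq _ _ _ D) => // y; rewrite inE => /tangent_gram.
    rewrite (derive_mulmx a (dJ Dx) (differentiable_trmx (dJ Dx))).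
    rewrite (derive_trmx a (dJ Dx)) (metric_compatible Do gsm gsym gunit a Dx).
    rewrite -(tangent_gram Dx); move: ('D_a J x) (Gam x a) (J x) => p q r E.
    transitivity (p *m r^T + r *m p^T - (q *m (r *m r^T) + r *m r^T *m q^T)).
      by mx_distr; mx_ring.
    by rewrite E subrr.
  apply/eqP; rewrite -addr_eq0; apply/eqP.
  have : (b *m (('D_a J x - Gam x a *m J x) *m (J x)^T
      + J x *m ('D_a J x - Gam x a *m J x)^T) *m c^T) 0 0 = 0.
    by rewrite E mulmx0 mul0mx mxE.
  rewrite mulmxDr mulmxDl mxE /B => <-; congr (_ + _).
    by rewrite trmx_mul !mulmxA.
  rewrite -[in LHS](trmxK (c *m _ *m _)) [LHS]mxE; congr (fun_of_matrix _ 0 0).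
  by rewrite !trmx_mul !trmxK !mulmxA.
have B0 a b c : B a b c = 0.
  have h : B a b c = - B a b c.
    by rewrite {1}Bas Bsym Bas opprK Bsym Bas Bsym.
  by apply/eqP; move: h => /eqP; rewrite -addr_eq0 -mulr2n mulrn_eq0.
apply: bilin_mxP => v w; rewrite {2}/bilin mulmx0 mul0mx mxE -(B0 u v w) /B /bilin.
by rewrite trmx_mul !mulmxA.
Qed.

Variable N : 'rV[R]_n -> 'rV[R]_(n + 1).
Hypothesis Nsm : smooth D N.
Hypothesis JN : forall x, D x -> J x *m (N x)^T = 0.
Hypothesis NN : forall x, D x -> N x *m (N x)^T = 1%:M.

Let dN x : D x -> differentiable N x.
Proof. by move=> Dx; exact: smooth_differentiable Nsm Dx. Qed.

Definition second_form (x : 'rV[R]_n) : 'M[R]_n :=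
  \matrix_(j, i) ('D_(delta_mx 0 i) J x *m (N x)^T) j 0.

Local Notation H := second_form.

Lemma second_formE x v : D x -> H x *m v^T = 'D_v J x *m (N x)^T.
Proof.
move=> Dx; rewrite (derivative_rV _ (dJ Dx)) mulmx_suml.
apply/colP => j; rewrite mxE summxE; apply: eq_bigr => i _.
by rewrite -scalemxAl [RHS]mxE [H x j i]mxE [v^T i 0]mxE mulrC.
Qed.

Lemma second_form_smooth : smooth D H.
Proof.
move=> k; apply/Ck_mxP => // j i.
have := Ck_mulmx Do (smooth_derive (delta_mx 0 i) tangent_frame_smooth k)
  (Ck_trmx Do (Nsm k)) => /Ck_mxP => /(_ Do j 0).
by apply: Ck_eq => // y _; rewrite [RHS]mxE.
Qed.

Lemma second_form_sym x : D x -> (H x)^T = H x.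
Proof.
move=> Dx; apply: bilin_mxP => v w.
have E a b : bilin (H x) a b = (a *m 'D_b J x *m (N x)^T) 0 0.
  by rewrite /bilin -mulmxA (second_formE b Dx) mulmxA.
have T : bilin (H x)^T v w = bilin (H x) w v.
  rewrite /bilin -[in LHS](trmxK (v *m (H x)^T *m w^T)) [LHS]mxE.
  by rewrite !trmx_mul !trmxK mulmxA.
by rewrite T !E (derive_tangent_frame_sym v w Dx).
Qed.

(** Obtained by differentiating the orthogonality of the normal to the tangent frame. *)
Lemma weingarten x u : D x -> 'D_u N x *m (J x)^T = - (u *m H x).
Proof.
move=> Dx; have : 'D_u (fun y => J y *m (N y)^T) x = 0.
  rewrite (@derive_open_eq _ _ _ D _ (cst 0) x u Do) ?derive_cst//.
  by move=> y; rewrite inE => /JN.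
rewrite (derive_mulmx u (dJ Dx) (differentiable_trmx (dN Dx))).
rewrite (derive_trmx u (dN Dx)) -(second_formE u Dx) => E.
rewrite -[LHS]trmxK trmx_mul trmxK -(second_form_sym Dx) -[u]trmxK -trmx_mul -trmx_opp.
rewrite trmxK; congr (_^T); apply/eqP; rewrite -addr_eq0 addrC; exact/eqP.
Qed.

Lemma normal_derive_normal x u : D x -> 'D_u N x *m (N x)^T = 0.
Proof.
move=> Dx; have : 'D_u (fun y => N y *m (N y)^T) x = 0.
  rewrite (@derive_open_eq _ _ _ D _ (cst 1%:M) x u Do) ?derive_cst//.
  by move=> y; rewrite inE => /NN.
rewrite (derive_mulmx u (dN Dx) (differentiable_trmx (dN Dx))).
rewrite (derive_trmx u (dN Dx)) => E.
have E0 : ('D_u N x *m (N x)^T) 0 0 = 0.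
  have : ('D_u N x *m (N x)^T + ('D_u N x *m (N x)^T)^T) 0 0 = 0.
    by rewrite trmx_mul trmxK E mxE.
  by rewrite mxE [X in _ + X]mxE -mulr2n => /eqP; rewrite mulrn_eq0 => /eqP.
by apply/matrixP => i j; rewrite !ord1 E0 mxE.
Qed.

Lemma frame_unit x : D x -> col_mx (J x) (N x) \in unitmx.
Proof.
move=> Dx.
suff : col_mx (J x) (N x) *m (col_mx (J x) (N x))^T \in unitmx.
  by rewrite unitmx_mul => /andP[].
have NJ : N x *m (J x)^T = 0 by rewrite -[LHS]trmxK trmx_mul trmxK JN// trmx0.
rewrite tr_col_mx mul_col_row JN// NN// NJ tangent_gram//.
by rewrite unitmxE det_ublock det1 mulr1 -unitmxE gunit.
Qed.

(** The tangent frame and the normal form an invertible matrix, so it is enough to compare products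
    with [(J x)^T] and [(N x)^T]. *)
Lemma gauss_formula x u : D x -> 'D_u J x = Gam x u *m J x + H x *m u^T *m N x.
Proof.
move=> Dx; have NJ : N x *m (J x)^T = 0.
  by rewrite -[LHS]trmxK trmx_mul trmxK JN// trmx0.
have U : (col_mx (J x) (N x))^T \in unitmx by rewrite unitmx_tr frame_unit.
apply: (can_inj (mulmxK U)); rewrite tr_col_mx !mul_mx_row.
have := second_fundamental_normal u Dx; rewrite mulmxBl => /subr0_eq ->.
by rewrite !mulmxDl -!mulmxA NJ NN// JN// mulmx1 !mulmx0 !(addr0, add0r) second_formE.
Qed.

Let second_order x u v : D x -> 'D_u (fun y => 'D_v J y) x =
  'D_u (fun y => Gam y v) x *m J x
  + Gam x v *m (Gam x u *m J x + H x *m u^T *m N x)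
  + (('D_u H x *m v^T) *m N x + H x *m v^T *m 'D_u N x).
Proof.
move=> Dx; rewrite -(gauss_formula u Dx).
have dG : differentiable (fun y => Gam y v) x.
  exact: smooth_differentiable (Gsm v) Dx.
have dH : differentiable H x by exact: smooth_differentiable second_form_smooth Dx.
have dv : differentiable (cst v^T : 'rV[R]_n -> 'cV[R]_n) x by exact: differentiable_cst.
have dHv := differentiable_mulmx dH dv.
rewrite (@derive_open_eq _ _ _ D _
  (fun y => Gam y v *m J y + H y *m cst v^T y *m N y) x u Do); last 2 first.
- by move=> y; rewrite inE => /gauss_formula.
- exact: Dx.
rewrite deriveD; last 2 first.
- exact: (diff_derivable (differentiable_mulmx dG (dJ Dx))).
- exact: (diff_derivable (differentiable_mulmx dHv (dN Dx))).
rewrite (derive_mulmx u dG (dJ Dx)) (derive_mulmx u dHv (dN Dx)).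
by rewrite (derive_mulmx u dH dv) derive_cst mulmx0 addr0.
Qed.

(** Second derivatives of the tangent frame commute. Multiplying this identity by [(J x)^T] extracts
    the tangential part, which is Gauss; multiplying by [(N x)^T] extracts the normal part, which is
    Codazzi. *)
Lemma gauss_codazzi x u v : D x ->
  Om x u v *m g x = H x *m (v^T *m u - u^T *m v) *m H x /\
  'D_u H x *m v^T + Gam x v *m H x *m u^T = 'D_v H x *m u^T + Gam x u *m H x *m v^T.
Proof.
move=> Dx; have NJ : N x *m (J x)^T = 0.
  by rewrite -[LHS]trmxK trmx_mul trmxK JN// trmx0.
have E := etrans (esym (second_order u v Dx))
  (etrans (schwarz v u Do tangent_frame_smooth Dx) (second_order v u Dx)).
have EJ := congr1 (fun M => M *m (J x)^T) E; have EN := congr1 (fun M => M *m (N x)^T) E.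
move: EJ EN; rewrite /=.
have := weingarten u Dx; have := weingarten v Dx.
have := normal_derive_normal u Dx; have := normal_derive_normal v Dx.
have := JN Dx; have := NN Dx; have := tangent_gram Dx; move: NJ.
rewrite /connection_curvature.
move: ('D_u N x) ('D_v N x) ('D_u H x) ('D_v H x) => p q r s.
move: ('D_u (fun y => Gam y v) x) ('D_v (fun y => Gam y u) x) => a b.
move: (Gam x u) (Gam x v) (H x) (g x) (J x) (N x) => c d h gg j m.
move=> mj jj mm jm qm pm qj pj; mx_distr.
rewrite -!(mulmxA _ _ j^T) -!(mulmxA _ _ m^T) mj jj mm jm qm pm qj pj.
mx_distr; rewrite !mulmx1 => EJ EN; split.
  apply: subr0_eq; move/eqP: EJ; rewrite -subr_eq0 => /eqP <-.
  by mx_distr; mx_ring.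
apply: subr0_eq; move/eqP: EN; rewrite -subr_eq0 => /eqP <-.
by mx_distr; mx_ring.
Qed.

Lemma gauss_equation x u v z w : D x ->
  - bilin (g x) (z *m Om x u v) w =
  bilin (H x) u z * bilin (H x) v w - bilin (H x) v z * bilin (H x) u w.
Proof.
move=> Dx; rewrite (bilin_sym u z (second_form_sym Dx)).
rewrite (bilin_sym v z (second_form_sym Dx)) -bilinMl (gauss_codazzi u v Dx).1.
rewrite /bilin; move: (H x) => h.
have -> : z *m (h *m (v^T *m u - u^T *m v) *m h) *m w^T =
    (z *m h *m v^T) *m (u *m h *m w^T) - (z *m h *m u^T) *m (v *m h *m w^T).
  by mx_distr.
have m11 (A B : 'M[R]_1) : (A *m B) 0 0 = A 0 0 * B 0 0 by rewrite mxE big_ord1.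
by rewrite !mx_entryE !m11; ring.
Qed.

(** The Codazzi equation of [gauss_codazzi] lacks the term [H x *m (Gam x u)^T]; torsion-freeness
    makes its contribution symmetric in [u] and [v]. *)
Lemma codazzi_sym12 x u v w : D x ->
  bilin ('D_u H x - Gam x u *m H x - H x *m (Gam x u)^T) w v =
  bilin ('D_v H x - Gam x v *m H x - H x *m (Gam x v)^T) w u.
Proof.
move=> Dx; have := (gauss_codazzi u v Dx).2.
have := connection_torsion_free Do gsym u v Dx.
rewrite /bilin; move: ('D_u H x) ('D_v H x) (Gam x u) (Gam x v) (H x) => p q a b h T E.
congr (fun_of_matrix _ 0 0); rewrite -!mulmxA; congr (w *m _).
have T2 : h *m a^T *m v^T = h *m b^T *m u^T.
  by rewrite -!mulmxA -!trmx_mul T.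
apply: subr0_eq; rewrite !mulmxBl T2; move/eqP: E; rewrite -subr_eq0 => /eqP <-.
by mx_distr; mx_ring.
Qed.

Lemma codazzi_sym23 x u v w : D x ->
  bilin ('D_u H x - Gam x u *m H x - H x *m (Gam x u)^T) w v =
  bilin ('D_u H x - Gam x u *m H x - H x *m (Gam x u)^T) v w.
Proof.
move=> Dx; apply: bilin_sym.
have dH : differentiable H x by exact: smooth_differentiable second_form_smooth Dx.
have : ('D_u H x)^T = 'D_u H x.
  rewrite -(derive_trmx u dH); apply: (@derive_open_eq _ _ _ D) => // y.
  by rewrite inE => /second_form_sym.
have := second_form_sym Dx; move: ('D_u H x) (Gam x u) (H x) => p a h hs ps.
by mx_distr; rewrite hs ps; mx_ring.
Qed.

End Hypersurface.

(** * Rivertz's polynomials under Gauss and Codazzi *)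

Section RivertzAlgebra.
Context {R : realType}.

Lemma det_mx3 (A : 'M[R]_3) : let a i j := A (inord i) (inord j) in
  \det A = a 0 0 * (a 1 1 * a 2 2 - a 1 2 * a 2 1)
         - a 0 1 * (a 1 0 * a 2 2 - a 1 2 * a 2 0)
         + a 0 2 * (a 1 0 * a 2 1 - a 1 1 * a 2 0).
Proof.
move=> a; have E (i j : 'I_3) : A i j = a i j by rewrite /a !inord_val.
rewrite (expand_det_row _ ord0) !big_ord_recl big_ord0 /cofactor.
rewrite !(expand_det_row _ ord0) !big_ord_recl !big_ord0 /cofactor !det_mx11.
by rewrite !mxE !E /= /bump /= !add0n; ring.
Qed.

Variables (G : 'rV[R]_3 -> 'M[R]_3) (X : 'I_3 -> 'rV[R]_3 -> 'rV[R]_3) (x : 'rV[R]_3).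

Lemma det_Rtilde : \det (Rtilde G X x) =
  Rc G X x 1 2 1 2 * (Rc G X x 1 3 1 3 * Rc G X x 2 3 2 3 - Rc G X x 1 3 2 3 ^+ 2)
  - Rc G X x 1 2 1 3 * (Rc G X x 1 2 1 3 * Rc G X x 2 3 2 3
      - Rc G X x 1 3 2 3 * Rc G X x 1 2 2 3)
  + Rc G X x 1 2 2 3 * (Rc G X x 1 2 1 3 * Rc G X x 1 3 2 3
      - Rc G X x 1 3 1 3 * Rc G X x 1 2 2 3).
Proof.
by rewrite det_mx3 !mxE !inordK//=; move: (Rc G X x) => r; ring.
Qed.

(* [h i k] and [T m i k] stand for the values of the second fundamental form and
   of its covariant derivative in the direction [m] on the frame [X]. *)
Variables (h : nat -> nat -> R) (T : nat -> nat -> nat -> R).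
Hypothesis hs : forall i j, h i j = h j i.
Hypothesis T12 : forall m i k, T m i k = T i m k.
Hypothesis T23 : forall m i k, T m i k = T m k i.
Hypothesis gauss : forall i j k l, Rc G X x i j k l = h i k * h j l - h j k * h i l.
Hypothesis dgauss : forall i j k l m, Sc G X x i j k l m =
  T m i k * h j l + h i k * T m j l - T m j k * h i l - h j k * T m i l.

(** The squared factor is the determinant of the symmetric matrix [h], expanded along its first
    row. *)
Lemma det_Rtilde_gauss : \det (Rtilde G X x) =
  (h 1 1 * (h 2 2 * h 3 3 - h 2 3 ^+ 2) - h 1 2 * (h 1 2 * h 3 3 - h 2 3 * h 1 3)
   + h 1 3 * (h 1 2 * h 2 3 - h 2 2 * h 1 3)) ^+ 2.
Proof.
rewrite det_Rtilde !gauss (hs 2 1) (hs 3 1) (hs 3 2).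
by move: (h 1 1) (h 1 2) (h 1 3) (h 2 2) (h 2 3) (h 3 3) => *; ring.
Qed.

Lemma rivertz_gauss_codazzi :
  [/\ r1 G X x = 0, r2 G X x = 0 & r3 G X x = 0] /\
  [/\ r4 G X x = 0, r5 G X x = 0 & r6 G X x = 0].
Proof.
(* Total symmetry leaves ten independent values of [T], those with nondecreasing indices. The other
   seventeen are rewritten into them, so that [ring] sees independent variables. *)
have E121 : T 1 2 1 = T 1 1 2 by rewrite (T23 1 2 1).
have E131 : T 1 3 1 = T 1 1 3 by rewrite (T23 1 3 1).
have E132 : T 1 3 2 = T 1 2 3 by rewrite (T23 1 3 2).
have E211 : T 2 1 1 = T 1 1 2 by rewrite (T12 2 1 1) (T23 1 2 1).
have E212 : T 2 1 2 = T 1 2 2 by rewrite (T12 2 1 2).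
have E213 : T 2 1 3 = T 1 2 3 by rewrite (T12 2 1 3).
have E221 : T 2 2 1 = T 1 2 2 by rewrite (T23 2 2 1) (T12 2 1 2).
have E231 : T 2 3 1 = T 1 2 3 by rewrite (T23 2 3 1) (T12 2 1 3).
have E232 : T 2 3 2 = T 2 2 3 by rewrite (T23 2 3 2).
have E311 : T 3 1 1 = T 1 1 3 by rewrite (T12 3 1 1) (T23 1 3 1).
have E312 : T 3 1 2 = T 1 2 3 by rewrite (T12 3 1 2) (T23 1 3 2).
have E313 : T 3 1 3 = T 1 3 3 by rewrite (T12 3 1 3).
have E321 : T 3 2 1 = T 1 2 3 by rewrite (T12 3 2 1) (T23 2 3 1) (T12 2 1 3).
have E322 : T 3 2 2 = T 2 2 3 by rewrite (T12 3 2 2) (T23 2 3 2).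
have E323 : T 3 2 3 = T 2 3 3 by rewrite (T12 3 2 3).
have E331 : T 3 3 1 = T 1 3 3 by rewrite (T23 3 3 1) (T12 3 1 3).
have E332 : T 3 3 2 = T 2 3 3 by rewrite (T23 3 3 2) (T12 3 2 3).
pose E := (E121, E131, E132, E211, E212, E213, E221, E231, E232,
  E311, E312, E313, E321, E322, E323, E331, E332).
split; split; rewrite /r1 /r2 /r3 /r4 /r5 /r6 /C11 /C12 /C13 /C22 /C23 /C33;
  rewrite !dgauss !gauss !E (hs 2 1) (hs 3 1) (hs 3 2);
  move: (h 1 1) (h 1 2) (h 1 3) (h 2 2) (h 2 3) (h 3 3);
  move: (T 1 1 1) (T 1 1 2) (T 1 1 3) (T 1 2 2) (T 1 2 3) (T 1 3 3);
  move: (T 2 2 2) (T 2 2 3) (T 2 3 3) (T 3 3 3) => *; ring.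
Qed.

End RivertzAlgebra.

(** * A local unit normal *)

Section UnitNormal.
Context {R : realType} {n : nat}.

Lemma positive_unitmx (G : 'M[R]_n) :
  (forall v : 'rV[R]_n, v != 0 -> 0 < bilin G v v) -> G \in unitmx.
Proof.
move=> Gpos; rewrite -row_free_unit -kermx_eq0; apply/eqP/row_matrixP => i.
rewrite row0; apply/eqP; apply: contraT => /Gpos.
by rewrite /bilin -row_mul mulmx_ker row0 mul0mx mxE ltxx.
Qed.

Lemma dot_self N (v : 'rV[R]_N) : v *m v^T = (dot v v)%:M.
Proof. by apply/matrixP => i j; rewrite !ord1 [RHS]mxE eqxx. Qed.

Lemma dot_gt0 N (v : 'rV[R]_N) : v != 0 -> 0 < dot v v.
Proof.
move=> v0; have E : dot v v = \sum_i v 0 i ^+ 2.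
  by rewrite /dot mxE; apply: eq_bigr => i _; rewrite mxE expr2.
have [i vi] : exists i, v 0 i != 0.
  apply/existsP; apply: contraNT v0; rewrite negb_exists => /forallP v0.
  by apply/eqP/rowP => i; rewrite mxE; apply/eqP; rewrite -[_ == _]negbK.
rewrite E (bigD1 i)//= ltr_wpDr ?sumr_ge0// => [j _|]; first exact: sqr_ge0.
by rewrite exprn_even_gt0.
Qed.

(** A vector normal at [x0] is projected off the tangent spaces at nearby points. The projection is
    smooth and, by continuity, nonzero near [x0], so it can be normalised. *)
Lemma unit_normal_exists (g : 'rV[R]_n -> 'M[R]_n) (J : 'rV[R]_n -> 'M[R]_(n, n + 1))
    (D : set 'rV[R]_n) x0 : open D -> D x0 -> smooth D g -> smooth D J ->
  (forall x, D x -> (g x)^T = g x) -> (forall x, D x -> g x \in unitmx) ->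
  (forall x, D x -> J x *m (J x)^T = g x) ->
  exists (r : R) (N : 'rV[R]_n -> 'rV[R]_(n + 1)),
    [/\ 0 < r, ball x0 r `<=` D, smooth (ball x0 r) N,
        forall x, ball x0 r x -> J x *m (N x)^T = 0 &
        forall x, ball x0 r x -> N x *m (N x)^T = 1%:M].
Proof.
move=> Do Dx0 gsm Jsm gsym gunit JJ.
have [v v0 vJ] : exists2 v : 'rV[R]_(n + 1), v != 0 & v *m (J x0)^T = 0.
  have K0 : kermx (J x0)^T != 0.
    rewrite kermx_eq0 /row_free; apply/eqP => rk.
    by have := rank_leq_col (J x0)^T; rewrite rk addn1 ltnn.
  have /rowV0Pn[v /sub_kermxP vJ v0] := K0.
  by exists v.
(* Since [g] is the Gram matrix of the rows of [J], the subtracted term is the orthogonal projection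
   of [v] to the tangent space. *)
pose N1 y := v - v *m (J y)^T *m invmx (g y) *m J y.
have N1sm : smooth D N1.
  move=> k; apply: (CkB Do (@Ck_cst _ _ _ _ _ v)).
  apply: (Ck_mulmx Do _ (Jsm k)); apply: (Ck_mulmx Do _ (Ck_invmx Do gunit (gsm k))).
  exact: (Ck_mulmx Do (@Ck_cst _ _ _ _ _ v) (Ck_trmx Do (Jsm k))).
have N1x0 : N1 x0 = v by rewrite /N1 vJ !mul0mx subr0.
have JN1 x : D x -> J x *m (N1 x)^T = 0.
  move=> Dx; have ginv : (invmx (g x))^T = invmx (g x) by rewrite trmx_inv gsym.
  rewrite /N1 trmx_add trmx_opp !trmx_mul trmxK ginv mulmxDr mulmxN !mulmxA JJ//.
  by rewrite mulmxV ?gunit// mul1mx subrr.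
pose q y := dot (N1 y) (N1 y).
have qsm : smooth D q.
  move=> k; have := Ck_mulmx Do (N1sm k) (Ck_trmx Do (N1sm k)) => /Ck_mxP.
  exact.
have q0 : 0 < q x0 by rewrite /q N1x0 dot_gt0.
have [r /= r0 rD] : exists2 r : R, 0 < r & ball x0 r `<=` [set y | D y /\ 0 < q y].
  apply/nbhs_ballP.
  have qc := smooth_continuous qsm Dx0.
  have h : \forall y \near x0, 0 < q y by apply: (cvgr_gt _ qc).
  have Dn : nbhs x0 D by exact: open_nbhs_nbhs.
  by apply: filterS2 Dn h => y Dy qy.
have bo : open (ball x0 r) by exact: ball_open.
exists r, (fun y => (Num.sqrt (q y))^-1 *: N1 y); split=> //.
- by move=> y /rD[].
- have rD' : ball x0 r `<=` D by move=> y /rD[].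
  move=> k; apply: (Ck_scale bo); last exact: (Ck_sub rD' (N1sm k)).
  apply: (Ck_rsqrt bo _ (Ck_sub rD' (qsm k))).
  by move=> y /rD[].
- by move=> y /rD[Dy _]; rewrite linearZ/= -scalemxAr JN1// scaler0.
- move=> y /rD[Dy qy].
  rewrite linearZ/= -scalemxAr -scalemxAl dot_self scalerA -/(q y) scale_scalar_mx.
  rewrite -invfM -expr2 sqr_sqrtr ?ltW// mulVf// gt_eqF//.
Qed.

End UnitNormal.

(** * Necessity of the curvature conditions *)

Section Necessity.
Context {R : realType} (M : smoothManifold R 3) (g : riemannianMetric M).

Lemma gram_unit (c : @chart R M 3) x : atlas c -> (chart_coord c @` chart_dom c) x ->
  gram g c x \in unitmx.
Proof. by move=> ca cx; apply: positive_unitmx => v; exact: gram_pos. Qed.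

Lemma nbhs_chart_image (c : @chart R M 3) (U : set M) p : open U -> U p -> chart_dom c p ->
  nbhs (chart_coord c p) (chart_coord c @` (chart_dom c `&` U)).
Proof.
move=> Uo Up cp; have cI : (chart_coord c @` chart_dom c) (chart_coord c p) by exists p.
have H1 : nbhs (chart_coord c p) (chart_coord c @` chart_dom c).
  by apply: open_nbhs_nbhs; split => //; exact: chart_image_open.
have H2 : \forall y \near chart_coord c p, U (chart_param c y).
  apply: (chart_param_continuous cI); apply: open_nbhs_nbhs; split => //.
  by rewrite chart_coordK.
apply: filterS2 H1 H2 => y [q cq <-]; rewrite chart_coordK// => Uq.
by exists q.
Qed.

(** On a ball where the frame, the embedding and a unit normal are all available, [h] and [T] are
    the values on the frame of the second form and of its covariant derivative. This reduces
    necessity to algebra at one point. *)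
Lemma embedded_frame_point (c : @chart R M 3) A X x : locally_isometrically_embeddable g 4 ->
  atlas c -> local_frame c A X -> A x ->
  exists (h : nat -> nat -> R) (T : nat -> nat -> nat -> R),
  [/\ forall i j, h i j = h j i, forall m i k, T m i k = T i m k,
      forall m i k, T m i k = T m k i,
      forall i j k l, Rc (gram g c) X x i j k l = h i k * h j l - h j k * h i l &
      forall i j k l m, Sc (gram g c) X x i j k l m =
        T m i k * h j l + h i k * T m j l - T m j k * h i l - h j k * T m i l].
Proof.
move=> emb ca [Ao AI Xsm _] Ax; have [p cp px] := AI x Ax.
have [U [Uo Up [f [[fsm _ _] fiso]]]] := emb p.
have [r /= r0 rD] : exists2 r : R, 0 < r & ball x r `<=`
    [set y | A y /\ (chart_coord c @` (chart_dom c `&` U)) y].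
  apply/nbhs_ballP; have H1 : nbhs x A by exact: open_nbhs_nbhs.
  have H2 := nbhs_chart_image Uo Up cp; rewrite px in H2.
  by apply: filterS2 H1 H2 => y Ay Uy.
pose phi : 'rV[R]_3 -> 'rV[R]_(3 + 1) := f \o chart_param c.
have bI y : ball x r y -> (chart_coord c @` chart_dom c) y.
  by move=> /rD[_ [q [cq _] <-]]; exists q.
have bo : open (ball x r) by exact: ball_open.
have bx : ball x r x by exact: ballxx.
have gsm : smooth (ball x r) (gram g c).
  by move=> k; apply: Ck_sub (gram_smooth g ca k).
have gsym y : ball x r y -> (gram g c y)^T = gram g c y.
  by move=> /bI cy; exact: gram_sym.
have gunit y : ball x r y -> gram g c y \in unitmx.
  by move=> /bI cy; exact: gram_unit.
have phism : smooth (ball x r) phi.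
  by move=> k; apply: Ck_sub (fsm c ca k) => y /rD[].
have phi_iso y v w : ball x r y ->
    dot ('D_v phi y) ('D_w phi y) = bilin (gram g c y) v w.
  by move=> /rD[_ cy]; exact: fiso.
have Jsm := tangent_frame_smooth bo phism.
have JJ := tangent_gram phism phi_iso.
have [s [N [s0 sr Nsm JN NN]]] := unit_normal_exists bo bx gsm Jsm gsym gunit JJ.
have so : open (ball x s) by exact: ball_open.
have sx : ball x s x by exact: ballxx.
have gsm' : smooth (ball x s) (gram g c) by move=> k; exact: Ck_sub sr (gsm k).
have gsym' y (sy : ball x s y) := gsym y (sr y sy).
have gunit' y (sy : ball x s y) := gunit y (sr y sy).
have phism' : smooth (ball x s) phi by move=> k; exact: Ck_sub sr (phism k).
have phi_iso' y v w (sy : ball x s y) := phi_iso y v w (sr y sy).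
have Fsm i : smooth (ball x s) (frame X i).
  by move=> k; apply: Ck_sub (Xsm (inord i.-1) k) => y /sr/rD[].
pose H := second_form phi N.
have Hsm : smooth (ball x s) H by exact: second_form_smooth.
have gauss y u v z w (sy : ball x s y) :=
  gauss_equation so gsm' gsym' gunit' phism' phi_iso' Nsm JN NN u v z w sy.
have Gx := gsm'.
pose nabH v := 'D_v H x - connection (gram g c) x v *m H x
   - H x *m (connection (gram g c) x v)^T.
have sym12 u v w : bilin (nabH u) w v = bilin (nabH v) w u.
  exact: (codazzi_sym12 so gsm' gsym' gunit' phism' phi_iso' Nsm JN NN u v w sx).
have sym23 u v w : bilin (nabH u) w v = bilin (nabH u) v w.
  exact: (codazzi_sym23 (gram g c) so phism' Nsm u v w sx).
exists (fun i j => bilin (H x) (frame X i x) (frame X j x)),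
  (fun m i k => bilin (nabH (frame X m x)) (frame X i x) (frame X k x)).
have Hs : (H x)^T = H x by exact: (second_form_sym so phism' N sx).
split.
- by move=> i j; exact: bilin_sym.
- by move=> m i k; rewrite sym23 sym12 sym23.
- by move=> m i k; exact: sym23.
- move=> i j k l; rewrite /Rc.
  rewrite (riemannE so gsm' gunit' _ (Fsm i) (Fsm j) (Fsm k) sx).
  exact: (gauss x _ _ _ _ sx).
- move=> i j k l m; rewrite /Sc.
  exact: (nabla_riemann_gauss so gsm' gunit' Hsm gauss
    (Fsm m) (Fsm i) (Fsm j) (Fsm k) (Fsm l) sx).
Qed.

End Necessity.

(** * The form determined by the curvature *)

Section CodazziAlgebra.
Context {R : realType}.
Variables (G : 'rV[R]_3 -> 'M[R]_3) (X : 'I_3 -> 'rV[R]_3 -> 'rV[R]_3) (x : 'rV[R]_3).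

(** Jacobi's identity for the adjugate of [Rtilde]: the [C_ij] are, up to sign and order, its
    entries, so their two-by-two minors are the determinant times entries of [Rtilde]. After
    division by the determinant these equations are Gauss. *)
Lemma rivertz_cofactor_minors :
  let D := \det (Rtilde G X x) in
  [/\ C11 G X x * C22 G X x - C12 G X x ^+ 2 = D * Rc G X x 1 2 1 2,
      C11 G X x * C23 G X x - C12 G X x * C13 G X x = D * Rc G X x 1 2 1 3 &
      C12 G X x * C23 G X x - C22 G X x * C13 G X x = D * Rc G X x 1 2 2 3] /\
  [/\ C11 G X x * C33 G X x - C13 G X x ^+ 2 = D * Rc G X x 1 3 1 3,
      C12 G X x * C33 G X x - C23 G X x * C13 G X x = D * Rc G X x 1 3 2 3 &
      C22 G X x * C33 G X x - C23 G X x ^+ 2 = D * Rc G X x 2 3 2 3].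
Proof.
rewrite /= det_Rtilde /C11 /C12 /C13 /C22 /C23 /C33.
move: (Rc G X x 1 2 1 2) (Rc G X x 1 2 1 3) (Rc G X x 1 2 2 3).
move: (Rc G X x 1 3 1 3) (Rc G X x 1 3 2 3) (Rc G X x 2 3 2 3) => *.
by split; split; ring.
Qed.

Variables (h : nat -> nat -> R) (T : nat -> nat -> nat -> R).
Hypothesis hs : forall i j, h i j = h j i.
Hypothesis T23 : forall m i k, T m i k = T m k i.
Hypothesis gauss : forall i j k l, Rc G X x i j k l = h i k * h j l - h j k * h i l.
Hypothesis dgauss : forall i j k l m, Sc G X x i j k l m =
  T m i k * h j l + h i k * T m j l - T m j k * h i l - h j k * T m i l.
Hypothesis bianchi : forall k l,
  Sc G X x 1 2 k l 3 + Sc G X x 2 3 k l 1 + Sc G X x 3 1 k l 2 = 0.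
Hypothesis det_neq0 : \det (Rtilde G X x) != 0.
Hypothesis r123 : [/\ r1 G X x = 0, r2 G X x = 0 & r3 G X x = 0].
Hypothesis r456 : [/\ r4 G X x = 0, r5 G X x = 0 & r6 G X x = 0].

(* With [c] the cofactor matrix of [h] and [M] the Codazzi defect, [r1, r4, r6]
   are the diagonal entries of [c *m M], [r2, r3, r5] its symmetric off-diagonal
   part and the second Bianchi identity its antisymmetric part. *)
Lemma codazzi_of_rivertz :
  [/\ forall b, (b = 1 \/ b = 2 \/ b = 3)%N -> T 3 b 2 = T 2 b 3,
      forall b, (b = 1 \/ b = 2 \/ b = 3)%N -> T 1 b 3 = T 3 b 1 &
      forall b, (b = 1 \/ b = 2 \/ b = 3)%N -> T 2 b 1 = T 1 b 2].
Proof.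
have [e1 e2 e3] := r123; have [e4 e5 e6] := r456.
have B12 := bianchi 1 2; have B13 := bianchi 1 3; have B23 := bianchi 2 3.
have d0 := det_neq0; move: d0 e1 e2 e3 e4 e5 e6 B12 B13 B23.
rewrite (det_Rtilde_gauss hs gauss) expf_eq0 /=.
rewrite /r1 /r2 /r3 /r4 /r5 /r6 /C11 /C12 /C13 /C22 /C23 /C33.
rewrite !dgauss !gauss (hs 2 1) (hs 3 1) (hs 3 2).
rewrite !(T23 _ 2 1) !(T23 _ 3 1) !(T23 _ 3 2).
set h11 := h 1 1; set h12 := h 1 2; set h13 := h 1 3.
set h22 := h 2 2; set h23 := h 2 3; set h33 := h 3 3.
pose c11 := h22 * h33 - h23 ^+ 2; pose c12 := - (h12 * h33 - h23 * h13).
pose c13 := h12 * h23 - h22 * h13; pose c22 := h11 * h33 - h13 ^+ 2.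
pose c23 := - (h11 * h23 - h12 * h13); pose c33 := h11 * h22 - h12 ^+ 2.
(* The row is the middle index of [T]. The column is the index complementary to the antisymmetrised
   pair: [(3, 2)], [(1, 3)], [(2, 1)] for columns 1, 2, 3. *)
pose M11 := T 3 1 2 - T 2 1 3; pose M21 := T 3 2 2 - T 2 2 3; pose M31 := T 3 2 3 - T 2 3 3.
pose M12 := T 1 1 3 - T 3 1 1; pose M22 := T 1 2 3 - T 3 1 2; pose M32 := T 1 3 3 - T 3 1 3.
pose M13 := T 2 1 1 - T 1 1 2; pose M23 := T 2 1 2 - T 1 2 2; pose M33 := T 2 1 3 - T 1 2 3.
set d := (X in X != 0) => d0 e1 e2 e3 e4 e5 e6 B12 B13 B23.
have Q33 : c13 * M13 + c23 * M23 + c33 * M33 = 0.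
  apply: (mulfI d0); rewrite mulr0 -[RHS]e1 /d /c13 /c23 /c33 /M13 /M23 /M33; ring.
have Q22 : c12 * M12 + c22 * M22 + c23 * M32 = 0.
  apply: (mulfI d0); rewrite mulr0 -[RHS]e4 /d /c12 /c22 /c23 /M12 /M22 /M32; ring.
have Q11 : c11 * M11 + c12 * M21 + c13 * M31 = 0.
  apply: (mulfI d0); rewrite mulr0 -[RHS]e6 /d /c11 /c12 /c13 /M11 /M21 /M31; ring.
pose b12 := (T 3 1 1 * h22 + h11 * T 3 2 2 - T 3 1 2 * h12 - h12 * T 3 1 2)
  + (T 1 1 2 * h23 + h12 * T 1 2 3 - T 1 1 3 * h22 - h13 * T 1 2 2)
  + (T 2 1 3 * h12 + h13 * T 2 1 2 - T 2 1 1 * h23 - h11 * T 2 2 3).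
pose b13 := (T 3 1 1 * h23 + h11 * T 3 2 3 - T 3 1 2 * h13 - h12 * T 3 1 3)
  + (T 1 1 2 * h33 + h12 * T 1 3 3 - T 1 1 3 * h23 - h13 * T 1 2 3)
  + (T 2 1 3 * h13 + h13 * T 2 1 3 - T 2 1 1 * h33 - h11 * T 2 3 3).
pose b23 := (T 3 1 2 * h23 + h12 * T 3 2 3 - T 3 2 2 * h13 - h22 * T 3 1 3)
  + (T 1 2 2 * h33 + h22 * T 1 3 3 - T 1 2 3 * h23 - h23 * T 1 2 3)
  + (T 2 2 3 * h13 + h23 * T 2 1 3 - T 2 1 2 * h33 - h12 * T 2 3 3).
have {}B12 : b12 = 0 by rewrite -[RHS]B12 /b12; ring.
have {}B13 : b13 = 0 by rewrite -[RHS]B13 /b13; ring.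
have {}B23 : b23 = 0 by rewrite -[RHS]B23 /b23; ring.
have two0 : 2 * d != 0 by rewrite mulf_neq0.
(* Modulo Bianchi, [- r2] is [d] times the sum of two opposite off-diagonal entries of [c *m M], and
   Bianchi makes these entries equal; hence the factor [2 * d]. The multiples of [b12] and [b23] are
   the explicit correction. *)
have Q23 : c12 * M13 + c22 * M23 + c23 * M33 = 0.
  apply: (mulfI two0); rewrite mulr0.
  transitivity (- 0 - d * (h11 * b23 + 2 * h13 * b12)); last by rewrite B12 B23; ring.
  by rewrite -{1}e2 /d /b12 /b23 /c12 /c22 /c23 /M13 /M23 /M33; ring.
have Q13 : c11 * M13 + c12 * M23 + c13 * M33 = 0.
  apply: (mulfI two0); rewrite mulr0.
  transitivity (0 + d * (- h22 * b13 + 2 * h23 * b12)); last by rewrite B12 B13; ring.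
  by rewrite -{1}e3 /d /b12 /b13 /c11 /c12 /c13 /M13 /M23 /M33; ring.
have Q12 : c11 * M12 + c12 * M22 + c13 * M32 = 0.
  apply: (mulfI two0); rewrite mulr0.
  transitivity (- 0 - d * (- 2 * h23 * b13 + h33 * b12)); last by rewrite B12 B13; ring.
  by rewrite -{1}e5 /d /b12 /b13 /c11 /c12 /c13 /M12 /M22 /M32; ring.
(* Up to sign, the differences of opposite off-diagonal entries are the rows of [h] paired with
   [(b23, - b13, b12)]: here the first row, then the second and the third. *)
have Q32 : c13 * M12 + c23 * M22 + c33 * M32 = 0.
  transitivity (c12 * M13 + c22 * M23 + c23 * M33
    + (h11 * b23 - h12 * b13 + h13 * b12)); last by rewrite Q23 B12 B13 B23; ring.
  by rewrite /b12 /b13 /b23 /c12 /c22 /c23 /c13 /c33 /M13 /M23 /M33 /M12 /M22 /M32; ring.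
have Q31 : c13 * M11 + c23 * M21 + c33 * M31 = 0.
  transitivity (c11 * M13 + c12 * M23 + c13 * M33
    - (h12 * b23 - h22 * b13 + h23 * b12)); last by rewrite Q13 B12 B13 B23; ring.
  by rewrite /b12 /b13 /b23 /c11 /c12 /c13 /c23 /c33 /M13 /M23 /M33 /M11 /M21 /M31; ring.
have Q21 : c12 * M11 + c22 * M21 + c23 * M31 = 0.
  transitivity (c11 * M12 + c12 * M22 + c13 * M32
    + (h13 * b23 - h23 * b13 + h33 * b12)); last by rewrite Q12 B12 B13 B23; ring.
  by rewrite /b12 /b13 /b23 /c11 /c12 /c13 /c22 /c23 /M12 /M22 /M32 /M11 /M21 /M31; ring.
(* [c] is inverted by multiplying with [h], since [h *m c] is [d] times the identity. *)
have solve q1 q2 q3 : c11 * q1 + c12 * q2 + c13 * q3 = 0 ->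
    c12 * q1 + c22 * q2 + c23 * q3 = 0 -> c13 * q1 + c23 * q2 + c33 * q3 = 0 ->
    [/\ q1 = 0, q2 = 0 & q3 = 0].
  move=> a1 a2 a3; split; apply: (mulfI d0); rewrite mulr0.
  - transitivity (h11 * (c11 * q1 + c12 * q2 + c13 * q3)
      + h12 * (c12 * q1 + c22 * q2 + c23 * q3) + h13 * (c13 * q1 + c23 * q2 + c33 * q3)).
      by rewrite /d /c11 /c12 /c13 /c22 /c23 /c33; ring.
    by rewrite a1 a2 a3; ring.
  - transitivity (h12 * (c11 * q1 + c12 * q2 + c13 * q3)
      + h22 * (c12 * q1 + c22 * q2 + c23 * q3) + h23 * (c13 * q1 + c23 * q2 + c33 * q3)).
      by rewrite /d /c11 /c12 /c13 /c22 /c23 /c33; ring.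
    by rewrite a1 a2 a3; ring.
  - transitivity (h13 * (c11 * q1 + c12 * q2 + c13 * q3)
      + h23 * (c12 * q1 + c22 * q2 + c23 * q3) + h33 * (c13 * q1 + c23 * q2 + c33 * q3)).
      by rewrite /d /c11 /c12 /c13 /c22 /c23 /c33; ring.
    by rewrite a1 a2 a3; ring.
have [/subr0_eq m11 /subr0_eq m21 /subr0_eq m31] := solve _ _ _ Q11 Q21 Q31.
have [/subr0_eq m12 /subr0_eq m22 /subr0_eq m32] := solve _ _ _ Q12 Q22 Q32.
have [/subr0_eq m13 /subr0_eq m23 /subr0_eq m33] := solve _ _ _ Q13 Q23 Q33.
split=> b [->|[->|->]].
- exact: m11.
- exact: m21.
- by rewrite (T23 3 3 2).
- exact: m12.
- by rewrite (T23 3 2 1).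
- by rewrite (T23 3 3 1).
- exact: m13.
- by rewrite (T23 2 2 1).
- by rewrite (T23 2 3 1) (T23 1 3 2).
Qed.

End CodazziAlgebra.

(** * Pair symmetry of the curvature tensor *)

Section CurvatureSymmetries.
Context {R : realType} {n : nat}.
Variables (g : 'rV[R]_n -> 'M[R]_n) (D : set 'rV[R]_n).
Hypothesis Do : open D.
Hypothesis gsm : smooth D g.
Hypothesis gsym : forall x, D x -> (g x)^T = g x.
Hypothesis gunit : forall x, D x -> g x \in unitmx.

Local Notation Gam := (connection g).
Local Notation Om := (connection_curvature Gam).

Lemma linear_row_eq (W : lmodType R) (f1 f2 : 'rV[R]_n -> W) : linear f1 -> linear f2 ->
  (forall i, f1 (delta_mx 0 i) = f2 (delta_mx 0 i)) -> f1 =1 f2.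
Proof.
move=> l1 l2 E v.
pose L1 := GRing.isLinear.Build R 'rV[R]_n W *:%R f1 l1.
pose f1' : {linear 'rV[R]_n -> W} := HB.pack f1 L1.
pose L2 := GRing.isLinear.Build R 'rV[R]_n W *:%R f2 l2.
pose f2' : {linear 'rV[R]_n -> W} := HB.pack f2 L2.
rewrite -[f1]/(f1' : _ -> _) -[f2]/(f2' : _ -> _) (row_sum_delta v) !linear_sum.
by apply: eq_bigr => i _; rewrite !linearZ/= E.
Qed.

Let R4 x u v z w := bilin (g x) (z *m Om x u v) w.

Let R4_anti12 x u v z w : R4 x v u z w = - R4 x u v z w.
Proof. by rewrite /R4 (curvature_matrix_antisym Gam x u v) mulmxN bilinNl. Qed.

Let R4_anti34 x u v z w : D x -> R4 x u v w z = - R4 x u v z w.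
Proof.
move=> Dx; have := curvature_metric_antisym Do gsm gsym gunit u v Dx => E.
have Ez : (w *m (Om x u v *m g x + g x *m (Om x u v)^T) *m z^T) 0 0 = 0.
  by rewrite E mulmx0 mul0mx mxE.
apply/eqP; rewrite -addr_eq0; apply/eqP; rewrite -[RHS]Ez /R4 /bilin.
move: (Om x u v) (g x) (gsym Dx) => O G Gs.
rewrite mulmxDr mulmxDl [RHS]mxE !mulmxA; congr (_ + _).
rewrite -[in LHS](trmxK (z *m _ *m _ *m _)) [LHS]mxE; congr (fun_of_matrix _ 0 0).
by rewrite !trmx_mul !trmxK Gs !mulmxA.
Qed.

Let R4_bianchi x u v z w : D x -> R4 x u v z w + R4 x v z u w + R4 x z u v w = 0.
Proof.
move=> Dx; rewrite /R4 -!bilinDl (first_bianchi Do gsm gsym gunit u v z Dx).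
by rewrite /bilin !mul0mx mxE.
Qed.

(** Four instances of the first Bianchi identity, one for each omitted argument, are brought to
    common terms by the two antisymmetries; the claim is then a linear combination of them. *)
Lemma curvature_pair_sym x u v z w : D x ->
  bilin (g x) (z *m Om x u v) w = bilin (g x) (u *m Om x z w) v.
Proof.
move=> Dx; rewrite -/(R4 x u v z w) -/(R4 x z w u v).
have a12 := R4_anti12 x; have a34 a b c d := R4_anti34 a b c d Dx.
have b1 := R4_bianchi u v z w Dx; have b2 := R4_bianchi v z w u Dx.
have b3 := R4_bianchi z w u v Dx; have b4 := R4_bianchi w u v z Dx.
move: b1 b2 b3 b4.
rewrite (a12 u z) (a34 v z u w) (a34 z w u v) (a12 v w z u) (a34 v w u z).
rewrite (a12 u w z v) (a34 u w v z) (a34 u z v w) (a12 u w v z) (a34 u v z w).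
by lra.
Qed.

End CurvatureSymmetries.

(** * Gauss and Codazzi for the form built from the curvature *)

Section RivertzForm.
Context {R : realType}.
Variables (g : 'rV[R]_3 -> 'M[R]_3) (D : set 'rV[R]_3).
Hypothesis Do : open D.
Hypothesis gsm : smooth D g.
Hypothesis gsym : forall x, D x -> (g x)^T = g x.
Hypothesis gunit : forall x, D x -> g x \in unitmx.

Local Notation Gam := (connection g).
Local Notation Om := (connection_curvature Gam).

Definition coordinate_frame (i : 'I_3) : 'rV[R]_3 -> 'rV[R]_3 := cst (delta_mx 0 i).

Local Notation X0 := coordinate_frame.

Hypothesis det_gt0 : forall x, D x -> 0 < \det (Rtilde g X0 x).
Hypothesis r123 : forall x, D x ->
  [/\ r1 g X0 x = 0, r2 g X0 x = 0 & r3 g X0 x = 0].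
Hypothesis r456 : forall x, D x ->
  [/\ r4 g X0 x = 0, r5 g X0 x = 0 & r6 g X0 x = 0].

(* By Jacobi's identity the [C_ij] are [\det h * h_ij] for the form [h] whose
   second compound is [Rtilde], and [\det Rtilde = (\det h) ^+ 2]. *)
Definition rivertz_form (x : 'rV[R]_3) : 'M[R]_3 :=
  (Num.sqrt (\det (Rtilde g X0 x)))^-1 *:
  \matrix_(i, j) nth 0 (nth [::]
    [:: [:: C11 g X0 x; C12 g X0 x; C13 g X0 x];
        [:: C12 g X0 x; C22 g X0 x; C23 g X0 x];
        [:: C13 g X0 x; C23 g X0 x; C33 g X0 x]] i) j.

Local Notation H := rivertz_form.

Lemma rivertz_form_sym x : (H x)^T = H x.
Proof.
apply/matrixP => i j; rewrite !mxE; congr (_ * _).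
by case: i => [[|[|[|//]]] ?]; case: j => [[|[|[|//]]] ?].
Qed.

Lemma coordinate_frame_smooth i : smooth D (X0 i).
Proof. by move=> k; exact: Ck_cst. Qed.

Lemma Rc_coordinate x i j k l : D x -> Rc g X0 x i j k l =
  - (Om x (frame X0 i x) (frame X0 j x) *m g x) (inord k.-1) (inord l.-1).
Proof.
move=> Dx; rewrite /Rc (riemannE Do gsm gunit _ (coordinate_frame_smooth _)
  (coordinate_frame_smooth _) (coordinate_frame_smooth _) Dx).
by rewrite -bilinMl bilin_delta.
Qed.

Lemma Rc_smooth i j k l : smooth D (fun x => Rc g X0 x i j k l).
Proof.
move=> a; have h : Ck a D (fun x => - (Om x (delta_mx 0 (inord i.-1))
    (delta_mx 0 (inord j.-1)) *m g x) (inord k.-1) (inord l.-1)).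
  apply: (CkN Do); apply: ((Ck_mxP _ _ Do).1 _ _ _).
  exact: (Ck_mulmx Do (curvature_matrix_smooth Do gsm gunit _ _ a) (gsm a)).
by apply: (Ck_eq Do _ h) => x; rewrite inE => /Rc_coordinate ->.
Qed.

Lemma rivertz_form_smooth : smooth D H.
Proof.
move=> a; have Rs i j k l := Rc_smooth i j k l a.
have C11s : Ck a D (C11 g X0).
  by rewrite /C11; apply: (CkB Do); apply: (Ck_mul Do).
have C12s : Ck a D (C12 g X0).
  by rewrite /C12; apply: (CkB Do); apply: (Ck_mul Do).
have C13s : Ck a D (C13 g X0).
  by rewrite /C13; apply: (CkB Do); apply: (Ck_mul Do).
have C22s : Ck a D (C22 g X0).
  by rewrite /C22; apply: (CkB Do); apply: (Ck_mul Do).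
have C23s : Ck a D (C23 g X0).
  by rewrite /C23; apply: (CkB Do); apply: (Ck_mul Do).
have C33s : Ck a D (C33 g X0).
  by rewrite /C33; apply: (CkB Do); apply: (Ck_mul Do).
apply: (Ck_scale Do).
  apply: (Ck_rsqrt Do det_gt0); apply: (Ck_det Do); apply/(Ck_mxP _ _ Do) => i j.
  case: i => [[|[|[|//]]] ?]; case: j => [[|[|[|//]]] ?];
    by apply: (Ck_eq Do _ (Rs _ _ _ _)) => x _; rewrite mxE.
apply/(Ck_mxP _ _ Do) => i j.
case: i => [[|[|[|//]]] ?]; case: j => [[|[|[|//]]] ?];
  [apply: (Ck_eq Do _ C11s)|apply: (Ck_eq Do _ C12s)|apply: (Ck_eq Do _ C13s)
  |apply: (Ck_eq Do _ C12s)|apply: (Ck_eq Do _ C22s)|apply: (Ck_eq Do _ C23s)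
  |apply: (Ck_eq Do _ C13s)|apply: (Ck_eq Do _ C23s)|apply: (Ck_eq Do _ C33s)];
  by move=> x _; rewrite mxE.
Qed.

(** Used once for each antisymmetric pair of indices, it reduces the 81 component equations of Gauss
    to nine. *)
Lemma antisym3_eq (f1 f2 : 'I_3 -> 'I_3 -> R) :
  (forall i j, f1 j i = - f1 i j) -> (forall i j, f2 j i = - f2 i j) ->
  f1 (inord 0) (inord 1) = f2 (inord 0) (inord 1) ->
  f1 (inord 0) (inord 2) = f2 (inord 0) (inord 2) ->
  f1 (inord 1) (inord 2) = f2 (inord 1) (inord 2) -> forall i j, f1 i j = f2 i j.
Proof.
move=> a1 a2 e01 e02 e12.
have z f i : (forall i j : 'I_3, f j i = - f i j :> R) -> f i i = 0.
  by move=> a; have := a i i; lra.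
have all3 (P : 'I_3 -> Prop) : P (inord 0) -> P (inord 1) -> P (inord 2) -> forall i, P i.
  by move=> p0 p1 p2 i; rewrite -(inord_val i); case: i => [[|[|[|//]]] ?] /=.
have z1 := fun i => z f1 i a1; have z2 := fun i => z f2 i a2.
apply: (all3 _); apply: (all3 _); rewrite ?z1 ?z2 ?e01 ?e02 ?e12 //.
- by rewrite a1 a2 e01.
- by rewrite a1 a2 e02.
- by rewrite a1 a2 e12.
Qed.

(** Pair symmetry reduces the nine equations left by [antisym3_eq] to the six of
    [rivertz_cofactor_minors]; the square of the normalising factor cancels the determinant
    there. *)
Lemma rivertz_gauss_entries x i j k l : D x ->
  - (Om x (delta_mx 0 i) (delta_mx 0 j) *m g x) k l =
  H x i k * H x j l - H x j k * H x i l.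
Proof.
move=> Dx; have Dn0 := det_gt0 Dx; have HsE := rivertz_form_sym x.
have Hs a b : H x b a = H x a b by rewrite -[in LHS]HsE mxE.
pose F i j k l := - (Om x (delta_mx 0 i) (delta_mx 0 j) *m g x) k l.
have FE i' j' k' l' : F i' j' k' l' = - bilin (g x)
    (delta_mx 0 k' *m Om x (delta_mx 0 i') (delta_mx 0 j')) (delta_mx 0 l').
  by rewrite /F -bilinMl bilin_delta.
have FR i' j' k' l' : F (inord i'.-1) (inord j'.-1) (inord k'.-1) (inord l'.-1) =
    Rc g X0 x i' j' k' l' by rewrite Rc_coordinate.
have F12 i' j' k' l' : F j' i' k' l' = - F i' j' k' l'.
  by rewrite /F (curvature_matrix_antisym Gam x (delta_mx 0 i')) mulNmx mxE.
have Fpair i' j' k' l' : F i' j' k' l' = F k' l' i' j'.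
  by rewrite !FE (curvature_pair_sym Do gsm gsym gunit).
have F34 i' j' k' l' : F i' j' l' k' = - F i' j' k' l'.
  by rewrite Fpair F12 -Fpair.
have sD : (Num.sqrt (\det (Rtilde g X0 x)))^-1 ^+ 2 * \det (Rtilde g X0 x) = 1.
  by rewrite exprVn sqr_sqrtr ?ltW// mulVf// gt_eqF.
have [[m1 m2 m3] [m4 m5 m6]] := rivertz_cofactor_minors g X0 x.
rewrite -/(F i j k l).
have base c1 c2 c3 c4 r (s := (Num.sqrt (\det (Rtilde g X0 x)))^-1) :
    c1 * c2 - c3 * c4 = \det (Rtilde g X0 x) * r ->
    r = s * c1 * (s * c2) - s * c3 * (s * c4).
  move=> E; transitivity (s ^+ 2 * (c1 * c2 - c3 * c4)); last by ring.
  by rewrite E mulrA sD mul1r.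
have HE a b : H x a b = (Num.sqrt (\det (Rtilde g X0 x)))^-1 * nth 0 (nth [::]
    [:: [:: C11 g X0 x; C12 g X0 x; C13 g X0 x];
        [:: C12 g X0 x; C22 g X0 x; C23 g X0 x];
        [:: C13 g X0 x; C23 g X0 x; C33 g X0 x]] a) b by rewrite !mxE.
have n0 : (0 < 3)%N by []; have n1 : (1 < 3)%N by []; have n2 : (2 < 3)%N by [].
apply: (@antisym3_eq (fun i j => F i j k l)
  (fun i j => H x i k * H x j l - H x j k * H x i l)) => [||||].
- by move=> *; exact: F12.
- by move=> *; ring.
- apply: (@antisym3_eq (fun k l => F (inord 0) (inord 1) k l)
    (fun k l => H x (inord 0) k * H x (inord 1) l - H x (inord 1) k * H x (inord 0) l)).
  + by move=> *; exact: F34.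
  + by move=> *; ring.
  + rewrite (FR 1 2 1 2)%N !HE !inordK//=; apply: base; rewrite -m1; ring.
  + rewrite (FR 1 2 1 3)%N !HE !inordK//=; apply: base; rewrite -m2; ring.
  + rewrite (FR 1 2 2 3)%N !HE !inordK//=; apply: base; rewrite -m3; ring.
- apply: (@antisym3_eq (fun k l => F (inord 0) (inord 2) k l)
    (fun k l => H x (inord 0) k * H x (inord 2) l - H x (inord 2) k * H x (inord 0) l)).
  + by move=> *; exact: F34.
  + by move=> *; ring.
  + rewrite Fpair (FR 1 2 1 3)%N !HE !inordK//=; apply: base; rewrite -m2; ring.
  + rewrite (FR 1 3 1 3)%N !HE !inordK//=; apply: base; rewrite -m4; ring.
  + rewrite (FR 1 3 2 3)%N !HE !inordK//=; apply: base; rewrite -m5; ring.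
- apply: (@antisym3_eq (fun k l => F (inord 1) (inord 2) k l)
    (fun k l => H x (inord 1) k * H x (inord 2) l - H x (inord 2) k * H x (inord 1) l)).
  + by move=> *; exact: F34.
  + by move=> *; ring.
  + rewrite Fpair (FR 1 2 2 3)%N !HE !inordK//=; apply: base; rewrite -m3; ring.
  + rewrite Fpair (FR 1 3 2 3)%N !HE !inordK//=; apply: base; rewrite -m5; ring.
  + rewrite (FR 2 3 2 3)%N !HE !inordK//=; apply: base; rewrite -m6; ring.
Qed.

Lemma curvature_matrix_linear x v : D x -> linear (fun u => Om x u v).
Proof. by move=> Dx; exact: (curvature_linearl Do gsm gunit v Dx). Qed.

Lemma rivertz_gauss_mx x u v : D x ->
  Om x u v *m g x = H x *m (v^T *m u - u^T *m v) *m H x.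
Proof.
move=> Dx.
have Hs a b : H x b a = H x a b by rewrite -[in LHS](rivertz_form_sym x) mxE.
have base i j : Om x (delta_mx 0 i) (delta_mx 0 j) *m g x =
    H x *m ((delta_mx 0 j : 'rV_3)^T *m delta_mx 0 i
      - (delta_mx 0 i : 'rV_3)^T *m delta_mx 0 j) *m H x.
  apply/matrixP => k l; have := rivertz_gauss_entries i j k l Dx.
  move=> /(congr1 -%R); rewrite opprK => ->.
  have e a b : (H x *m ((delta_mx 0 a : 'rV_3)^T *m delta_mx 0 b) *m H x) k l =
      H x k a * H x b l.
    rewrite !mulmxA trmx_delta -colE -mulmxA -rowE mxE big_ord1 !mxE.
    by [].
  by rewrite mulmxBr mulmxBl addmx_entry oppmx_entry !e (Hs i k) (Hs j k); ring.
have lin1 v' : linear (fun u => Om x u v' *m g x).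
  by move=> a p q; rewrite (curvature_matrix_linear v' Dx) mulmxDl scalemxAl.
have lin2 (v' : 'rV[R]_3) : linear (fun u => H x *m (v'^T *m u - u^T *m v') *m H x).
  move=> a p q; have -> : (a *: p + q)^T = a *: p^T + q^T by rewrite linearP.
  move: (H x) => h.
  rewrite !(mulmxDr, mulmxDl, mulmxN, mulNmx) -!scalemxAl -!scalemxAr -!scalemxAl.
  by mx_ring.
(* Extension from the basis in the first argument only; it is used twice, the antisymmetry of both
   sides exchanging the arguments in between. *)
have ext v' : (forall i, Om x (delta_mx 0 i) v' *m g x =
      H x *m (v'^T *m delta_mx 0 i - (delta_mx 0 i)^T *m v') *m H x) ->
    forall u, Om x u v' *m g x = H x *m (v'^T *m u - u^T *m v') *m H x.
  exact: (@linear_row_eq R 3 'M[R]_3 (fun u => Om x u v' *m g x)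
    (fun u => H x *m (v'^T *m u - u^T *m v') *m H x) (lin1 v') (lin2 v')).
apply: (ext _) => i.
have E1 w : Om x (delta_mx 0 i) w *m g x = - (Om x w (delta_mx 0 i) *m g x).
  by rewrite (curvature_matrix_antisym Gam x w) mulNmx.
have E2 (w : 'rV[R]_3) : H x *m (w^T *m delta_mx 0 i - (delta_mx 0 i)^T *m w) *m H x =
    - (H x *m ((delta_mx 0 i)^T *m w - w^T *m delta_mx 0 i) *m H x).
  by rewrite -opprB mulmxN mulNmx.
rewrite E1 E2; congr (- _); apply: (ext _) => j.
exact: base.
Qed.

Lemma rivertz_gauss x u v z w : D x ->
  - bilin (g x) (z *m Om x u v) w =
  bilin (H x) u z * bilin (H x) v w - bilin (H x) v z * bilin (H x) u w.
Proof.
move=> Dx; rewrite (bilin_sym u z (rivertz_form_sym x)).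
rewrite (bilin_sym v z (rivertz_form_sym x)) -bilinMl (rivertz_gauss_mx u v Dx).
rewrite /bilin; move: (H x) => h.
have -> : z *m (h *m (v^T *m u - u^T *m v) *m h) *m w^T =
    (z *m h *m v^T) *m (u *m h *m w^T) - (z *m h *m u^T) *m (v *m h *m w^T).
  by mx_distr.
have m11 (A B : 'M[R]_1) : (A *m B) 0 0 = A 0 0 * B 0 0 by rewrite mxE big_ord1.
by rewrite !mx_entryE !m11; ring.
Qed.

Let nabH x v : 'M[R]_3 := 'D_v H x - Gam x v *m H x - H x *m (Gam x v)^T.

Let nabH_linear x : D x -> linear (nabH x).
Proof.
move=> Dx a u v; have dH := smooth_differentiable rivertz_form_smooth Dx.
rewrite /nabH derivative_add// derivative_scale// connection_linear.
move: ('D_u H x) ('D_v H x) (Gam x u) (Gam x v) => p q c d; move: (H x) => h.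
have -> : (a *: c + d)^T = a *: c^T + d^T by rewrite linearP.
by rewrite !(mulmxDr, mulmxDl) -!scalemxAl -!scalemxAr; mx_ring.
Qed.

Let nabH_sym x u v w : D x -> bilin (nabH x u) w v = bilin (nabH x u) v w.
Proof.
move=> Dx; apply: bilin_sym; have dH := smooth_differentiable rivertz_form_smooth Dx.
have : ('D_u H x)^T = 'D_u H x.
  exact: (derive_symmetric u Do rivertz_form_smooth (fun y _ => rivertz_form_sym y) Dx).
have := rivertz_form_sym x; rewrite /nabH.
move: ('D_u H x) (Gam x u) (H x) => p a h hs ps.
by mx_distr; rewrite hs ps; mx_ring.
Qed.

Lemma rivertz_codazzi_entries x : D x -> forall m b k : 'I_3,
  bilin (nabH x (delta_mx 0 m)) (delta_mx 0 b) (delta_mx 0 k) =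
  bilin (nabH x (delta_mx 0 k)) (delta_mx 0 b) (delta_mx 0 m).
Proof.
move=> Dx; pose h i j := bilin (H x) (frame X0 i x) (frame X0 j x).
pose T m i k := bilin (nabH x (frame X0 m x)) (frame X0 i x) (frame X0 k x).
have Xsm i : smooth D (frame X0 i) by exact: coordinate_frame_smooth.
have hs i j : h i j = h j i by apply: bilin_sym; exact: rivertz_form_sym.
have T23 m i k : T m i k = T m k i by exact: nabH_sym.
have gauss i j k l : Rc g X0 x i j k l = h i k * h j l - h j k * h i l.
  rewrite /Rc (riemannE Do gsm gunit _ (Xsm i) (Xsm j) (Xsm k) Dx).
  exact: rivertz_gauss.
have dgauss i j k l m : Sc g X0 x i j k l m =
    T m i k * h j l + h i k * T m j l - T m j k * h i l - h j k * T m i l.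
  exact: (nabla_riemann_gauss Do gsm gunit rivertz_form_smooth
    (fun y u v z w => @rivertz_gauss y u v z w) (Xsm m) (Xsm i) (Xsm j) (Xsm k) (Xsm l) Dx).
(* Coordinate fields are constant, so the identity proved for constant fields applies directly. *)
have bianchi k l :
    Sc g X0 x 1 2 k l 3 + Sc g X0 x 2 3 k l 1 + Sc g X0 x 3 1 k l 2 = 0.
  exact: (second_bianchi Do gsm gsym gunit _ _ _ _ _ Dx).
have Dn0 : \det (Rtilde g X0 x) != 0 by rewrite gt_eqF// det_gt0.
have [c1 c2 c3] := codazzi_of_rivertz hs T23 gauss dgauss bianchi Dn0 (r123 Dx) (r456 Dx).
have TE (m b k : 'I_3) : bilin (nabH x (delta_mx 0 m)) (delta_mx 0 b) (delta_mx 0 k)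
    = T m.+1 b.+1 k.+1.
  by rewrite /T /frame /coordinate_frame /= !inord_val.
have bin (b : 'I_3) : (b.+1 = 1 \/ b.+1 = 2 \/ b.+1 = 3)%N.
  by case: b => [[|[|[|//]]] ?] /=; [left|right; left|right; right].
move=> m b k; rewrite !TE; have := bin b; move: (val b).+1 => {}b {}bin.
by case: m => [[|[|[|//]]] ?]; case: k => [[|[|[|//]]] ?] //=;
  rewrite ?(c1 b bin) ?(c2 b bin) ?(c3 b bin).
Qed.

Lemma rivertz_codazzi x u v w : D x ->
  bilin (nabH x u) w v = bilin (nabH x v) w u.
Proof.
move=> Dx; have E := rivertz_codazzi_entries Dx.
have nl := nabH_linear Dx.
have L1 w' v' : linear (fun u => bilin (nabH x u) w' v' : R^o).
  move=> a p q; rewrite nl; move: (nabH x p) (nabH x q) => P Q.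
  by rewrite /bilin mulmxDr mulmxDl -scalemxAr -scalemxAl addmx_entry scalemx_entry.
have L2 (A : 'M[R]_3) (w' : 'rV[R]_3) : linear (fun v => bilin A w' v : R^o).
  move=> a p q; rewrite bilinDr; congr (_ + _).
  by rewrite /bilin linearZ/= -scalemxAr mxE.
have L3 (A : 'M[R]_3) (v' : 'rV[R]_3) : linear (fun w => bilin A w v' : R^o).
  move=> a p q; rewrite bilinDl; congr (_ + _).
  by rewrite /bilin -!scalemxAl mxE.
refine (@linear_row_eq R 3 R^o (fun u => bilin (nabH x u) w v)
  (fun u => bilin (nabH x v) w u) (L1 w v) (L2 _ w) _ u) => m.
refine (@linear_row_eq R 3 R^o (fun v => bilin (nabH x (delta_mx 0 m)) w v)
  (fun v => bilin (nabH x v) w (delta_mx 0 m)) (L2 _ w) (L1 w _) _ v) => k.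
refine (@linear_row_eq R 3 R^o (fun w => bilin (nabH x (delta_mx 0 m)) w (delta_mx 0 k))
  (fun w => bilin (nabH x (delta_mx 0 k)) w (delta_mx 0 m)) (L3 _ _) (L3 _ _) _ w) => b.
exact: E.
Qed.

(** The shape used by the fundamental theorem: the terms with [(Gam x u)^T] and [(Gam x v)^T] drop
    out by torsion-freeness. *)
Lemma rivertz_codazzi_mx x u v : D x ->
  'D_u H x *m v^T + Gam x v *m H x *m u^T = 'D_v H x *m u^T + Gam x u *m H x *m v^T.
Proof.
move=> Dx; have T := connection_torsion_free Do gsym u v Dx.
have E : nabH x u *m v^T = nabH x v *m u^T.
  apply/colP => i; have := rivertz_codazzi u v (delta_mx 0 i) Dx.
  by rewrite /bilin -!mulmxA -!rowE !mxE.
move: E; rewrite /nabH; move: T.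
move: ('D_u H x) ('D_v H x) (Gam x u) (Gam x v) (H x) => p q a b h T E.
have T2 : h *m a^T *m v^T = h *m b^T *m u^T.
  by rewrite -!mulmxA -!trmx_mul T.
move: E; rewrite !mulmxBl T2 => /eqP; rewrite -subr_eq0 => /eqP E.
by apply: subr0_eq; rewrite -[RHS]E; mx_ring.
Qed.

End RivertzForm.

(** * The fundamental theorem of hypersurfaces *)

Section BlockDerivatives.
Context {R : realType} {V : normedModType R}.

Lemma differentiable_row_mx m n1 n2 (a : V -> 'M[R]_(m, n1)) (b : V -> 'M[R]_(m, n2)) x :
  differentiable a x -> differentiable b x ->
  differentiable (fun y => row_mx (a y) (b y)) x.
Proof.
move=> /differentiable_mxP da /differentiable_mxP db; apply/differentiable_mxP => i j.
case: (split_ordP j) => k ->.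
  have -> : (fun y => row_mx (a y) (b y) i (lshift n2 k)) = (fun y => a y i k).
    by apply/funext => y; rewrite row_mxEl.
  exact: da.
have -> : (fun y => row_mx (a y) (b y) i (rshift n1 k)) = (fun y => b y i k).
  by apply/funext => y; rewrite row_mxEr.
exact: db.
Qed.

Lemma derive_row_mx m n1 n2 (a : V -> 'M[R]_(m, n1)) (b : V -> 'M[R]_(m, n2)) x v :
  differentiable a x -> differentiable b x ->
  'D_v (fun y => row_mx (a y) (b y)) x = row_mx ('D_v a x) ('D_v b x).
Proof.
move=> da db; apply/matrixP => i j.
rewrite (derive_mx_entry _ _ _ (differentiable_row_mx da db)).
case: (split_ordP j) => k ->.
  rewrite row_mxEl (derive_mx_entry v i k da).
  have -> : (fun y => row_mx (a y) (b y) i (lshift n2 k)) = (fun y => a y i k).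
    by apply/funext => y; rewrite row_mxEl.
  by [].
rewrite row_mxEr (derive_mx_entry v i k db).
have -> : (fun y => row_mx (a y) (b y) i (rshift n1 k)) = (fun y => b y i k).
  by apply/funext => y; rewrite row_mxEr.
by [].
Qed.

Lemma derive_col_mx m1 m2 n (a : V -> 'M[R]_(m1, n)) (b : V -> 'M[R]_(m2, n)) x v :
  differentiable a x -> differentiable b x ->
  'D_v (fun y => col_mx (a y) (b y)) x = col_mx ('D_v a x) ('D_v b x).
Proof.
move=> da db; have dat := differentiable_trmx da; have dbt := differentiable_trmx db.
have -> : (fun y => col_mx (a y) (b y)) = (fun y => (row_mx (a y)^T (b y)^T)^T).
  by apply/funext => y; rewrite tr_row_mx !trmxK.
rewrite (derive_trmx v (differentiable_row_mx dat dbt)) (derive_row_mx v dat dbt).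
by rewrite tr_row_mx (derive_trmx v da) (derive_trmx v db) !trmxK.
Qed.

Lemma derive_block_mx m1 m2 n1 n2 (a : V -> 'M[R]_(m1, n1)) (b : V -> 'M[R]_(m1, n2))
    (c : V -> 'M[R]_(m2, n1)) (d : V -> 'M[R]_(m2, n2)) x v :
  differentiable a x -> differentiable b x -> differentiable c x -> differentiable d x ->
  'D_v (fun y => block_mx (a y) (b y) (c y) (d y)) x =
  block_mx ('D_v a x) ('D_v b x) ('D_v c x) ('D_v d x).
Proof.
move=> da db dc dd; rewrite /block_mx.
rewrite (derive_col_mx v (differentiable_row_mx da db) (differentiable_row_mx dc dd)).
by rewrite (derive_row_mx v da db) (derive_row_mx v dc dd).
Qed.

Lemma Ck_block_mx m1 m2 n1 n2 (a : V -> 'M[R]_(m1, n1)) (b : V -> 'M[R]_(m1, n2))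
    (c : V -> 'M[R]_(m2, n1)) (d : V -> 'M[R]_(m2, n2)) (A : set V) k : open A ->
  Ck k A a -> Ck k A b -> Ck k A c -> Ck k A d ->
  Ck k A (fun y => block_mx (a y) (b y) (c y) (d y)).
Proof.
move=> Ao ak bk ck dk; apply/(Ck_mxP _ _ Ao) => i j.
case: (split_ordP i) => i' ->; case: (split_ordP j) => j' ->.
- apply: (Ck_eq Ao _ ((Ck_mxP _ _ Ao).1 ak i' j')) => y _.
  by rewrite block_mxEul.
- apply: (Ck_eq Ao _ ((Ck_mxP _ _ Ao).1 bk i' j')) => y _.
  by rewrite block_mxEur.
- apply: (Ck_eq Ao _ ((Ck_mxP _ _ Ao).1 ck i' j')) => y _.
  by rewrite block_mxEdl.
- apply: (Ck_eq Ao _ ((Ck_mxP _ _ Ao).1 dk i' j')) => y _.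
  by rewrite block_mxEdr.
Qed.

Lemma derive_invmx n (g : V -> 'M[R]_n) (D : set V) x v : open D -> smooth D g ->
  (forall y, D y -> g y \in unitmx) -> D x ->
  'D_v (fun y => invmx (g y)) x = - (invmx (g x) *m 'D_v g x *m invmx (g x)).
Proof.
move=> Do gsm gunit Dx; have dg := smooth_differentiable gsm Dx.
have ism : smooth D (fun y => invmx (g y)) by move=> k; exact: (Ck_invmx Do gunit (gsm k)).
have di := smooth_differentiable ism Dx.
have : 'D_v (fun y => g y *m invmx (g y)) x = 0.
  rewrite (@derive_open_eq _ _ _ D _ (cst 1%:M) x v Do) ?derive_cst//.
  by move=> y; rewrite inE => /gunit/mulmxV.
rewrite (derive_mulmx v dg di) => /eqP; rewrite addr_eq0 => /eqP E.
by rewrite -[_ *m 'D_v g x *m _]mulmxA E mulmxN opprK mulmxA mulVmx ?gunit// mul1mx.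
Qed.

End BlockDerivatives.

Section Cholesky.
Context {R : realType}.

(** Supplies the initial tangent frame: the rows of [P] have Gram matrix [G]. The induction splits
    off the first coordinate and recurses on the Schur complement. *)
Lemma cholesky n (G : 'M[R]_n) : G^T = G ->
  (forall v : 'rV[R]_n, v != 0 -> 0 < bilin G v v) -> exists P : 'M[R]_n, P *m P^T = G.
Proof.
elim: n G => [|n IH] G Gs Gp; first by exists 0; apply/matrixP => -[].
change ('M[R]_(1 + n)) in G.
change (forall v : 'rV[R]_(1 + n), v != 0 -> 0 < bilin G v v) in Gp.
pose a : 'M[R]_1 := ulsubmx G; pose b := ursubmx G.
pose c := drsubmx G; pose s := a 0 0.
have aE : a = s%:M by apply/matrixP => i j; rewrite !ord1 [RHS]mxE eqxx.
have bT : dlsubmx G = b^T by rewrite /b trmx_ursub Gs.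
have cT : c^T = c by rewrite /c trmx_drsub Gs.
have GE : G = block_mx s%:M b b^T c by rewrite -aE -bT submxK.
have form (t : 'rV[R]_1) (v : 'rV[R]_n) : bilin G (row_mx t v) (row_mx t v) =
    (t *m t^T) 0 0 * s + (t *m b *m v^T) 0 0 *+ 2 + bilin c v v.
  rewrite /bilin {1}GE mul_row_block tr_row_mx mul_row_col !mulmxDl !addmx_entry.
  have -> : (v *m b^T *m t^T) 0 0 = (t *m b *m v^T) 0 0.
    rewrite -[in LHS](trmxK (v *m b^T *m t^T)) [LHS]mxE.
    by rewrite !trmx_mul !trmxK mulmxA.
  by rewrite mul_mx_scalar -scalemxAl scalemx_entry mulr2n; ring.
have s0 : 0 < s.
  have := Gp (row_mx 1%:M 0); rewrite form trmx0 mulmx0 /bilin trmx0 mulmx0.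
  rewrite trmx1 mulmx1 !mxE eqxx mul1r mul0rn !addr0; apply.
  apply/eqP => /(congr1 lsubmx); rewrite row_mxKl => /matrixP/(_ 0 0).
  rewrite !mxE eqxx => /eqP.
  by rewrite oner_eq0.
have [P' P'E] : exists P' : 'M[R]_n, P' *m P'^T = c - s^-1 *: (b^T *m b).
  apply: IH.
    rewrite trmx_add trmx_opp cT; congr (_ - _).
    by rewrite linearZ/= trmx_mul trmxK.
  (* This [t] minimises the form on [row_mx t v] for fixed [v], and the minimum is the value of the
     Schur complement at [v], hence positive. *)
  move=> v v0; pose t : 'rV[R]_1 := - s^-1 *: (v *m b^T).
  have tE : (t *m t^T) 0 0 * s + (t *m b *m v^T) 0 0 *+ 2 =
      - s^-1 * (v *m (b^T *m b) *m v^T) 0 0.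
    have -> : (t *m t^T) 0 0 = s^-1 ^+ 2 * (v *m (b^T *m b) *m v^T) 0 0.
      rewrite /t linearZ/= -scalemxAl -scalemxAr scalerA trmx_mul trmxK !mulmxA.
      by rewrite scalemx_entry mulrNN expr2.
    have -> : (t *m b *m v^T) 0 0 = - s^-1 * (v *m (b^T *m b) *m v^T) 0 0.
      by rewrite /t -!scalemxAl scalemx_entry !mulmxA.
    by rewrite mulr2n; field; rewrite gt_eqF.
  have := Gp (row_mx t v); rewrite form tE.
  have -> : bilin (c - s^-1 *: (b^T *m b)) v v =
      - s^-1 * (v *m (b^T *m b) *m v^T) 0 0 + bilin c v v.
    rewrite bilinBm addrC; congr (_ + _).
    by rewrite /bilin -scalemxAr -scalemxAl scalemx_entry mulNr.
  apply; apply: contraNneq v0 => /(congr1 rsubmx); rewrite row_mxKr => ->.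
  by apply/eqP/matrixP => i j; rewrite !mxE.
pose q := Num.sqrt s.
have q0 : q != 0 by rewrite gt_eqF// sqrtr_gt0.
have qq : q ^+ 2 = s by rewrite sqr_sqrtr// ltW.
pose P : 'M[R]_(1 + n) := block_mx q%:M 0 (q^-1 *: b^T) P'.
suff PE : P *m P^T = G by exists P.
rewrite /P tr_block_mx mulmx_block !trmx0 !mulmx0 !mul0mx !addr0 tr_scalar_mx.
rewrite linearZ/= trmxK P'E [RHS]GE; congr block_mx.
- by rewrite -scalar_mxM -expr2 qq.
- by rewrite mul_scalar_mx scalerA mulfV// scale1r.
- by rewrite mul_mx_scalar scalerA mulfV// scale1r.
- by rewrite -scalemxAl -scalemxAr scalerA -invfM -expr2 qq addrC subrK.
Qed.

End Cholesky.

Lemma sym_form_swap {R : realType} {n : nat} (u v : 'rV[R]_n) (S : 'M[R]_n) :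
  S^T = S -> u *m S *m v^T = v *m S *m u^T.
Proof.
move=> ST; have T : (u *m S *m v^T)^T = v *m S *m u^T.
  by rewrite !trmx_mul trmxK ST mulmxA.
by rewrite -T; apply/matrixP => i j; rewrite !ord1 [RHS]mxE.
Qed.

Section FundamentalTheorem.
Context {R : realType} {n : nat}.
Variables (g H : 'rV[R]_n -> 'M[R]_n) (D : set 'rV[R]_n).
Hypothesis Do : open D.
Hypothesis gsm : smooth D g.
Hypothesis gsym : forall x, D x -> (g x)^T = g x.
Hypothesis gunit : forall x, D x -> g x \in unitmx.
Hypothesis Hsm : smooth D H.
Hypothesis Hsym : forall x, D x -> (H x)^T = H x.

Local Notation Gam := (connection g).
Local Notation Om := (connection_curvature Gam).
Local Notation Gsm := (connection_smooth Do gsm gunit).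

Hypothesis gauss : forall x u v, D x ->
  Om x u v *m g x = H x *m (v^T *m u - u^T *m v) *m H x.
Hypothesis codazzi : forall x u v, D x ->
  'D_u H x *m v^T + Gam x v *m H x *m u^T = 'D_v H x *m u^T + Gam x u *m H x *m v^T.

(* [moving_frame] is the system satisfied by the tangent vectors and the unit
   normal of a hypersurface; [immersion_system] adds the position vector. *)
Definition moving_frame (x v : 'rV[R]_n) : 'M[R]_(n + 1) :=
  block_mx (Gam x v) (H x *m v^T) (- (v *m H x *m invmx (g x))) 0.

Definition immersion_system (x v : 'rV[R]_n) : 'M[R]_(1 + (n + 1)) :=
  block_mx 0 (row_mx v 0) 0 (moving_frame x v).

Local Notation B := moving_frame.
Local Notation A := immersion_system.

Lemma moving_frame_linear x : linear (B x).
Proof.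
move=> a u v; rewrite /B connection_linear.
have -> : (a *: u + v)^T = a *: u^T + v^T by rewrite linearP.
rewrite scale_block_mx add_block_mx scaler0 addr0; congr block_mx.
  by rewrite mulmxDr -scalemxAr.
by rewrite !mulmxDl -!scalemxAl opprD scalerN.
Qed.

Lemma immersion_system_linear x : linear (A x).
Proof.
move=> a u v; rewrite /A moving_frame_linear; move: (B x u) (B x v) => P Q.
rewrite scale_block_mx add_block_mx !scaler0 !addr0.
by congr block_mx; rewrite scale_row_mx add_row_mx scaler0 addr0.
Qed.

Lemma invmx_metric_smooth : smooth D (fun x => invmx (g x)).
Proof. by move=> k; exact: (Ck_invmx Do gunit (gsm k)). Qed.

Lemma moving_frame_smooth v : smooth D (fun x => B x v).
Proof.
move=> k; apply: (Ck_block_mx Do).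
- exact: Gsm.
- exact: (Ck_mulmx Do (Hsm k) (@Ck_cst _ _ _ _ _ v^T)).
- apply: (CkN Do); apply: (Ck_mulmx Do _ (invmx_metric_smooth k)).
  exact: (Ck_mulmx Do (@Ck_cst _ _ _ _ _ v) (Hsm k)).
- exact: Ck_cst.
Qed.

Lemma immersion_system_smooth v : smooth D (fun x => A x v).
Proof.
move=> k; apply: (Ck_block_mx Do); [exact: Ck_cst..|].
exact: moving_frame_smooth.
Qed.

Let dg x : D x -> differentiable g x.
Proof. by move=> Dx; exact: smooth_differentiable gsm Dx. Qed.

Let dH x : D x -> differentiable H x.
Proof. by move=> Dx; exact: smooth_differentiable Hsm Dx. Qed.

Let dG v x : D x -> differentiable (fun y => Gam y v) x.
Proof. by move=> Dx; exact: smooth_differentiable (Gsm v) Dx. Qed.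

Let derive_form_sym x u : D x -> ('D_u H x)^T = 'D_u H x.
Proof. by move=> Dx; exact: (derive_symmetric u Do Hsm Hsym Dx). Qed.

Let derive_moving_frame x u v : D x -> 'D_u (fun y => B y v) x =
  block_mx ('D_u (fun y => Gam y v) x) ('D_u H x *m v^T)
    (- (v *m 'D_u H x *m invmx (g x)
        - v *m H x *m (invmx (g x) *m Gam x u + (Gam x u)^T *m invmx (g x)))) 0.
Proof.
move=> Dx; have dv : differentiable (cst v : 'rV[R]_n -> 'rV[R]_n) x.
  exact: differentiable_cst.
have dvT : differentiable (cst v^T : 'rV[R]_n -> 'cV[R]_n) x by exact: differentiable_cst.
have di : differentiable (fun y => invmx (g y)) x.
  exact: smooth_differentiable invmx_metric_smooth Dx.
have dHv := differentiable_mulmx (dH Dx) dvT.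
have dvH := differentiable_mulmx dv (dH Dx).
have dvHi := differentiable_mulmx dvH di.
have d0 : differentiable (cst 0 : 'rV[R]_n -> 'M[R]_1) x by exact: differentiable_cst.
rewrite /B.
rewrite (derive_block_mx u (dG v Dx) dHv (differentiableN dvHi) d0).
congr block_mx.
- by rewrite (derive_mulmx u (dH Dx) dvT) derive_cst mulmx0 addr0.
- rewrite (deriveN (diff_derivable dvHi)) (derive_mulmx u dvH di).
  rewrite (derive_mulmx u dv (dH Dx)) derive_cst mul0mx add0r.
  rewrite (derive_invmx u Do gsm gunit Dx) (metric_compatible Do gsm gsym gunit u Dx).
  congr (- (_ + _)); rewrite mulmxN; congr (- (_ *m _)).
  rewrite mulmxDr mulmxDl !mulmxA mulVmx ?gunit// mul1mx.
  by rewrite -!mulmxA mulmxV ?gunit// mulmx1.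
- exact: derive_cst.
Qed.

(** The blocks are the classical equations: Gauss in the upper left, Codazzi in the upper right, its
    transpose times the inverse metric in the lower left, and in the lower right the symmetry of
    [H x *m invmx (g x) *m H x]. *)
Lemma moving_frame_flat x u v : D x -> connection_curvature B x u v = 0.
Proof.
move=> Dx; rewrite /connection_curvature (derive_moving_frame u v Dx).
rewrite (derive_moving_frame v u Dx) /B !mulmx_block.
rewrite !(opp_block_mx, add_block_mx) -[RHS](@block_mx0 R n 1 n 1).
have gi : g x *m invmx (g x) = 1%:M by rewrite mulmxV ?gunit.
have GE : Om x u v = H x *m (v^T *m u - u^T *m v) *m H x *m invmx (g x).
  by rewrite -(gauss u v Dx) -mulmxA gi mulmx1.
have C := codazzi u v Dx; have CT := congr1 trmx C; rewrite /= in CT.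
move: CT; rewrite !trmx_add !trmx_mul !trmxK (derive_form_sym u Dx).
rewrite (derive_form_sym v Dx) (Hsym Dx) => CT.
have HS : v *m H x *m invmx (g x) *m (H x *m u^T) = u *m H x *m invmx (g x) *m (H x *m v^T).
  have isym : (invmx (g x))^T = invmx (g x) by rewrite trmx_inv (gsym Dx).
  have S : (H x *m invmx (g x) *m H x)^T = H x *m invmx (g x) *m H x.
    by rewrite !trmx_mul (Hsym Dx) isym mulmxA.
  by have := sym_form_swap v u S; rewrite !mulmxA.
move: GE C CT HS; rewrite /connection_curvature.
move: ('D_u (fun y => Gam y v) x) ('D_v (fun y => Gam y u) x) => a b.
move: ('D_u H x) ('D_v H x) (Gam x u) (Gam x v) (H x) (invmx (g x)).
move=> p q c d h i GE C CT HS; congr block_mx.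
- transitivity (a - b + d *m c - c *m d - h *m (v^T *m u - u^T *m v) *m h *m i).
    by mx_distr; mx_ring.
  by rewrite GE subrr.
- transitivity (p *m v^T + d *m h *m u^T - (q *m u^T + c *m h *m v^T)).
    by mx_distr; mx_ring.
  by rewrite C subrr.
- transitivity ((u *m q + v *m (h *m c^T) - (v *m p + u *m (h *m d^T))) *m i).
    by mx_distr; mx_ring.
  have -> : u *m q + v *m (h *m c^T) = v *m p + u *m (h *m d^T).
    by move: CT; mx_distr => ->.
  by rewrite subrr mul0mx.
- rewrite !mulNmx HS !mulmx0; mx_ring.
Qed.

(** Beyond the flatness of the frame, the position adds only [row_mx v 0 *m B x u = row_mx u 0 *m B
    x v], which is torsion-freeness together with the symmetry of [H]. *)
Lemma immersion_system_flat x u v : D x -> connection_curvature A x u v = 0.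
Proof.
move=> Dx; have F := moving_frame_flat u v Dx.
have dB w : differentiable (fun y => B y w) x.
  exact: smooth_differentiable (moving_frame_smooth w) Dx.
have DA w z : 'D_w (fun y => A y z) x = block_mx 0 0 0 ('D_w (fun y => B y z) x).
  have dc (m k : nat) (c : 'M[R]_(m, k)) : differentiable (cst c : 'rV[R]_n -> _) x.
    exact: differentiable_cst.
  rewrite /A (derive_block_mx w (dc _ _ 0) (dc _ _ (row_mx z 0)) (dc _ _ 0) (dB z)).
  by rewrite !derive_cst.
have AA w z : A x w *m A x z = block_mx 0 (row_mx w 0 *m B x z) 0 (B x w *m B x z).
  rewrite /A; move: (B x w) (B x z) => P Q.
  by rewrite mulmx_block !mul0mx !mulmx0 !(addr0, add0r).
have torsion : row_mx v 0 *m B x u = row_mx u 0 *m B x v.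
  rewrite /B !mul_row_block !mul0mx !addr0 (connection_torsion_free Do gsym u v Dx).
  by rewrite !mulmxA (sym_form_swap u v (Hsym Dx)).
move: F; rewrite /connection_curvature !DA !AA torsion.
move: ('D_u (B^~ v) x) ('D_v (B^~ u) x) (B x v *m B x u) (B x u *m B x v).
move: (row_mx u 0 *m B x v) => t p q a b F.
rewrite !(opp_block_mx, add_block_mx) !(oppr0, addr0, add0r) subrr F.
by rewrite /block_mx !row_mx0 col_mx0.
Qed.

Hypothesis gpos : forall x v, D x -> v != 0 -> 0 < bilin (g x) v v.

(** The Gram matrix that the tangent vectors and the normal should have. It satisfies the same
    linear equation as the actual Gram matrix [K x *m (K x)^T], by metric compatibility. *)
Let gram_target x : 'M[R]_(n + 1) := block_mx (g x) 0 0 1%:M.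

Let derive_gram_target x u : D x -> 'D_u gram_target x =
  B x u *m gram_target x + gram_target x *m (B x u)^T.
Proof.
move=> Dx; rewrite /gram_target.
have d0 m k (c : 'M[R]_(m, k)) : differentiable (cst c : 'rV[R]_n -> _) x.
  exact: differentiable_cst.
rewrite (derive_block_mx u (dg Dx) (d0 _ _ 0) (d0 _ _ 0) (d0 _ _ 1%:M)).
rewrite !derive_cst (metric_compatible Do gsm gsym gunit u Dx).
have isym : (invmx (g x))^T = invmx (g x) by rewrite trmx_inv (gsym Dx).
rewrite /B tr_block_mx !mulmx_block add_block_mx !(mulmx0, mul0mx, addr0, add0r).
rewrite !mulmx1 !mul1mx trmx_opp !trmx_mul !trmxK isym trmx0 (Hsym Dx).
have -> : - (u *m H x *m invmx (g x)) *m g x = - (u *m H x).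
  by rewrite mulNmx -(mulmxA (u *m H x)) mulVmx ?gunit// mulmx1.
have -> : g x *m - (invmx (g x) *m (H x *m u^T)) = - (H x *m u^T).
  by rewrite mulmxN mulmxA mulmxV ?gunit// mul1mx.
by rewrite subrr addNr.
Qed.

Theorem immersion_exists x0 : D x0 -> exists r (phi : 'rV[R]_n -> 'rV[R]_(n + 1))
    (J : 'rV[R]_n -> 'M[R]_(n, n + 1)),
  [/\ 0 < r, ball x0 r `<=` D, smooth (ball x0 r) phi /\ smooth (ball x0 r) J,
    forall x (v : 'rV[R]_n), ball x0 r x -> 'D_v phi x = v *m J x &
    forall x, ball x0 r x -> J x *m (J x)^T = g x].
Proof.
move=> Dx0; have [P PE] := cholesky (gsym Dx0) (fun v => @gpos x0 v Dx0).
(* Initial data at [x0]: tangent vectors in the first [n] coordinates with Gram matrix [g x0], and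
   the last basis vector as unit normal. The initial position, added below, is the origin. *)
pose K0 : 'M[R]_(n + 1) := block_mx P 0 0 1%:M.
have [r [F [r0 rD F0 Fsm FD]]] := frobenius (col_mx 0 K0 : 'M[R]_(1 + (n + 1), n + 1))
  Do Dx0 immersion_system_linear immersion_system_smooth immersion_system_flat.
have Bo : open (ball x0 r) by exact: ball_open.
have dF x : ball x0 r x -> differentiable F x by exact: smooth_differentiable.
pose K x : 'M[R]_(n + 1) := row_mx 0 1%:M *m F x.
pose phi x : 'rV[R]_(n + 1) := row_mx 1%:M 0 *m F x.
pose J x : 'M[R]_(n, n + 1) := row_mx 1%:M 0 *m K x.
have FE x : F x = col_mx (phi x) (K x).
  by rewrite /phi /K -[F x]vsubmxK !mul_row_col !mul1mx !mul0mx addr0 add0r.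
have cF m (c : 'M[R]_(m, 1 + (n + 1))) : smooth (ball x0 r) (fun x => c *m F x).
  by move=> k; exact: (Ck_mulmx Bo (@Ck_cst _ _ _ _ _ c) (Fsm k)).
have DcF m (c : 'M[R]_(m, 1 + (n + 1))) x v : ball x0 r x ->
    'D_v (fun x => c *m F x) x = c *m (A x v *m F x).
  move=> Bx; have dc : differentiable (cst c : 'rV[R]_n -> _) x by exact: differentiable_cst.
  by rewrite (derive_mulmx v dc (dF x Bx)) derive_cst mul0mx add0r FD.
have DK x v : ball x0 r x -> 'D_v K x = B x v *m K x.
  move=> Bx; rewrite (DcF _ (row_mx 0 1%:M) x v Bx) FE /A.
  move: (B x v) (K x) (phi x) => b k p.
  by rewrite mul_block_col mul_row_col !mul0mx mul1mx !add0r.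
have Kt x : K x = col_mx (J x) (row_mx 0 1%:M *m K x).
  by rewrite /J -[in LHS](mul1mx (K x)) -mul_col_mx -block_mxEv -scalar_mx_block.
have Dphi x v : ball x0 r x -> 'D_v phi x = v *m J x.
  move=> Bx; rewrite (DcF _ (row_mx 1%:M 0) x v Bx) FE /A.
  move: (B x v) (phi x) => b p.
  rewrite mul_block_col mul_row_col !mul0mx mul1mx !add0r addr0.
  by rewrite [in LHS]Kt mul_row_col mul0mx addr0.
have Ksm : smooth (ball x0 r) K by exact: cF.
have dK x : ball x0 r x -> differentiable K x by exact: smooth_differentiable.
pose E x := K x *m (K x)^T - gram_target x.
have DE x v : ball x0 r x -> differentiable E x /\ 'D_v E x = B x v *m E x + E x *m (B x v)^T.
  move=> Bx; have dKT := differentiable_trmx (dK x Bx).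
  have dKK := differentiable_mulmx (dK x Bx) dKT.
  have dt : differentiable gram_target x.
    have tsm : smooth D gram_target.
      by move=> k; apply: (Ck_block_mx Do) => //; exact: Ck_cst.
    exact: smooth_differentiable tsm (rD x Bx).
  split; first exact: differentiableB.
  rewrite (deriveB (diff_derivable dKK) (diff_derivable dt)).
  rewrite (derive_mulmx v (dK x Bx) dKT) (derive_trmx v (dK x Bx)) (DK x v Bx).
  rewrite (derive_gram_target v (rD x Bx)) /E (trmx_mul (B x v) (K x)).
  move: (B x v) (K x) (gram_target x) => b k t.
  by mx_distr; mx_ring.
have E0 : E x0 = 0.
  have Kx0 : K x0 = K0 by rewrite /K F0 mul_row_col mul0mx mul1mx add0r.
  rewrite /E Kx0 /K0 tr_block_mx !trmx0 trmx1 mulmx_block !(mulmx0, mul0mx, addr0, add0r).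
  by rewrite PE mulmx1 subrr.
have [r' [C [[r'0 C0 r'D] [BC _ _]]]] := coef_bounds Do moving_frame_linear
  moving_frame_smooth Dx0.
(* The equation for [E] has a left and a right product with [B]. This radius bounds each of them by
   a quarter of the norm of [E], which gives the factor [2^-1] of [gronwall_small]. *)
pose N : R := (n + 1)%:R; pose s := (4 * N * C)^-1.
have N0 : 0 < N by rewrite /N ltr0n addn1.
have s0 : 0 < s by rewrite invr_gt0 !mulr_gt0.
have norm_tr (a b : nat) (M : 'M[R]_(a, b)) : `|M^T| <= `|M|.
  by apply: mx_norm_le => [|i j]; rewrite ?normr_ge0// mxE mx_entry_le.
pose r1 := Num.min r (Num.min r' s).
have [r1r r1r' r1s] : [/\ r1 <= r, r1 <= r' & r1 <= s].
  by rewrite /r1 !ge_min !lexx !orbT.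
have r10 : 0 < r1 by rewrite /r1 !lt_min r0 r'0 s0.
have sub1 : ball x0 r1 `<=` ball x0 r by exact: le_ball.
exists r1, phi, J; split => //.
- exact: subset_trans sub1 rD.
- have o1 : open (ball x0 r1) by exact: ball_open.
  split=> k; first exact: Ck_sub sub1 (cF _ _ k).
  apply: Ck_sub sub1 _; exact: (Ck_mulmx Bo (@Ck_cst _ _ _ _ _ (row_mx 1%:M 0)) (Ksm k)).
- by move=> x v /sub1; exact: Dphi.
move=> x Bx; pose v := x - x0.
have vr : `|v| < r1 by rewrite /v -normrN opprB; move: Bx; rewrite -ball_normE.
have Bt (t : R) : 0 <= t <= 1 -> ball x0 r1 (x0 + t *: v).
  move=> /andP[t0 t1]; rewrite -ball_normE /= opprD addNKr normrN normrZ ger0_norm//.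
  by rewrite (le_lt_trans _ vr)// ler_piMl.
suff Ex : E x = 0.
  have : row_mx 1%:M 0 *m E x *m (row_mx 1%:M 0)^T = 0 by rewrite Ex mulmx0 mul0mx.
  rewrite /E mulmxBr mulmxBl => /eqP; rewrite subr_eq0 => /eqP.
  rewrite /gram_target tr_row_mx trmx1 trmx0 mul_row_block.
  rewrite !mul1mx !mul0mx !addr0 mul_row_col mulmx1 mul0mx addr0 => <-.
  by rewrite /J trmx_mul tr_row_mx trmx1 trmx0 !mulmxA.
apply/eqP; rewrite -normr_le0.
have zd (t : R) : 0 <= t <= 1 -> is_derive t 1 (fun t => E (x0 + t *: v))
    (B (x0 + t *: v) v *m E (x0 + t *: v) + E (x0 + t *: v) *m (B (x0 + t *: v) v)^T).
  by move=> /Bt/sub1 Bxt; have [dE <-] := DE _ v Bxt; exact: is_derive_line.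
have /= := @gronwall_small _ _ _ (fun t => E (x0 + t *: v)) _ 0 (lexx 0) _ _ _ _ 1.
have xE : x0 + 1 *: v = x by rewrite scale1r /v addrC subrK.
rewrite mulr0 xE; apply.
- by rewrite scale0r addr0.
- apply: continuous_in_subspaceT => t; rewrite inE /= in_itv /= => t01.
  exact: derivable_continuous (zd t t01).
- by move=> t /andP[t0 t1]; apply: zd; rewrite !ltW.
- move=> t /andP[t0 t1]; rewrite addr0.
  have Bxt : ball x0 r1 (x0 + t *: v) by apply: Bt; rewrite !ltW.
  move: (E (x0 + t *: v)) => e.
  have bC : `|B (x0 + t *: v) v| <= C * s.
    have Br' : ball x0 r' (x0 + t *: v) by exact: le_ball Bxt.
    by rewrite (le_trans (BC _ v Br'))// ler_pM2l// ltW// (lt_le_trans vr).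
  move: (B (x0 + t *: v) v) bC => b bC.
  rewrite (le_trans (ler_normD _ _))//.
  have h1 := mx_norm_mul b e; have h2 := mx_norm_mul e b^T; have h3 := norm_tr _ _ b.
  have e0 := normr_ge0 e.
  have Cs : C * s * N = 4^-1 by rewrite /s; field; rewrite !gt_eqF.
  have p1 : `|b| * (N * `|e|) <= C * s * (N * `|e|) by rewrite ler_wpM2r// mulr_ge0// ltW.
  have p2 : `|b^T| * (N * `|e|) <= `|b| * (N * `|e|) by rewrite ler_wpM2r// mulr_ge0// ltW.
  have p3 : C * s * (N * `|e|) = 4^-1 * `|e| by rewrite mulrA Cs.
  rewrite -/N in h1 h2; lra.
- by rewrite ler01 lexx.
Qed.

End FundamentalTheorem.

(** * From immersions to embeddings *)

Section ImmersionInverse.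
Context {R : realType} {n N : nat}.

Lemma ball_segment (x0 p q : 'rV[R]_n) r (t : R) : 0 <= t <= 1 ->
  ball x0 r p -> ball x0 r q -> ball x0 r (p + t *: (q - p)).
Proof.
move=> /andP[t0 t1]; rewrite -ball_normE /= => pr qr.
have -> : x0 - (p + t *: (q - p)) = (1 - t) *: (x0 - p) + t *: (x0 - q).
  rewrite !scalerBr !scalerBl !scale1r !opprD opprK.
  by apply/matrixP => i j; rewrite !mxE; ring.
rewrite (le_lt_trans (ler_normD _ _))// !normrZ !ger0_norm ?subr_ge0//.
have [->|tn] := eqVneq t 0; first by rewrite subr0 mul1r mul0r addr0.
have t0' : 0 < t by rewrite lt_neqAle eq_sym tn.
have h1 : (1 - t) * `|x0 - p| <= (1 - t) * r by rewrite ler_wpM2l ?subr_ge0// ltW.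
have h2 : t * `|x0 - q| < t * r by rewrite ltr_pM2l.
by lra.
Qed.

(** [L] is a right inverse of the differential at [x0], so [phi z *m L - z] has a small differential
    nearby and is Lipschitz with constant one half. Absorbing that half on the left yields
    injectivity and a Lipschitz inverse on the image. *)
Lemma immersion_lipschitz_inverse (phi : 'rV[R]_n -> 'rV[R]_N)
    (J : 'rV[R]_n -> 'M[R]_(n, N)) (L : 'M[R]_(N, n)) x0 r : 0 < r ->
  (forall x, ball x0 r x -> differentiable phi x) ->
  (forall x (v : 'rV[R]_n), ball x0 r x -> 'D_v phi x = v *m J x) ->
  Ck 0 (ball x0 r) J -> J x0 *m L = 1%:M ->
  exists r1 C : R, [/\ 0 < r1, r1 <= r, 0 < C & forall x y,
    ball x0 r1 x -> ball x0 r1 y -> `|x - y| <= C * `|phi x - phi y|].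
Proof.
move=> r0 dphi Dphi Jc JL.
have Bo : open (ball x0 r) by exact: ball_open.
have JLc : {for x0, continuous (fun x => J x *m L)}.
  have := Ck_mulmx Bo Jc (@Ck_cst _ _ _ 0 _ L).
  by apply; exact: ballxx.
(* Chosen so that [n%:R * e] is at most one half, where [n] is the factor lost in the norm of a
   product; the successor keeps it meaningful for [n = 0]. *)
pose e : R := (2 * n.+1%:R)^-1.
have e0 : 0 < e by rewrite invr_gt0 mulr_gt0// ltr0n.
move/cvgrPdist_le : JLc => /(_ e e0) /nbhs_ballP[r' /= r'0 r'J].
pose r1 := Num.min r r'; pose C := 2 * N%:R * `|L| + 1.
have C0 : 0 < C by rewrite /C ltr_wpDl// !mulr_ge0.
exists r1, C; split => //; [by rewrite /r1 lt_min r0|by rewrite /r1 ge_min lexx|].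
have sr : ball x0 r1 `<=` ball x0 r by apply: le_ball; rewrite /r1 ge_min lexx.
have sr' : ball x0 r1 `<=` ball x0 r'.
  by apply: le_ball; rewrite /r1 ge_min lexx orbT.
move=> x y Bx By; pose psi z := phi z *m L - z.
have dpsi z v : ball x0 r1 z -> differentiable psi z /\ `|'D_v psi z| <= 2^-1 * `|v|.
  move=> Bz; have dz := dphi z (sr _ Bz).
  have dL : differentiable (cst L : 'rV[R]_n -> _) z by exact: differentiable_cst.
  have dpL := differentiable_mulmx dz dL.
  have did : differentiable (id : 'rV[R]_n -> 'rV[R]_n) z by exact: ex_diff.
  split; first exact: differentiableB.
  rewrite (deriveB (diff_derivable dpL) (diff_derivable did)).
  rewrite (derive_mulmx v dz dL) derive_cst mulmx0 addr0 derive_id (Dphi z v (sr _ Bz)).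
  have -> : v *m J z *m L - v = v *m (J z *m L - 1%:M).
    by rewrite mulmxBr mulmx1 mulmxA.
  have h := r'J z (sr' _ Bz); rewrite /= JL distrC in h.
  rewrite (le_trans (mx_norm_mul _ _))//.
  have h2 : n%:R * `|v| * `|J z *m L - 1%:M| <= n%:R * `|v| * e by rewrite ler_wpM2l ?mulr_ge0.
  apply: (le_trans h2); rewrite mulrAC ler_wpM2r//.
  rewrite /e invfM mulrCA mulrC -[leRHS]mul1r ler_wpM2r ?invr_ge0//.
  by rewrite ler_pdivrMr ?ltr0n// mul1r ler_nat.
have S : `|psi y - psi x| <= 2^-1 * `|y - x|.
  have -> : psi y = psi (x + (y - x)) by rewrite addrC subrK.
  have Bt (t : R) : 0 <= t <= 1 -> ball x0 r1 (x + t *: (y - x)).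
    by move=> t01; exact: ball_segment.
  apply: mean_value_segment; first by rewrite mulr_ge0 ?invr_ge0.
    by move=> t /Bt Bxt; have [] := dpsi _ 0 Bxt.
  by move=> t /Bt Bxt; have [] := dpsi _ (y - x) Bxt.
have E : x - y = (phi x - phi y) *m L + (psi y - psi x).
  by rewrite /psi mulmxBl; apply/matrixP => i j; rewrite !mx_entryE; ring.
have T := ler_normD ((phi x - phi y) *m L) (psi y - psi x); rewrite -E in T.
have M := mx_norm_mul (phi x - phi y) L.
rewrite [`|y - x|]distrC in S.
have p0 := normr_ge0 (phi x - phi y).
have : C * `|phi x - phi y| = 2 * (N%:R * `|phi x - phi y| * `|L|) + `|phi x - phi y|.
  by rewrite /C; ring.
by lra.
Qed.

End ImmersionInverse.

Section LocalEmbedding.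
Context {R : realType} {M : smoothManifold R 3} {g : riemannianMetric M}.

(** The isometry is known in the chart [c0] only. For another chart the map factors through the
    transition to [c0], and [gram_compatible] carries the identity over. The differential is
    injective because the metric is positive definite. *)
Lemma immersion_local_embedding N (c0 : @chart R M 3) x0 r
    (phi : 'rV[R]_3 -> 'rV[R]_N) (J : 'rV[R]_3 -> 'M[R]_(3, N)) : atlas c0 -> 0 < r ->
  ball x0 r `<=` chart_coord c0 @` chart_dom c0 ->
  smooth (ball x0 r) phi -> smooth (ball x0 r) J ->
  (forall x (v : 'rV[R]_3), ball x0 r x -> 'D_v phi x = v *m J x) ->
  (forall x, ball x0 r x -> J x *m (J x)^T = gram g c0 x) ->
  exists U : set M, [/\ open U, U (chart_param c0 x0) &
    exists f : M -> 'rV[R]_N, isometric_embedding g U f].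
Proof.
move=> c0a r0 rD phism Jsm Dphi JJ.
have B0 : ball x0 r x0 by exact: ballxx.
have JL : J x0 *m ((J x0)^T *m invmx (gram g c0 x0)) = 1%:M.
  by rewrite mulmxA (JJ x0 B0) mulmxV// gram_unit//; exact: rD.
have dphi x : ball x0 r x -> differentiable phi x by exact: smooth_differentiable.
have [s [C [s0 sr C0 lip]]] := immersion_lipschitz_inverse r0 dphi Dphi (Jsm 0%N) JL.
have sB : ball x0 s `<=` ball x0 r by exact: le_ball.
have so : open (ball x0 s) by exact: ball_open.
pose U : set M := chart_dom c0 `&` chart_coord c0 @^-1` ball x0 s.
pose f p := phi (chart_coord c0 p).
have [p0 cp0 px0] := rD x0 B0.
have Uo : open U.
  rewrite openE => p [cp Bp]; apply: filterI.
    by apply: open_nbhs_nbhs; split => //; exact: chart_dom_open.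
  by apply: (chart_coord_continuous cp); apply: open_nbhs_nbhs.
have U0 : U (chart_param c0 x0).
  by rewrite -px0 chart_coordK//; split => //=; rewrite px0; exact: ballxx.
exists U; split => //; exists f.
have chartP c x : atlas c -> (chart_coord c @` (chart_dom c `&` U)) x ->
    overlap c c0 x /\ ball x0 s (transition c c0 x).
  move=> ca [p [cp [c0p Bp]] <-]; split; first by exists p.
  by rewrite /transition /= chart_coordK.
have imo (c : @chart R M 3) : open (chart_coord c @` (chart_dom c `&` U)).
  by rewrite openE => _ [p [cp Up] <-]; exact: nbhs_chart_image.
have tsm c : atlas c -> smooth (chart_coord c @` (chart_dom c `&` U)) (transition c c0).
  move=> ca k; apply: Ck_sub (atlas_compatible ca c0a k) => x /(chartP c x ca) [+ _].
  exact.
have Df c x v : atlas c -> (chart_coord c @` (chart_dom c `&` U)) x ->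
    'D_v (f \o chart_param c) x = 'D_v (transition c c0) x *m J (transition c c0 x).
  move=> ca cx; have [_ Bx] := chartP c x ca cx.
  have dt := smooth_differentiable (tsm c ca) cx.
  have := derive_chain v dt (dphi _ (sB _ Bx)).
  by rewrite (Dphi _ _ (sB _ Bx)).
have iso c x v w : atlas c -> (chart_coord c @` (chart_dom c `&` U)) x ->
    dot ('D_v (f \o chart_param c) x) ('D_w (f \o chart_param c) x) =
    bilin (gram g c x) v w.
  move=> ca cx; have [ox Bx] := chartP c x ca cx.
  rewrite (Df c x v ca cx) (Df c x w ca cx) (gram_compatible g v w ca c0a ox).
  by rewrite -(JJ _ (sB _ Bx)) /dot /bilin trmx_mul !mulmxA.
split; last by [].
split.
- move=> c ca k; have := Ck_comp (imo c) _ (tsm c ca k) (Ck_sub sB (phism k)).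
  by apply => x /(chartP c x ca) [].
- move=> c x v ca cx Dv0; apply/eqP; apply: contraT => v0.
  have cx' : (chart_coord c @` chart_dom c) x by case: cx => p [cp _] <-; exists p.
  by have := gram_pos g ca cx' v0; rewrite -(iso c x v v ca cx) Dv0 /dot mul0mx mxE ltxx.
(* The inverse is a chosen preimage, with default [0] off the image. The Lipschitz estimate [lip]
   makes this preimage unique and continuous on the image. *)
pose k y : 'rV[R]_3 := xget 0 [set x | ball x0 s x /\ phi x = y].
have kP x : ball x0 s x -> k (phi x) = x.
  move=> Bx; rewrite /k; case: xgetP => [z _ [Bz pz]|/(_ x)]; last by case.
  apply/eqP; rewrite -subr_eq0 -normr_le0.
  by rewrite (le_trans (lip z x Bz Bx))// pz subrr normr0 mulr0.
exists (chart_param c0 \o k); split.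
  by move=> p [cp Bp]; rewrite /f /= kP// chart_coordK.
apply/subspace_continuousP => _ [p [cp Bp] <-].
have cI : (chart_coord c0 @` chart_dom c0) (k (f p)) by rewrite /f kP//; exists p.
have kc : k y @[y --> within (f @` U) (nbhs (f p))] --> k (f p).
  apply/cvgrPdist_le => e e0; rewrite near_withinE.
  apply/nbhs_ballP; exists (e / C); first by rewrite /= divr_gt0.
  move=> y; rewrite -ball_normE /= => fpy [q [cq Bq] qy].
  rewrite -qy /f !kP// (le_trans (lip _ _ Bp Bq))// mulrC -ler_pdivlMr//.
  by rewrite -/(f p) -/(f q) qy ltW.
exact: cvg_comp kc (chart_param_continuous cI).
Qed.

End LocalEmbedding.

Theorem theorem1p1 (R : realType) (M : smoothManifold R 3)
    (g : riemannianMetric M) :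
  simply_connected R M ->
  holds_everywhere g (fun G X x => \det (Rtilde G X x) != 0) ->
  (locally_isometrically_embeddable g 4 <->
   (holds_everywhere g (fun G X x => 0 < \det (Rtilde G X x)) /\
    holds_everywhere g (fun G X x =>
      [/\ r1 G X x = 0, r2 G X x = 0 & r3 G X x = 0] /\
      [/\ r4 G X x = 0, r5 G X x = 0 & r6 G X x = 0]))).
Proof.
move=> _ det_neq0; split=> [emb|[det_gt0 rz]].
  split=> c A X ca AX x Ax;
    have [h [T [hs T12 T23 gauss dgauss]]] := embedded_frame_point emb ca AX Ax.
    (* The determinant is a square by Gauss, and nonzero by assumption. *)
    rewrite lt_neqAle eq_sym (det_neq0 c A X ca AX x Ax) /=.
    by rewrite (det_Rtilde_gauss hs gauss) sqr_ge0.
  exact: rivertz_gauss_codazzi hs T12 T23 gauss dgauss.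
move=> p; have [c ca cp] := atlas_cover p.
pose D := chart_coord c @` chart_dom c.
have Do : open D by exact: chart_image_open.
(* The conditions are given for every local frame; the coordinate frame of one chart around [p] is
   the instance from which the form [H] is built. *)
have frame0 : local_frame c D coordinate_frame.
  split=> // [i k|x _]; first exact: Ck_cst.
  have -> : \matrix_i coordinate_frame i x = 1%:M :> 'M[R]_3.
    by apply/matrixP => i j; rewrite !mxE eq_sym.
  by rewrite unitmx1.
have gsm : smooth D (gram g c) by exact: gram_smooth.
have gsym x : D x -> (gram g c x)^T = gram g c x by exact: gram_sym.
have gunit x : D x -> gram g c x \in unitmx by exact: gram_unit.
have det0 x : D x -> 0 < \det (Rtilde (gram g c) coordinate_frame x).
  by move=> Dx; exact: det_gt0 ca frame0 x Dx.
have r123 x (Dx : D x) := (rz c D coordinate_frame ca frame0 x Dx).1.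
have r456 x (Dx : D x) := (rz c D coordinate_frame ca frame0 x Dx).2.
have Dp : D (chart_coord c p) by exists p.
have [r [phi [J [r0 rD [phism Jsm] Dphi JJ]]]] := immersion_exists Do gsm gsym gunit
  (rivertz_form_smooth Do gsm gunit det0) (fun x _ => rivertz_form_sym (gram g c) x)
  (rivertz_gauss_mx Do gsm gsym gunit det0)
  (rivertz_codazzi_mx Do gsm gsym gunit det0 r123 r456)
  (fun x v Dx => gram_pos g ca Dx) Dp.
have [U [Uo Up Uf]] := immersion_local_embedding ca r0 rD phism Jsm Dphi JJ.
by exists U; split => //; rewrite -(chart_coordK cp).
Qed.
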